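(* Let $0<\alpha<1$, $f\in C^\infty(\mathbb{R})$ and $\varepsilon>0$. Let $u_0^\varepsilon,v_0^\varepsilon\in L^\infty(\mathbb{R})$ with $u_0^\varepsilon-v_0^\varepsilon\in L^1(\mathbb{R})$, and let $u^\varepsilon$ and $v^\varepsilon$ be the mild solutions on $(0,\infty)\times\mathbb{R}$ of $$\partial_t w+\partial_x f(w)=\varepsilon\,\partial_x\mathcal{D}^\alpha[w]$$ with initial data $u_0^\varepsilon$ and $v_0^\varepsilon$ respectively. Then for all $t\in(0,\infty)$, $u^\varepsilon(t,\cdot)-v^\varepsilon(t,\cdot)\in L^1(\mathbb{R})$ and $$\|u^\varepsilon(t,\cdot)-v^\varepsilon(t,\cdot)\|_{L^1(\mathbb{R})}\le\|u_0^\varepsilon-v_0^\varepsilon\|_{L^1(\mathbb{R})}.$$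
   Context: For $0<\alpha<1$, $\mathcal{D}^\alpha[g](x)=\frac{1}{\Gamma(1-\alpha)}\int_{-\infty}^x\frac{g'(z)}{(x-z)^\alpha}\,dz$, acting on the $x$ variable only; $\partial_x\mathcal{D}^\alpha$ has Fourier symbol $(i\xi)^{\alpha+1}=|\xi|^{\alpha+1}e^{i\,\mathrm{sgn}(\xi)(\alpha+1)\pi/2}$. Kernel: $K(t,x)=\frac{1}{2\pi}\int_{\mathbb{R}}e^{(i\xi)^{\alpha+1}t}e^{ix\xi}\,d\xi$ for $t>0$, $x\in\mathbb{R}$. Mild solution with initial datum $w_0\in L^\infty(\mathbb{R})$ on $(0,T)\times\mathbb{R}$, $T\in(0,\infty]$: a function $w\in L^\infty((0,T)\times\mathbb{R})$ such that for a.e. $(t,x)\in(0,T)\times\mathbb{R}$ $$w(t,x)=\big(K(\varepsilon t,\cdot)*w_0\big)(x)-\int_0^t\big(\partial_xK(\varepsilon(t-s),\cdot)*f(w(s,\cdot))\big)(x)\,ds .$$ For each $w_0\in L^\infty(\mathbb{R})$ there is a mild solution on $(0,\infty)\times\mathbb{R}$; it is smooth for $t>0$ (and $w(t,\cdot)$ denotes this smooth representative). *)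

(* Defs.v *)
From HB Require Import structures.
From mathcomp Require Import all_boot all_order all_algebra.
From mathcomp Require Import all_classical all_reals all_analysis.
From mathcomp Require Import measurable_realfun complex.

Set Implicit Arguments.
Unset Strict Implicit.
Unset Printing Implicit Defensive.

Import Order.TTheory GRing.Theory Num.Theory.
Import numFieldNormedType.Exports.

Local Open Scope classical_set_scope.
Local Open Scope ring_scope.
Local Open Scope complex_scope.

Section Definitions.
Context {R : realType}.

Local Notation leb := (@lebesgue_measure R).
Local Notation leb2 := (leb \x leb)%E.

Definition cexp (z : R[i]) : R[i] :=
  (expR (complex.Re z))%:C * (cos (complex.Im z) +i* sin (complex.Im z)).

Definition cintegral (g : R -> R[i]) : R[i] :=
  (\int[leb]_(x in setT) complex.Re (g x)) +i*
  (\int[leb]_(x in setT) complex.Im (g x)).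

(* The principal value of (i xi)^(alpha + 1), that is
   |xi|^(alpha + 1) exp(i sgn(xi) (alpha + 1) pi / 2). *)
Definition symbol (alpha xi : R) : R[i] :=
  (`|xi| `^ (alpha + 1))%:C *
  cexp ('i * (Num.sg xi * ((alpha + 1) * pi / 2))%:C).

Definition ckernel (alpha t x : R) : R[i] :=
  ((2 * pi)^-1)%:C *
  cintegral (fun xi => cexp (symbol alpha xi * t%:C) * cexp ('i * (x * xi)%:C)).

(* The kernel is real-valued: see [ckernelE] below. *)
Definition kernel (alpha t x : R) : R := complex.Re (ckernel alpha t x).

Lemma symbolE (alpha xi : R) :
  symbol alpha xi =
  (`|xi| `^ (alpha + 1) * cos (Num.sg xi * ((alpha + 1) * pi / 2))) +i*
  (`|xi| `^ (alpha + 1) * sin (Num.sg xi * ((alpha + 1) * pi / 2))).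
Proof.
rewrite /symbol; set theta := Num.sg xi * _; move: theta => theta.
by rewrite /cexp; simpc; rewrite /= expR0 !mul1r.
Qed.

Lemma Im_integrandE (alpha t x xi : R) :
  complex.Im (cexp (symbol alpha xi * t%:C) * cexp ('i * (x * xi)%:C)) =
  expR (`|xi| `^ (alpha + 1) *
        cos (Num.sg xi * ((alpha + 1) * pi / 2)) * t) *
  sin (`|xi| `^ (alpha + 1) *
       sin (Num.sg xi * ((alpha + 1) * pi / 2)) * t + x * xi).
Proof.
rewrite symbolE; set a := _ * cos _; set b := _ * sin _.
move: a b => a b; rewrite /cexp; simpc; rewrite /= expR0 !mul1r sinD.
by rewrite addrC mulrDr !mulrA.
Qed.

Lemma Im_integrand_odd (alpha t x xi : R) :
  complex.Im (cexp (symbol alpha (- xi) * t%:C) * cexp ('i * (x * - xi)%:C)) =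
  - complex.Im (cexp (symbol alpha xi * t%:C) * cexp ('i * (x * xi)%:C)).
Proof.
rewrite !Im_integrandE normrN sgrN mulNr cosN sinN mulrN mulNr mulrN -opprD.
by rewrite sinN mulrN.
Qed.

Lemma measurable_sg : measurable_fun [set: R] (@Num.sg R).
Proof.
rewrite (_ : @Num.sg R = fun x => if x == 0 then 0 else if x < 0 then -1 else 1).
  apply: measurable_fun_ifT => //; first exact: measurable_fun_eqr.
  apply: measurable_fun_ifT => //; exact: measurable_fun_ltr.
by apply/funext => x; case: sgrP.
Qed.

Lemma measurable_Im_integrand (alpha t x : R) :
  measurable_fun [set: R] (fun xi =>
    complex.Im (cexp (symbol alpha xi * t%:C) * cexp ('i * (x * xi)%:C))).
Proof.
under eq_fun do rewrite Im_integrandE.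
have mpow : measurable_fun [set: R] (fun xi : R => `|xi| `^ (alpha + 1)).
  by apply: (measurableT_comp (measurable_powR (alpha + 1))).
have msg : measurable_fun [set: R]
    (fun xi : R => Num.sg xi * ((alpha + 1) * pi / 2)).
  by apply: measurable_funM => //; exact: measurable_sg.
have mcos : measurable_fun [set: R] (@cos R).
  by apply: continuous_measurable_fun; exact: continuous_cos.
have msin : measurable_fun [set: R] (@sin R).
  by apply: continuous_measurable_fun; exact: continuous_sin.
apply: measurable_funM.
  apply: (measurableT_comp (@measurable_expR R)).
  apply: measurable_funM => //; apply: measurable_funM => //.
  exact: (measurableT_comp mcos).
apply: (measurableT_comp msin); apply: measurable_funD.
  apply: measurable_funM => //; apply: measurable_funM => //.
  exact: (measurableT_comp msin).
exact: measurable_funM.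
Qed.

Lemma Rintegral_odd (g : R -> R) : measurable_fun [set: R] g ->
  (forall x, g (- x) = - g x) -> \int[leb]_(x in setT) g x = 0.
Proof.
move=> mg g_odd; pose G x := (g x)%:E.
have mG : measurable_fun [set: R] G by exact/measurable_EFinP.
rewrite /Rintegral integralE.
have -> : (\int[leb]_(x in setT) G^\- x = \int[leb]_(x in setT) G^\+ x)%E.
  transitivity (\int[leb]_(x in setT) (G^\+ (- x)%R))%E.
    by apply: eq_integral => x _; rewrite funenegE funeposE /G g_odd.
  transitivity (\int[pushforward leb (-%R : R -> measurableTypeR R)]_(x in setT)
      G^\+ x)%E.
    rewrite ge0_integral_pushforward// ?preimage_setT//.
    exact: measurable_funepos.
  by apply: eq_measure_integral => A mA _; exact: lebesgue_measureN.
by case: (\int[leb]_(x in setT) G^\+ x)%E => //= r; rewrite subrr.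
Qed.

Lemma ckernelE (alpha t x : R) : ckernel alpha t x = (kernel alpha t x)%:C.
Proof.
rewrite /kernel /ckernel /cintegral (@Rintegral_odd (fun xi => complex.Im _)).
- by simpc; rewrite /= mulr0.
- exact: measurable_Im_integrand.
- by move=> xi; exact: Im_integrand_odd.
Qed.

Definition conv (g h : R -> R) (x : R) : R :=
  \int[leb]_(y in setT) (g (x - y) * h y).

Definition strip (T : \bar R) : set (R * R) :=
  [set p | 0 < p.1 /\ (p.1%:E < T)%E].

(* Elements of L^oo are given by Borel representatives, so [w] is only
   relevant up to a null set of [strip T]. *)
Definition mild_solution (alpha eps : R) (f : R -> R) (T : \bar R)
    (w0 : R -> R) (w : R -> R -> R) : Prop :=
  (fun p => w p.1 p.2) \_ (strip T) \in Lfun leb2 +oo%E /\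
  {ae leb2, forall p : R * R, strip T p ->
    w p.1 p.2 = conv (kernel alpha (eps * p.1)) w0 p.2
      - \int[leb]_(s in `]0, p.1[)
          conv (derive1 (kernel alpha (eps * (p.1 - s)))) (f \o w s) p.2}.

Definition smooth (f : R -> R) : Prop :=
  forall n x, derivable (derive1n n f) x 1.

(* Meant for open [D]: both partial derivatives are iterated in any order. *)
Fixpoint Cn_on (D : set (R * R)) (n : nat) (g : R * R -> R) : Prop :=
  (forall p, D p -> {for p, continuous g}) /\
  if n is m.+1 then
    [/\ forall p, D p -> derivable g p (1, 0) /\ derivable g p (0, 1),
        Cn_on D m ('D_(1, 0) g) & Cn_on D m ('D_(0, 1) g)]
  else True.

Definition smooth_on (D : set (R * R)) (g : R * R -> R) : Prop :=
  forall n, Cn_on D n g.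

End Definitions.

(* Main.v *)
(* The kernel [K] is nonnegative with unit mass: its symbol is the limit of characteristic functions of
   random walks whose step weights are the binomial coefficients of [(1 - z)^(alpha + 1)]. It is a
   semigroup in [t], and by scaling [d_x K(t, .)] has [L^1] norm [c t^(- 1 / (alpha + 1))], integrable at
   [t = 0]. Hence for [lam] large [W = exp(- lam t) (u - v)] solves [W = h - Q * (a W)] in the plane, where
   [h = k * w0], [k = exp(- lam t) K(eps t, .)], [Q = d_x k], [a] is the bounded slope of [f] between [u] and
   [v], [|a| <= L], and [L ||Q||_1 <= 1/4]; a Neumann series shows that [W] is integrable.

   Replace [d_x] by upwind (Lax-Friedrichs) difference quotients of mesh [dx] and absorb the diagonal term
   [- (L / dx) W] into a damping [exp(- (L / dx) t)] of [k]. The remaining coefficients are nonnegative, and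
   by induction every Picard iterate has [L^1] norm in [x] at most [exp(- lam t) ||w0||_1] at each time [t].
   The resolvent identity turns the damped iteration back into a discretization of the equation of [W], so
   the iterates tend to [W] in [L^1] of the plane as [dx -> 0]. This gives the contraction for almost every
   time, and continuity of [u - v] together with Fatou's lemma extends it to every time. *)
Require Import Defs.
From HB Require Import structures.
From mathcomp Require Import all_boot all_order all_algebra.
From mathcomp Require Import all_classical all_reals all_analysis.
From mathcomp Require Import measurable_realfun complex ring lra.

Set Implicit Arguments.
Unset Strict Implicit.
Unset Printing Implicit Defensive.

Import Order.TTheory GRing.Theory Num.Theory.
Import numFieldNormedType.Exports.

Local Open Scope classical_set_scope.
Local Open Scope ring_scope.

(** * Invariance of Lebesgue measure under translation, reflection and scaling *)

Section invariance.
Context {R : realType}.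
Local Notation leb := (@lebesgue_measure R).
Local Notation leb2 := (leb \x leb)%E.
Local Open Scope ereal_scope.

(** The kernel [Q] changes sign, so an estimate through [|Q|] multiplies the norm of the datum by a
    constant above 1: good enough for integrability, never for contraction. Upwinding trades [Q] for
    the nonnegative [k]. An upwind step costs at most a factor [L / dx], and the damping pays back
    exactly this amount, so the constant 1 survives on every mesh. As an iteration, however, the
    scheme contracts only with ratio [(L / dx) / (lam + L / dx)], which degenerates as [dx -> 0].
    Closeness to [W] is therefore read off the undamped equation, where the difference quotients of
    [k] are near [Q] in [L^1] and their norm times [L] stays below 1/2; the gap between 1/4 and 1/2
    pays for the discretization. The weight [exp(- lam t)] makes [k] and [Q] integrable in the
    plane, so one Young inequality in space-time serves everywhere, the initial datum entering as a
    source carried by the line [t = 0]. Convolutions of integrable functions exist only almost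
    everywhere, hence so do most identities between them. *)

Lemma lebesgue_measure_shift (c : R) (A : set R) : measurable A ->
  pushforward leb (fun x : R => (x + c)%R : measurableTypeR R) A = leb A.
Proof.
have mphi : measurable_fun [set: R] (fun x : R => (x + c)%R : measurableTypeR R).
  exact: measurable_funD.
move=> mA; apply/esym/lebesgue_measure_unique => //=.
move=> _ [[a b]] _ <-.
rewrite /pushforward /=.
have -> : (fun x : R => (x + c)%R) @^-1` `]a, b]%classic =
    `](a - c)%R, (b - c)%R]%classic.
  by apply/seteqP; split => x /=; rewrite !in_itv/= ltrBlDr lerBrDr.
rewrite !lebesgue_measure_itv/= !lte_fin ltrD2r -!EFinB.
by rewrite opprB addrA subrK.
Qed.

Lemma lebesgue_measure_scale (c : R) (A : set R) : (0 < c)%R -> measurable A ->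
  c%:E * pushforward leb (fun x : R => (c * x)%R : measurableTypeR R) A = leb A.
Proof.
move=> c0.
have mphi : measurable_fun [set: R] (fun x : R => (c * x)%R : measurableTypeR R).
  exact: measurable_funM.
move=> mA.
pose m : {measure set (measurableTypeR R) -> \bar R} :=
  mscale (NngNum (ltW c0)) (measure_function_pushforward__canonical__measure_function_Measure leb mphi).
suff /(@lebesgue_measure_unique R m) : forall X, ocitv X -> leb X = m X.
  by move=> /(_ A mA) ->.
move=> _ [[a b]] _ <-.
rewrite /m /mscale /= /pushforward /=.
rewrite [X in _ = _ * leb X](_ : _ = `](a / c)%R, (b / c)%R]%classic); last first.
  by apply/seteqP; split => x /=; rewrite !in_itv/= ltr_pdivrMr// ler_pdivlMr// !(mulrC c).
rewrite !lebesgue_measure_itv/= !lte_fin ltr_pM2r ?invr_gt0//.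
case: ifPn => _; last by rewrite mule0.
rewrite -!EFinB -EFinM; congr EFin; field; lra.
Qed.

Lemma ge0_integral_shift (c : R) (f : R -> \bar R) :
  measurable_fun [set: R] f -> (forall x, 0 <= f x) ->
  \int[leb]_x f (x + c)%R = \int[leb]_x f x.
Proof.
move=> mf f0.
transitivity (\int[pushforward leb (fun x : R => (x + c)%R : measurableTypeR R)]_x f x).
  rewrite ge0_integral_pushforward// ?preimage_setT//.
  exact: measurable_funD.
apply: eq_measure_integral => [|mc A mA _]; first exact: measurable_funD.
exact: lebesgue_measure_shift.
Qed.

Lemma ge0_integral_opp (f : R -> \bar R) :
  measurable_fun [set: R] f -> (forall x, 0 <= f x) ->
  \int[leb]_x f (- x)%R = \int[leb]_x f x.
Proof.
move=> mf f0.
transitivity (\int[pushforward leb (-%R : R -> measurableTypeR R)]_x f x).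
  by rewrite ge0_integral_pushforward// ?preimage_setT.
by apply: eq_measure_integral => A mA _; exact: lebesgue_measureN.
Qed.

Lemma ge0_integral_scale (c : R) (f : R -> \bar R) : (0 < c)%R ->
  measurable_fun [set: R] f -> (forall x, 0 <= f x) ->
  c%:E * \int[leb]_x f (c * x)%R = \int[leb]_x f x.
Proof.
move=> c0 mf f0.
have mc : measurable_fun [set: R] (fun x : R => (c * x)%R : measurableTypeR R).
  exact: measurable_funM.
transitivity (c%:E * \int[pushforward leb (fun x : R => (c * x)%R : measurableTypeR R)]_x f x).
  by rewrite ge0_integral_pushforward// ?preimage_setT.
pose m : {measure set (measurableTypeR R) -> \bar R} :=
  measure_function_pushforward__canonical__measure_function_Measure leb mc.
rewrite -[pushforward _ _]/(m : set _ -> _) -[c in LHS]/((NngNum (ltW c0))%:num).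
rewrite -ge0_integral_mscale//.
by apply: eq_measure_integral => A mA _; exact: lebesgue_measure_scale.
Qed.

End invariance.

(** * Sigma-finiteness of product measures *)

Section product_sigma_finite.
Context d1 d2 (T1 : measurableType d1) (T2 : measurableType d2) (R : realType).
Variable m1 : {sigma_finite_measure set T1 -> \bar R}.
Variable m2 : {sigma_finite_measure set T2 -> \bar R}.

Lemma sigma_finite_product : sigma_finite [set: T1 * T2] (m1 \x m2)%E.
Proof.
have /sigma_finiteP[F [TF ndF Foo]] := sigma_finiteT m1.
have /sigma_finiteP[G [TG ndG Goo]] := sigma_finiteT m2.
exists (fun n => F n `*` G n).
  rewrite -setXTT TF TG predeqE => -[x y]; split.
    move=> [/= [n _ Fnx] [k _ Gky]]; exists (maxn n k) => //; split.
    - by move: x Fnx; exact/subsetPset/ndF/leq_maxl.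
    - by move: y Gky; exact/subsetPset/ndG/leq_maxr.
  by move=> [n _ []/= ? ?]; split; exists n.
move=> k; have [? ?] := Foo k; have [? ?] := Goo k.
split; first exact: measurableX.
by rewrite product_measure1E// lte_mul_pinfty// ge0_fin_numE.
Qed.

(* Packed by hand: the canonical instance found for [m1 \x m2] is the one for
   sub-probability measures. *)
Definition prod_measure : {sigma_finite_measure set (T1 * T2)%type -> \bar R} :=
  HB.pack (m1 \x m2)%E (Measure_isSigmaFinite.Build _ _ _ (m1 \x m2)%E sigma_finite_product).

End product_sigma_finite.
Arguments prod_measure : simpl never.

(** * Young's inequality for a family of measure-preserving maps *)

Section young.
Context d1 d2 (X : measurableType d1) (Y : measurableType d2) (R : realType).
Variables (mu : {sigma_finite_measure set X -> \bar R}).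
Variables (nu : {sigma_finite_measure set Y -> \bar R}).
Variable phi : X * Y -> X.
Hypothesis mphi : measurable_fun [set: X * Y] phi.
Hypothesis phi_inv : forall (y : Y) (f : X -> \bar R),
  measurable_fun [set: X] f -> (forall x, (0 <= f x)%E) ->
  (\int[mu]_x f (phi (x, y)) = \int[mu]_x f x)%E.
Variables (A : X -> R) (G : Y -> R).
Hypothesis intA : mu.-integrable [set: X] (EFin \o A).
Hypothesis intG : nu.-integrable [set: Y] (EFin \o G).

Let mA : measurable_fun [set: X] A.
Proof. by apply/measurable_EFinP; exact: measurable_int intA. Qed.

Let mG : measurable_fun [set: Y] G.
Proof. by apply/measurable_EFinP; exact: measurable_int intG. Qed.

Let F (z : X * Y) := A (phi z) * G z.2.

Let mF : measurable_fun [set: X * Y] F.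
Proof.
apply: measurable_funM; first exact: measurableT_comp.
exact: measurableT_comp.
Qed.

(** For fixed [y] the map [phi] preserves integrals in [x], so integrating in [x] on the inside
    splits the double integral. With [phi] a difference this serves convolutions, with a projection
    tensor products, and with [Y] itself a product triple integrals. *)
Lemma young_norm : (\int[nu]_y \int[mu]_x `|(F (x, y))%:E| =
  (\int[mu]_x `|(A x)%:E|) * (\int[nu]_y `|(G y)%:E|))%E.
Proof.
have mabsA : measurable_fun [set: X] (fun x => `|(A x)%:E|%E).
  by apply: measurableT_comp => //; exact/measurable_EFinP.
transitivity (\int[nu]_y ((\int[mu]_x `|(A x)%:E|) * `|(G y)%:E|))%E.
  apply: eq_integral => y _.
  transitivity (\int[mu]_x (`|(G y)%:E| * `|(A (phi (x, y)))%:E|))%E.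
    by apply: eq_integral => x _; rewrite /F/= normrM EFinM muleC.
  rewrite ge0_integralZl//; last first.
    apply: measurableT_comp => //; apply/measurable_EFinP.
    exact: measurableT_comp (measurableT_comp mphi (pair2_measurable y)).
  by rewrite (phi_inv y mabsA)// muleC.
rewrite ge0_integralZl//; first last.
- exact: integral_ge0.
- by apply: measurableT_comp => //; exact/measurable_EFinP.
Qed.

Lemma young_integrable : (mu \x nu)%E.-integrable [set: X * Y] (EFin \o F).
Proof.
apply/integrable21ltyP; first exact/measurable_EFinP.
rewrite young_norm lte_mul_pinfty//.
- exact: integral_ge0.
- by have /integrable_fin_num := integrable_abse intA; exact.
- by have /integrableP[] := intG.
Qed.

End young.

(** * Real-valued integrals and the norm of L^1 *)

Section rintegral.
Context d (T : measurableType d) (R : realType) (mu : {measure set T -> \bar R}).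
Implicit Types f g : T -> R.

Lemma EFin_Rintegral f : mu.-integrable [set: T] (EFin \o f) ->
  ((\int[mu]_x f x)%:E = \int[mu]_x (f x)%:E)%E.
Proof. by move=> intf; rewrite /Rintegral fineK//; exact: integrable_fin_num. Qed.

Lemma measurable_of_integrable f : mu.-integrable [set: T] (EFin \o f) ->
  measurable_fun [set: T] f.
Proof. by move=> /measurable_int /measurable_EFinP. Qed.

Lemma ae_eq_Rintegral f g : measurable_fun [set: T] f -> measurable_fun [set: T] g ->
  {ae mu, forall x, f x = g x} -> \int[mu]_x f x = \int[mu]_x g x.
Proof.
move=> mf mg fg; rewrite /Rintegral; congr fine; apply: ae_eq_integral => //.
- exact/measurable_EFinP.
- exact/measurable_EFinP.
- by apply: filterS fg => x /= -> _.
Qed.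

(** Integrability is asked of the product, which is what Fubini provides: for [c != 0] divide by
    [c], and for [c = 0] both sides vanish. *)
Lemma RintegralMr f c : mu.-integrable [set: T] (fun x => (f x * c)%:E) ->
  \int[mu]_x (f x * c) = (\int[mu]_x f x) * c.
Proof.
have [->|c0] := eqVneq c 0.
  move=> _; rewrite mulr0; under eq_Rintegral do rewrite mulr0.
  by rewrite Rintegral_cst// mul0r.
move=> intfc; rewrite -RintegralZr//.
have -> : EFin \o f = (fun x => (f x * c)%:E * (c^-1)%:E)%E.
  by apply/funext => x /=; rewrite -EFinM mulfK.
exact: integrableZr.
Qed.

Definition nrm1 f := \int[mu]_x `|f x|.

Lemma nrm1_ge0 f : 0 <= nrm1 f.
Proof. exact: Rintegral_ge0. Qed.

Lemma EFin_nrm1 f : mu.-integrable [set: T] (EFin \o f) ->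
  (nrm1 f)%:E = (\int[mu]_x `|(f x)%:E|)%E.
Proof. by move=> intf; rewrite /nrm1 EFin_Rintegral//; exact: integrable_norm. Qed.

Lemma ae_le_nrm1 f g : measurable_fun [set: T] f ->
  mu.-integrable [set: T] (EFin \o g) ->
  {ae mu, forall x, `|f x| <= g x} -> nrm1 f <= \int[mu]_x g x.
Proof.
move=> mf intg fg; have mg := measurable_of_integrable intg.
have le : (\int[mu]_x `|(f x)%:E| <= \int[mu]_x `|(g x)%:E|)%E.
  apply: ae_ge0_le_integral => //.
  - by apply: measurableT_comp => //; exact/measurable_EFinP.
  - by apply: measurableT_comp => //; exact/measurable_EFinP.
  - apply: filterS fg => x fgx _; rewrite lee_fin (le_trans fgx)//.
    exact: ler_norm.
have intf : mu.-integrable [set: T] (EFin \o f).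
  apply/integrableP; split; first exact/measurable_EFinP.
  by rewrite (le_lt_trans le)//; have /integrableP[] := intg.
rewrite -lee_fin EFin_nrm1// EFin_Rintegral//.
rewrite (le_trans le)// le_eqVlt; apply/orP; left; apply/eqP.
apply: ae_eq_integral => //.
- by apply: measurableT_comp => //; exact/measurable_EFinP.
- exact/measurable_EFinP.
- by apply: filterS fg => x fgx _; rewrite /= ger0_norm// (le_trans _ fgx).
Qed.

Lemma nrm1_triangle f g h : measurable_fun [set: T] f ->
  mu.-integrable [set: T] (EFin \o g) -> mu.-integrable [set: T] (EFin \o h) ->
  {ae mu, forall x, `|f x| <= `|g x| + `|h x|} -> nrm1 f <= nrm1 g + nrm1 h.
Proof.
move=> mf intg inth fgh.
rewrite /nrm1 -RintegralD//; [|exact: integrable_norm|exact: integrable_norm].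
apply: ae_le_nrm1 => //.
have := integrableD measurableT (integrable_norm intg) (integrable_norm inth).
by apply: eq_integrable.
Qed.

Lemma nrm1Z f c : mu.-integrable [set: T] (EFin \o f) ->
  nrm1 (fun x => c * f x) = `|c| * nrm1 f.
Proof.
move=> intf; rewrite /nrm1 -RintegralZl//; last exact: integrable_norm.
by apply: eq_Rintegral => x _; rewrite normrM.
Qed.

Lemma integrable_scale f (c : R) : mu.-integrable [set: T] (EFin \o f) ->
  mu.-integrable [set: T] (fun x => (c * f x)%:E).
Proof.
by move=> intf; have := integrableZl measurableT c intf; apply: eq_integrable.
Qed.

Lemma integrable_lin f g (c d' : R) : mu.-integrable [set: T] (EFin \o f) ->
  mu.-integrable [set: T] (EFin \o g) ->
  mu.-integrable [set: T] (fun x => (c * f x + d' * g x)%:E).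
Proof.
move=> intf intg.
have := integrableD measurableT (integrableZl measurableT c intf) (integrableZl measurableT d' intg).
by apply: eq_integrable => // x _ /=; rewrite EFinD !EFinM.
Qed.

Lemma Rintegral_lin f g (c d' : R) : mu.-integrable [set: T] (EFin \o f) ->
  mu.-integrable [set: T] (EFin \o g) ->
  \int[mu]_x (c * f x + d' * g x) = c * (\int[mu]_x f x) + d' * \int[mu]_x g x.
Proof.
move=> intf intg; rewrite -!RintegralZl//; rewrite -RintegralD//.
- by have := integrableZl measurableT c intf; apply: eq_integrable.
- by have := integrableZl measurableT d' intg; apply: eq_integrable.
Qed.

Lemma nrm1_lin_add f g (c : R) : 0 <= c -> mu.-integrable [set: T] (EFin \o f) ->
  mu.-integrable [set: T] (EFin \o g) ->
  nrm1 (fun x => 1 * f x + c * g x) <= nrm1 f + c * nrm1 g.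
Proof.
move=> c0 intf intg; rewrite -{2}(ger0_norm c0) -nrm1Z//; apply: nrm1_triangle => //.
- exact: measurable_of_integrable (integrable_lin _ _ intf intg).
- exact: integrable_scale.
- by apply/aeW => p; rewrite mul1r; exact: ler_normD.
Qed.

Lemma nrm1_lin_sub f g : mu.-integrable [set: T] (EFin \o f) ->
  mu.-integrable [set: T] (EFin \o g) ->
  nrm1 (fun x => 1 * f x + -1 * g x) <= nrm1 f + nrm1 g.
Proof.
move=> intf intg; apply: nrm1_triangle => //.
- exact: measurable_of_integrable (integrable_lin _ _ intf intg).
- by apply/aeW => p; rewrite mul1r mulN1r; exact: ler_normB.
Qed.

Lemma Rdominated_cvg (f_ : nat -> T -> R) f g :
  (forall n, measurable_fun [set: T] (f_ n)) ->
  (forall x, f_ ^~ x @ \oo --> f x) ->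
  mu.-integrable [set: T] (EFin \o g) ->
  (forall n x, `|f_ n x| <= g x) ->
  mu.-integrable [set: T] (EFin \o f) /\
  \int[mu]_x f_ n x @[n --> \oo] --> \int[mu]_x f x.
Proof.
move=> mf_ cf intg fg.
have mf : measurable_fun [set: T] f by apply: measurable_fun_cvg => // x _; exact: cf.
have [] := @dominated_convergence _ _ _ mu _ measurableT (fun n x => (f_ n x)%:E)
  (EFin \o f) (EFin \o g) _ _ _ intg _.
- by move=> n; exact/measurable_EFinP.
- exact/measurable_EFinP.
- apply/aeW => x _; apply: cvg_EFin; first exact: nearW.
  exact: cf.
- by apply/aeW => x n _; rewrite lee_fin.
move=> intf _ cvgi; split => //.
by apply: fine_cvg; rewrite EFin_Rintegral.
Qed.

End rintegral.

(** * Fubini's theorem for real-valued integrals *)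

Section rfubini.
Context d1 d2 (T1 : measurableType d1) (T2 : measurableType d2) (R : realType).
Variable m1 : {sigma_finite_measure set T1 -> \bar R}.
Variable m2 : {sigma_finite_measure set T2 -> \bar R}.
Variable F : T1 * T2 -> R.
Hypothesis intF : (m1 \x m2)%E.-integrable [set: T1 * T2] (EFin \o F).

Let mF : measurable_fun [set: T1 * T2] (EFin \o F).
Proof. exact: measurable_int intF. Qed.

Lemma measurable_Rfubini1 : measurable_fun [set: T1] (fun x => \int[m2]_y F (x, y)).
Proof. by apply: measurableT_comp => //; exact: measurable_fubini_F intF. Qed.

Lemma measurable_Rfubini2 : measurable_fun [set: T2] (fun y => \int[m1]_x F (x, y)).
Proof. by apply: measurableT_comp => //; exact: measurable_fubini_G intF. Qed.

(** Almost every slice is integrable. At the exceptional [x] the inner integral is only the [fine]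
    of a possibly infinite value, which the outer integral does not see. *)
Lemma Rfubini1 : \int[m1]_x \int[m2]_y F (x, y) = \int[(m1 \x m2)%E]_z F z.
Proof.
rewrite {1 3}/Rintegral -(integral12_prod_meas1 intF); congr fine.
apply: ae_eq_integral => //.
- by apply/measurable_EFinP; exact: measurable_Rfubini1.
- exact: measurable_fubini_F intF.
apply: filterS (ae_integrable1 intF) => x intFx _.
by rewrite EFin_Rintegral.
Qed.

Lemma Rfubini2 : \int[m2]_y \int[m1]_x F (x, y) = \int[(m1 \x m2)%E]_z F z.
Proof.
rewrite {1 3}/Rintegral -(integral21_prod_meas1 intF); congr fine.
apply: ae_eq_integral => //.
- by apply/measurable_EFinP; exact: measurable_Rfubini2.
- exact: measurable_fubini_G intF.
apply: filterS (ae_integrable2 intF) => x intFx _.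
by rewrite EFin_Rintegral.
Qed.

Lemma integrable_Rfubini1 :
  m1.-integrable [set: T1] (EFin \o (fun x => \int[m2]_y F (x, y))).
Proof.
apply/integrableP; split.
  by apply/measurable_EFinP; exact: measurable_Rfubini1.
have /integrableP[_] := integrable_fubini_F intF; apply: le_lt_trans.
apply: ae_ge0_le_integral => //.
- apply: measurableT_comp => //.
  by apply/measurable_EFinP; exact: measurable_Rfubini1.
- by apply: measurableT_comp => //; exact: measurable_fubini_F intF.
apply: filterS (ae_integrable1 intF) => x intFx _.
by rewrite (_ : (EFin \o _) x = fubini_F m2 (EFin \o F) x)// /comp EFin_Rintegral.
Qed.

(** Minkowski's inequality in [L^1]: the absolute value passes under the inner integral, and Tonelli
    exchanges the order. *)
Lemma nrm1_Rfubini1 : ((nrm1 m1 (fun x => \int[m2]_y F (x, y)))%:E <=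
  \int[m2]_y \int[m1]_x `|(F (x, y))%:E|)%E.
Proof.
rewrite EFin_nrm1; last exact: integrable_Rfubini1.
rewrite -(fubini_tonelli (fun z => `|(F z)%:E|%E))//; last exact: measurableT_comp.
apply: ae_ge0_le_integral => //.
- apply: measurableT_comp => //.
  by apply/measurable_EFinP; exact: measurable_Rfubini1.
- by move=> x _; exact: integral_ge0.
- apply: (measurable_fun_fubini_tonelli_F (fun z => `|(F z)%:E|%E)) => //.
  exact: measurableT_comp.
apply: filterS (ae_integrable1 intF) => x intFx _.
by rewrite EFin_Rintegral//; apply: le_abse_integral => //; exact: measurable_int intFx.
Qed.

End rfubini.

(** * Invariance for signed functions *)

Section signed_invariance.
Context d (T : measurableType d) (R : realType) (mu : {measure set T -> \bar R}).
Variable phi : T -> T.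
Hypothesis mphi : measurable_fun [set: T] phi.
Hypothesis phi_inv : forall f : T -> \bar R,
  measurable_fun [set: T] f -> (forall x, (0 <= f x)%E) ->
  (\int[mu]_x f (phi x) = \int[mu]_x f x)%E.

(** Positive and negative parts are transported separately, so that divergent integrals agree as
    well. *)
Lemma Rintegral_invariant (f : T -> R) : measurable_fun [set: T] f ->
  \int[mu]_x f (phi x) = \int[mu]_x f x.
Proof.
move=> /measurable_EFinP mf; rewrite /Rintegral; congr fine.
rewrite integralE [RHS]integralE; congr (_ - _)%E.
- rewrite -[RHS]phi_inv//; last exact: measurable_funepos.
  by apply: eq_integral => x _; rewrite !funeposE.
- rewrite -[RHS]phi_inv//; last exact: measurable_funeneg.
  by apply: eq_integral => x _; rewrite !funenegE.
Qed.

Lemma integrable_invariant (f : T -> R) : mu.-integrable [set: T] (EFin \o f) ->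
  mu.-integrable [set: T] (fun x => (f (phi x))%:E).
Proof.
move=> /integrableP[mf intf]; apply/integrableP; split.
  exact: measurableT_comp mf mphi.
have mabs : measurable_fun [set: T] (fun x => `|(f x)%:E|%E) by exact: measurableT_comp.
by rewrite (phi_inv mabs).
Qed.

End signed_invariance.

(** * Convolution in the plane *)

Section plane.
Context {R : realType}.
Local Notation leb := (@lebesgue_measure R).
Local Notation leb2 := (prod_measure leb leb).
Local Notation T := (measurableTypeR R).
Local Notation P := (T * T)%type.

Definition sub2 (p r : P) : P := (p.1 - r.1, p.2 - r.2).

Lemma measurable_sub2 : measurable_fun [set: P * P] (fun z => sub2 z.1 z.2).
Proof.
apply: measurable_fun_pair => /=; apply: measurable_funB.
- exact: (measurableT_comp measurable_fst measurable_fst).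
- exact: (measurableT_comp measurable_fst measurable_snd).
- exact: (measurableT_comp measurable_snd measurable_fst).
- exact: (measurableT_comp measurable_snd measurable_snd).
Qed.

Lemma measurable_sub2l (r : P) : measurable_fun [set: P] (fun p => sub2 p r).
Proof. exact: (measurableT_comp measurable_sub2 (pair2_measurable r)). Qed.

Lemma measurable_sub2r (p : P) : measurable_fun [set: P] (fun r => sub2 p r).
Proof. exact: (measurableT_comp measurable_sub2 (pair1_measurable p)). Qed.

Local Open Scope ereal_scope.

Lemma ge0_integral_sub2l (r : P) (f : P -> \bar R) :
  measurable_fun [set: P] f -> (forall x, 0 <= f x) ->
  \int[leb2]_p f (sub2 p r) = \int[leb2]_p f p.
Proof.
move=> mf f0.
have mfs := measurableT_comp mf (measurable_sub2l r).
rewrite [LHS](@fubini_tonelli1 _ _ _ _ _ leb leb _ mfs (fun p => f0 (sub2 p r))).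
rewrite [RHS](@fubini_tonelli1 _ _ _ _ _ leb leb f mf f0) /fubini_F /sub2/=.
transitivity (\int[leb]_x \int[leb]_y f ((x - r.1)%R, y)).
  apply: eq_integral => x _.
  apply: (ge0_integral_shift (- r.2)%R (f := fun y : T => f ((x - r.1)%R, y))) => //.
  exact: measurableT_comp mf (pair1_measurable _).
apply: (ge0_integral_shift (- r.1)%R (f := fun x => \int[leb]_y f (x, y))) => //.
- exact: measurable_fun_fubini_tonelli_F.
- by move=> x; exact: integral_ge0.
Qed.

Lemma ge0_integral_sub2r (p : P) (f : P -> \bar R) :
  measurable_fun [set: P] f -> (forall x, 0 <= f x) ->
  \int[leb2]_r f (sub2 p r) = \int[leb2]_r f r.
Proof.
move=> mf f0.
have mfs := measurableT_comp mf (measurable_sub2r p).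
rewrite [LHS](@fubini_tonelli1 _ _ _ _ _ leb leb _ mfs (fun r => f0 (sub2 p r))).
rewrite [RHS](@fubini_tonelli1 _ _ _ _ _ leb leb f mf f0) /fubini_F /sub2/=.
have subl (c : R) (g : R -> \bar R) : measurable_fun [set: R] g ->
    (forall x, 0 <= g x) -> \int[leb]_x g (c - x)%R = \int[leb]_x g x.
  move=> mg g0.
  have mgc : measurable_fun [set: R] (fun x => g (x + c)%R).
    by apply: measurableT_comp => //; exact: measurable_funD.
  rewrite -(ge0_integral_shift c mg g0) -(ge0_integral_opp mgc)//.
  by apply: eq_integral => x _; rewrite addrC.
transitivity (\int[leb]_x \int[leb]_y f ((p.1 - x)%R, y)).
  apply: eq_integral => x _.
  apply: (subl p.2 (fun y => f ((p.1 - x)%R, y))) => //.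
  exact: measurableT_comp mf (pair1_measurable _).
apply: (subl p.1 (fun x => \int[leb]_y f (x, y))) => //.
- exact: measurable_fun_fubini_tonelli_F.
- by move=> x; exact: integral_ge0.
Qed.


Lemma sub2_shift (p r v : P) : sub2 (sub2 p (sub2 r v)) v = sub2 p r.
Proof. by rewrite /sub2 /=; congr pair; ring. Qed.

Lemma sub2Dr (p s r : P) : sub2 (sub2 p r) (sub2 s r) = sub2 p s.
Proof. by rewrite /sub2 /=; congr pair; ring. Qed.

End plane.

Section convolution.
Context d (P : measurableType d) (R : realType).
Variable mu : {sigma_finite_measure set P -> \bar R}.
Variable sub : P -> P -> P.
Hypothesis msub : measurable_fun [set: P * P] (fun z => sub z.1 z.2).
Hypothesis sub_shift : forall p r v, sub (sub p (sub r v)) v = sub p r.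
Hypothesis subDr : forall p s r, sub (sub p r) (sub s r) = sub p s.
Hypothesis inv_l : forall (r : P) (f : P -> \bar R),
  measurable_fun [set: P] f -> (forall x, (0 <= f x)%E) ->
  (\int[mu]_p f (sub p r) = \int[mu]_p f p)%E.

Let msubl (r : P) : measurable_fun [set: P] (fun p => sub p r).
Proof. exact: (measurableT_comp msub (pair2_measurable r)). Qed.

Let msubr (p : P) : measurable_fun [set: P] (fun r => sub p r).
Proof. exact: (measurableT_comp msub (pair1_measurable p)). Qed.

Section gconv_def.
Variable nu : {sigma_finite_measure set P -> \bar R}.

(** The second measure is a parameter: Lebesgue measure of the plane gives the usual convolution
    with a source term, and a measure carried by the time 0 gives the evolution of an initial
    datum. *)
Definition gconv (A G : P -> R) (p : P) : R :=
  \int[nu]_r (A (sub p r) * G r).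

Variables (A G : P -> R).
Hypothesis intA : mu.-integrable [set: P] (EFin \o A).
Hypothesis intG : nu.-integrable [set: P] (EFin \o G).

Lemma integrable_gconv_prod :
  (mu \x nu)%E.-integrable [set: P * P] (fun z => (A (sub z.1 z.2) * G z.2)%:E).
Proof.
apply: (@young_integrable _ _ _ _ _ mu nu (fun z : P * P => sub z.1 z.2)) => //.
Qed.

Lemma ae_integrable_gconv :
  {ae mu, forall p, nu.-integrable [set: P] (fun r => (A (sub p r) * G r)%:E)}.
Proof. exact: (ae_integrable1 integrable_gconv_prod). Qed.

Lemma integrable_gconv : mu.-integrable [set: P] (EFin \o gconv A G).
Proof. exact: integrable_Rfubini1 integrable_gconv_prod. Qed.

Lemma nrm1_gconv : nrm1 mu (gconv A G) <= nrm1 mu A * nrm1 nu G.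
Proof.
rewrite -lee_fin (le_trans (nrm1_Rfubini1 integrable_gconv_prod))//=.
rewrite (@young_norm _ _ _ _ _ mu nu (fun z : P * P => sub z.1 z.2))//=.
by rewrite EFinM !EFin_nrm1.
Qed.

End gconv_def.

Section gconv_lin.
Variable nu : {sigma_finite_measure set P -> \bar R}.
Variables (A B G H : P -> R) (c e : R).
Hypothesis intA : mu.-integrable [set: P] (EFin \o A).
Hypothesis intB : mu.-integrable [set: P] (EFin \o B).
Hypothesis intG : nu.-integrable [set: P] (EFin \o G).
Hypothesis intH : nu.-integrable [set: P] (EFin \o H).

Lemma gconv_linr : {ae mu, forall p,
  gconv nu A (fun r => c * G r + e * H r) p = c * gconv nu A G p + e * gconv nu A H p}.
Proof.
near=> p.
rewrite /gconv -Rintegral_lin.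
- by apply: eq_Rintegral => r _; ring.
- by near: p; exact: ae_integrable_gconv.
- by near: p; exact: ae_integrable_gconv.
Unshelve. all: end_near. Qed.

Lemma gconv_linl : {ae mu, forall p,
  gconv nu (fun q => c * A q + e * B q) G p = c * gconv nu A G p + e * gconv nu B G p}.
Proof.
near=> p.
rewrite /gconv -Rintegral_lin.
- by apply: eq_Rintegral => r _; ring.
- by near: p; exact: ae_integrable_gconv.
- by near: p; exact: ae_integrable_gconv.
Unshelve. all: end_near. Qed.

End gconv_lin.

(** Substitution of [sub r v] for [r]. It moves a shift between the kernel and the function, and
    holds at every point. *)
Lemma gconv_shift (A G : P -> R) (v : P) (p : P) :
  measurable_fun [set: P] A -> measurable_fun [set: P] G ->
  gconv mu (fun q => A (sub q v)) G p = gconv mu A (fun r => G (sub r v)) p.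
Proof.
move=> mA mG; rewrite /gconv.
rewrite -[LHS](Rintegral_invariant (phi := fun r => sub r v)).
- apply: eq_Rintegral => r _; congr (A _ * _).
  exact: sub_shift.
- by move=> f mf f0; exact: inv_l.
- apply: measurable_funM => //.
  apply: (measurableT_comp mA).
  exact: (measurableT_comp (msubl v) (msubr p)).
Qed.

(** Fubini on a triple product, justified by [young_integrable] with [P * P] as second factor and a
    map that ignores the last variable; translating by [r] then recognises the inner convolution. *)
Lemma gconvA (nu : {sigma_finite_measure set P -> \bar R}) (A B G : P -> R) :
  mu.-integrable [set: P] (EFin \o A) ->
  mu.-integrable [set: P] (EFin \o B) ->
  nu.-integrable [set: P] (EFin \o G) ->
  {ae mu, forall p,
    gconv mu A (gconv nu B G) p = gconv nu (gconv mu A B) G p}.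
Proof.
move=> intA intB intG.
have intBG : (prod_measure mu nu).-integrable [set: P * P]
    (EFin \o (fun w => B (sub w.1 w.2) * G w.2)) := integrable_gconv_prod intB intG.
have intABG : (mu \x prod_measure mu nu)%E.-integrable [set: P * (P * P)]
    (fun z => (A (sub z.1 z.2.1) * (B (sub z.2.1 z.2.2) * G z.2.2))%:E).
  have mphi : measurable_fun [set: P * (P * P)]
      (fun z : P * (P * P)%type => sub z.1 z.2.1).
    have m12 : measurable_fun [set: P * (P * P)] (fun z : P * (P * P)%type => (z.1, z.2.1)).
      apply: measurable_fun_pair => //.
      exact: (measurableT_comp measurable_fst measurable_snd).
    exact: (measurableT_comp msub m12).
  have := @young_integrable _ _ _ _ _ mu (prod_measure mu nu) _ mphi
    (fun y f mf f0 => inv_l y.1 mf f0) _ _ intA intBG.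
  by [].
near=> p.
have intp : (mu \x nu)%E.-integrable [set: P * P]
    (fun w => (A (sub p w.1) * (B (sub w.1 w.2) * G w.2))%:E).
  by near: p; exact: ae_integrable1 intABG.
have mA := measurable_of_integrable intA.
have mB := measurable_of_integrable intB.
have mG := measurable_of_integrable intG.
transitivity (\int[mu]_s \int[nu]_r (A (sub p s) * (B (sub s r) * G r))).
  apply: ae_eq_Rintegral.
  - apply: measurable_funM; first exact: measurableT_comp mA (msubr p).
    exact: measurable_of_integrable (integrable_gconv intB intG).
  - exact: measurable_Rfubini1 intp.
  - apply: filterS (ae_integrable_gconv intB intG) => s ints.
    by rewrite RintegralZl.
rewrite (Rfubini1 intp) -(Rfubini2 intp).
apply: ae_eq_Rintegral.
- exact: measurable_Rfubini2 intp.
- apply: measurable_funM => //.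
  apply: (measurableT_comp (f := gconv mu A B)); last exact: msubr.
  exact: measurable_of_integrable (integrable_gconv intA intB).
apply: filterS (ae_integrable2 intp) => r intr.
rewrite /=.
under eq_Rintegral do rewrite mulrA.
rewrite RintegralMr; last first.
  by apply: eq_integrable intr => // s _ /=; rewrite mulrA.
congr (_ * _); rewrite /gconv.
rewrite -[RHS](Rintegral_invariant (phi := fun s => sub s r)).
- apply: eq_Rintegral => s _; congr (A _ * _).
  by rewrite subDr.
- by move=> f mf f0; exact: inv_l.
- apply: measurable_funM => //.
  by apply: (measurableT_comp mA); exact: msubr.
Unshelve. all: end_near. Qed.

End convolution.

Section plane_convolution.
Context {R : realType}.
Local Notation leb := (@lebesgue_measure R).
Local Notation mu2 := (prod_measure leb leb).
Local Notation T := (measurableTypeR R).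
Local Notation P := (T * T)%type.
Variables (nu : {sigma_finite_measure set P -> \bar R}) (A G : P -> R).
Hypothesis intA : mu2.-integrable [set: P] (EFin \o A).
Hypothesis intG : nu.-integrable [set: P] (EFin \o G).

Lemma integrable_conv2 : mu2.-integrable [set: P] (EFin \o gconv sub2 nu A G).
Proof. exact: (integrable_gconv measurable_sub2 ge0_integral_sub2l intA intG). Qed.

Lemma nrm1_conv2 : nrm1 mu2 (gconv sub2 nu A G) <= nrm1 mu2 A * nrm1 nu G.
Proof. exact: (nrm1_gconv measurable_sub2 ge0_integral_sub2l intA intG). Qed.

End plane_convolution.

(** * Integrals of exponentials in time *)

Section exponential_integrals.
Context {R : realType}.
Local Notation leb := (@lebesgue_measure R).

Lemma is_derive_expRM (c t : R) :
  is_derive t 1 (fun x => expR (c * x)) (c * expR (c * t)).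
Proof.
have H : is_derive t 1 (fun x : R => c * x) c.
  have := @is_deriveZ _ _ _ (@idfun R) c t 1 1 (is_derive_id _ _).
  by rewrite /GRing.scale /= mulr1.
have := @is_derive1_comp _ expR (fun x => c * x) t _ _ (is_derive_expR (c * t)) H.
by rewrite mulrC.
Qed.

Lemma integral_expRN (c h : R) : c != 0 -> 0 < h ->
  (\int[leb]_(t in `[0%R, h]) (expR (- c * t))%:E = ((1 - expR (- c * h)) / c)%:E)%E.
Proof.
move=> c0 h0.
have dF (t : R) : is_derive t 1 (fun x => - c^-1 * expR (- c * x)) (expR (- c * t)).
  have := @is_deriveZ _ _ _ (fun x => expR (- c * x)) (- c^-1) t 1 _ (is_derive_expRM (- c) t).
  by rewrite /GRing.scale /= mulrA mulrNN mulVf ?mul1r.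
have cF : continuous (fun x : R => expR (- c * x)).
  by move=> t; apply: differentiable_continuous; apply/derivable1_diffP; case: (is_derive_expRM (- c) t).
have cFF : continuous (fun x => - c^-1 * expR (- c * x)).
  by move=> t; apply: differentiable_continuous; apply/derivable1_diffP; case: (dF t).
rewrite (@continuous_FTC2 _ _ (fun x => - c^-1 * expR (- c * x)))//.
- by rewrite mulr0 expR0 mulr1 -EFinB; congr EFin; field.
- exact: continuous_subspaceT.
- split.
  + by move=> x _; case: (dF x).
  + by apply: cvg_at_right_filter; exact: cFF.
  + by apply: cvg_at_left_filter; exact: cFF.
- by move=> x _; rewrite derive1E; case: (dF x).
Qed.

Lemma integral0y_expRN (c : R) : 0 < c ->
  (\int[leb]_(t in `[0%R, +oo[) (expR (- c * t))%:E = (c^-1)%:E)%E.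
Proof.
move=> c0.
have dF (t : R) : is_derive t 1 (fun x => - c^-1 * expR (- c * x)) (expR (- c * t)).
  have := @is_deriveZ _ _ _ (fun x => expR (- c * x)) (- c^-1) t 1 _ (is_derive_expRM (- c) t).
  by rewrite /GRing.scale /= mulrA mulrNN mulVf ?mul1r// gt_eqF.
have cF : continuous (fun x : R => expR (- c * x)).
  by move=> t; apply: differentiable_continuous; apply/derivable1_diffP; case: (is_derive_expRM (- c) t).
have cFF : continuous (fun x => - c^-1 * expR (- c * x)).
  by move=> t; apply: differentiable_continuous; apply/derivable1_diffP; case: (dF t).
rewrite (@ge0_continuous_FTC2y _ _ (fun x => - c^-1 * expR (- c * x)) 0 0)//.
- by rewrite mulr0 expR0 mulr1 -EFinB opprK add0r.
- exact: continuous_subspaceT.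
- rewrite -[X in _ --> X](mulr0 (- c^-1)); apply: cvgMr.
  have cy : (fun x : R => c * x) @ +oo --> +oo.
    apply/cvgryPge => A; near=> x.
    rewrite -ler_pdivrMl//; near: x; exact: nbhs_pinfty_ge.
  rewrite (_ : (fun x : R => expR (- c * x)) = (fun x : R => expR (- x)) \o (fun x => c * x)).
    exact: cvg_comp cy (@cvgr_expR R).
  by apply/funext => x /=; rewrite mulNr.
- by apply: cvg_at_right_filter; exact: cFF.
- by move=> x _; rewrite derive1E; case: (dF x).
Unshelve. all: end_near. Qed.
Lemma measurable_expR_patch (c : R) (i : interval R) :
  measurable_fun [set: measurableTypeR R] ((fun s => expR (c * s)) \_ [set` i]).
Proof.
apply/(measurable_restrictT (fun s => expR (c * s)) (measurable_itv i)).
apply: measurable_funTS; apply: (measurableT_comp (@measurable_expR R)).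
exact: measurable_funM.
Qed.

Lemma integral_patch (f : R -> R) (D : set (measurableTypeR R)) :
  (\int[leb]_t ((f \_ D) t)%:E = \int[leb]_(t in D) (f t)%:E)%E.
Proof. by rewrite [RHS]integral_mkcond restrict_EFin. Qed.

End exponential_integrals.

(** * Damped semigroups *)

Section kernel.
Context {R : realType}.
Local Notation leb := (@lebesgue_measure R).
Local Notation mu2 := (prod_measure leb leb).
Local Notation T := (measurableTypeR R).
Local Notation P := (T * T)%type.
Variables (k : P -> R) (lam : R).
Hypothesis mk : measurable_fun [set: P] k.
Hypothesis k_ge0 : forall p, 0 <= k p.
Hypothesis k_neg : forall p, p.1 <= 0 -> k p = 0.
Hypothesis k_mass : forall t : R, 0 < t ->
  (\int[leb]_x (k (t, x))%:E <= (expR (- lam * t))%:E)%E.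
Hypothesis k_semigroup : forall s t x : R, 0 < s -> 0 < t ->
  (\int[leb]_y (k (t, x - y) * k (s, y))%:E = (k (t + s, x))%:E)%E.
Hypothesis lam0 : 0 < lam.

Definition damped (M : R) (p : P) := expR (- M * p.1) * k p.

Lemma measurable_damped (M : R) : measurable_fun [set: P] (damped M).
Proof.
apply: measurable_funM => //; apply: (measurableT_comp (@measurable_expR R)).
by apply: measurable_funM => //; exact: measurable_fst.
Qed.

Lemma damped_ge0 M p : 0 <= damped M p.
Proof. by rewrite mulr_ge0// expR_ge0. Qed.

Lemma damped0 : damped 0 = k.
Proof. by apply/funext => p; rewrite /damped oppr0 mul0r expR0 mul1r. Qed.

Lemma damped_slice (M t : R) :
  (\int[leb]_x (damped M (t, x))%:E <=
   ((fun s => expR (- (lam + M) * s)) \_ `[0, +oo[ t)%:E)%E.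
Proof.
have mkt : measurable_fun [set: T] (fun x => (k (t, x))%:E).
  by apply/measurable_EFinP; exact: measurableT_comp mk (pair1_measurable t).
have [t0|t0] := leP t 0.
  rewrite integral0_eq; last by move=> x _; rewrite /damped k_neg//= mulr0.
  by rewrite lee_fin /patch; case: ifP => // _; exact: expR_ge0.
rewrite /patch mem_set/=; last by rewrite in_itv/= andbT ltW.
under eq_integral do rewrite /damped/= EFinM.
rewrite ge0_integralZl//; last by move=> *; rewrite lee_fin ?expR_ge0 ?k_ge0.
rewrite opprD mulrDl expRD EFinM muleC lee_pmul//.
- by apply: integral_ge0 => x _; rewrite lee_fin.
- exact: k_mass.
Qed.

Lemma damped_mass (M : R) : 0 <= M ->
  (\int[mu2]_p (damped M p)%:E <= ((lam + M)^-1)%:E)%E.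
Proof.
move=> M0; have lM0 : 0 < lam + M by rewrite ltr_pwDl.
have mE : measurable_fun [set: P] (fun p => (damped M p)%:E).
  by apply/measurable_EFinP; exact: measurable_damped.
have E0 p : (0 <= (damped M p)%:E)%E by rewrite lee_fin damped_ge0.
rewrite [leLHS](@fubini_tonelli1 _ _ _ _ _ leb leb _ mE E0).
apply: (@le_trans _ _ (\int[leb]_t ((fun s => expR (- (lam + M) * s)) \_ `[0%R, +oo[ t)%:E)%E).
  apply: ge0_le_integral => //.
  - by move=> t _; apply: integral_ge0 => x _.
  - exact: measurable_fun_fubini_tonelli_F.
  - by apply/measurable_EFinP; exact: measurable_expR_patch.
  - by move=> t _; exact: damped_slice.
by rewrite integral_patch integral0y_expRN.
Qed.

Lemma integrable_damped (M : R) : 0 <= M -> mu2.-integrable [set: P] (EFin \o damped M).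
Proof.
move=> M0; apply/integrableP; split; first by apply/measurable_EFinP; exact: measurable_damped.
under eq_integral do rewrite /= ger0_norm ?damped_ge0//.
by rewrite (le_lt_trans (damped_mass M0))// ltry.
Qed.

Lemma nrm1_damped (M : R) : 0 <= M -> nrm1 mu2 (damped M) <= (lam + M)^-1.
Proof.
move=> M0; rewrite -lee_fin EFin_nrm1; last exact: integrable_damped.
under eq_integral do rewrite /= ger0_norm ?damped_ge0//.
exact: damped_mass.
Qed.

(** The damping depends on time only, so at an intermediate time [s] the semigroup law collapses the
    space integral to [exp(- M s)] times the value of [k] at the final point; an integral of an
    exponential over []0, h[] remains. It is the resolvent identity between damping 0 and damping
    [M]. *)
Lemma gconv_damped (M : R) (h : P) : 0 < M ->
  M * gconv sub2 mu2 k (damped M) h = k h - damped M h.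
Proof.
move=> M0.
suff -> : gconv sub2 mu2 k (damped M) h = (k h - damped M h) / M.
  by rewrite mulrC divfK// gt_eqF.
rewrite /gconv /Rintegral.
have mF : measurable_fun [set: P] (fun r => (k (sub2 h r) * damped M r)%:E).
  apply/measurable_EFinP; apply: measurable_funM; last exact: measurable_damped.
  exact: measurableT_comp mk (measurable_sub2r h).
have F0 r : (0 <= (k (sub2 h r) * damped M r)%:E)%E.
  by rewrite lee_fin mulr_ge0// damped_ge0.
rewrite (_ : (\int[mu2]_r (k (sub2 h r) * damped M r)%:E)%E = ((k h - damped M h) / M)%:E)//.
rewrite [LHS](@fubini_tonelli1 _ _ _ _ _ leb leb _ mF F0) /fubini_F.
rewrite /damped; case: h {mF F0} => h x; rewrite /sub2/=.
have [h0|h0] := leP h 0.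
  rewrite k_neg// mulr0 subrr mul0r integral0_eq// => t _.
  rewrite integral0_eq// => y _.
  have [t0|t0] := leP t 0; first by rewrite (@k_neg (t, y))// !mulr0.
  by rewrite k_neg ?mul0r//= subr_le0 (le_trans h0)// ltW.
transitivity (\int[leb]_t (((fun t => expR (- M * t)) \_ `]0%R, h[ t)%:E * (k (h, x))%:E))%E.
  apply: eq_integral => t _; rewrite /patch.
  case: ifPn => [/set_mem|/negP tI] /=.
    rewrite in_itv/= => /andP[t0 th].
    rewrite -{2}(subrK t h) -k_semigroup//; last by rewrite subr_gt0.
    rewrite -ge0_integralZl//.
    - by apply: eq_integral => y _; rewrite -EFinM; congr EFin; ring.
    - apply/measurable_EFinP; apply: measurable_funM.
      + apply: (measurableT_comp (measurableT_comp mk (pair1_measurable (h - t)))).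
        exact: measurable_funB.
      + exact: measurableT_comp mk (pair1_measurable t).
    - by move=> y _; rewrite lee_fin mulr_ge0.
  rewrite (_ : point = 0 :> T)// mul0e integral0_eq// => y _.
  have [t0|t0] := leP t 0; first by rewrite (@k_neg (t, y))// !mulr0.
  have [ht|th] := leP h t; first by rewrite k_neg ?mul0r//= subr_le0.
  by exfalso; apply: tI; rewrite inE/= in_itv/= t0.
rewrite ge0_integralZr//.
- rewrite integral_patch -(@integral_itv_bndoo _ 0%R h _ true false); last first.
    apply/measurable_EFinP; apply: measurable_funTS.
    by apply: (measurableT_comp (@measurable_expR R)); exact: measurable_funM.
  have Mn0 : M != 0 by rewrite gt_eqF.
  by rewrite integral_expRN// -EFinM; congr EFin; field.
- by apply/measurable_EFinP; exact: measurable_expR_patch.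
- by move=> t _; rewrite lee_fin /patch; case: ifP => // _; exact: expR_ge0.
- by rewrite lee_fin.
Qed.

(** The pointwise identity [gconv_damped] convolved with [G], by associativity and linearity. *)
Lemma resolvent (nu : {sigma_finite_measure set P -> \bar R}) (M : R) (G : P -> R) :
  0 < M -> nu.-integrable [set: P] (EFin \o G) ->
  {ae mu2, forall p, M * gconv sub2 mu2 k (gconv sub2 nu (damped M) G) p =
    gconv sub2 nu k G p - gconv sub2 nu (damped M) G p}.
Proof.
move=> M0 intG.
have intk : mu2.-integrable [set: P] (EFin \o k).
  by rewrite -damped0; exact: integrable_damped.
have intE := integrable_damped (ltW M0).
have lin := gconv_linl measurable_sub2 ge0_integral_sub2l (M^-1) (- M^-1) intk intE intG.
have assoc := gconvA measurable_sub2 sub2Dr ge0_integral_sub2l intk intE intG.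
apply: filterS2 lin assoc => p lin ->.
have -> : gconv sub2 mu2 k (damped M) = fun q => M^-1 * k q + - M^-1 * damped M q.
  apply/funext => q; apply: (mulfI (lt0r_neq0 M0)); rewrite gconv_damped//.
  by rewrite mulrDr mulNr mulrN !mulVKf// gt_eqF.
by rewrite lin mulrDr mulNr mulrN !mulVKf// gt_eqF.
Qed.

End kernel.

Section bounded_multiplier.
Context d (T : measurableType d) (R : realType) (mu : {measure set T -> \bar R}).

Lemma integrable_mulb (c z : T -> R) (C : R) : measurable_fun [set: T] c ->
  (forall x, `|c x| <= C) -> mu.-integrable [set: T] (EFin \o z) ->
  mu.-integrable [set: T] (fun x => (c x * z x)%:E).
Proof.
move=> mc cC intz.
apply: (@le_integrable _ _ _ mu _ measurableT _ (fun x => (C%:E * (z x)%:E)%E)).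
- apply/measurable_EFinP; apply: measurable_funM => //.
  exact: measurable_of_integrable intz.
- move=> x _; rewrite -EFinM lee_fin !normrM ler_wpM2r//.
  by rewrite (le_trans (cC x))// ler_norm.
- exact: integrableZl.
Qed.

End bounded_multiplier.

(** * The upwind iteration *)

Section lax_friedrichs.
Context {R : realType}.
Local Notation leb := (@lebesgue_measure R).
Local Notation mu2 := (prod_measure leb leb).
Local Notation T := (measurableTypeR R).
Local Notation P := (T * T)%type.
Variables (a : P -> R) (L dx : R).
Hypothesis ma : measurable_fun [set: P] a.
Hypothesis aL : forall p, `|a p| <= L.
Hypothesis dx0 : 0 < dx.

(** Lax-Friedrichs splitting of the flux: the two parts have nonnegative coefficients, travel in
    opposite directions, add up to [L z], and [right_part - left_part] is [a z]. *)
Definition left_part (z : P -> R) (p : P) := (L - a p) / 2 * z p.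
Definition right_part (z : P -> R) (p : P) := (L + a p) / 2 * z p.

(** Upwind discretization of [- d_x (a z)] without its diagonal term [- (L / dx) z]: each part is
    fetched from the side it comes from. *)
Definition lax_step (z : P -> R) (p : P) :=
  dx^-1 * left_part z (sub2 p (0, - dx)) + dx^-1 * right_part z (sub2 p (0, dx)).

Let a_le p : - L <= a p <= L.
Proof. by rewrite -ler_norml. Qed.

Lemma norm_left_right z p : `|left_part z p| + `|right_part z p| = L * `|z p|.
Proof.
have /andP[aL1 aL2] := a_le p.
have h1 : 0 <= (L - a p) / 2 by lra.
have h2 : 0 <= (L + a p) / 2 by lra.
rewrite /left_part /right_part (normrM ((L - a p) / 2)) (normrM ((L + a p) / 2)).
by rewrite (ger0_norm h1) (ger0_norm h2) -mulrDl; congr (_ * _); field.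
Qed.

Lemma measurable_left z : measurable_fun [set: P] z -> measurable_fun [set: P] (left_part z).
Proof.
move=> mz; apply: measurable_funM => //; apply: measurable_funM => //.
exact: measurable_funB.
Qed.

Lemma measurable_right z : measurable_fun [set: P] z -> measurable_fun [set: P] (right_part z).
Proof.
move=> mz; apply: measurable_funM => //; apply: measurable_funM => //.
exact: measurable_funD.
Qed.

Lemma integrable_left z : mu2.-integrable [set: P] (EFin \o z) ->
  mu2.-integrable [set: P] (EFin \o left_part z).
Proof.
move=> intz; apply: (@integrable_mulb _ _ _ _ _ _ L) => //.
  apply: measurable_funM => //; exact: measurable_funB.
move=> p; have /andP[aL1 aL2] := a_le p; rewrite ler_norml; lra.
Qed.

Lemma integrable_right z : mu2.-integrable [set: P] (EFin \o z) ->
  mu2.-integrable [set: P] (EFin \o right_part z).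
Proof.
move=> intz; apply: (@integrable_mulb _ _ _ _ _ _ L) => //.
  apply: measurable_funM => //; exact: measurable_funD.
move=> p; have /andP[aL1 aL2] := a_le p; rewrite ler_norml; lra.
Qed.

Lemma nrm1_left_right z : mu2.-integrable [set: P] (EFin \o z) ->
  nrm1 mu2 (left_part z) + nrm1 mu2 (right_part z) = L * nrm1 mu2 z.
Proof.
move=> intz; rewrite /nrm1 -RintegralD//; last 2 first.
- exact: integrable_norm (integrable_left intz).
- exact: integrable_norm (integrable_right intz).
rewrite -RintegralZl//; last exact: integrable_norm.
by apply: eq_Rintegral => p _; exact: norm_left_right.
Qed.

Lemma integrable_sub2 z (v : P) : mu2.-integrable [set: P] (EFin \o z) ->
  mu2.-integrable [set: P] (EFin \o (fun p => z (sub2 p v))).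
Proof.
apply: integrable_invariant; first exact: measurable_sub2l.
by move=> f mf f0; exact: ge0_integral_sub2l.
Qed.

Lemma nrm1_sub2 z (v : P) : measurable_fun [set: P] z ->
  nrm1 mu2 (fun p => z (sub2 p v)) = nrm1 mu2 z.
Proof.
move=> mz; have inv := @Rintegral_invariant _ _ _ mu2 (fun p => sub2 p v)
  (fun f mf f0 => ge0_integral_sub2l v mf f0).
by rewrite /nrm1; apply: (inv (fun p => `|z p|)); exact: measurableT_comp.
Qed.

Lemma integrable_lax z : mu2.-integrable [set: P] (EFin \o z) ->
  mu2.-integrable [set: P] (EFin \o lax_step z).
Proof.
move=> intz; apply: integrable_lin.
- exact/integrable_sub2/integrable_left.
- exact/integrable_sub2/integrable_right.
Qed.

Lemma nrm1_lax z : mu2.-integrable [set: P] (EFin \o z) ->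
  nrm1 mu2 (lax_step z) <= L / dx * nrm1 mu2 z.
Proof.
move=> intz.
have il := integrable_sub2 (0, - dx) (integrable_left intz).
have ir := integrable_sub2 (0, dx) (integrable_right intz).
have mz := measurable_of_integrable intz.
have dxi : 0 <= dx^-1 by rewrite invr_ge0 ltW.
apply: (@le_trans _ _ (nrm1 mu2 (fun p => dx^-1 * left_part z (sub2 p (0, - dx))) +
   nrm1 mu2 (fun p => dx^-1 * right_part z (sub2 p (0, dx))))).
  apply: nrm1_triangle.
  - exact: measurable_of_integrable (integrable_lax intz).
  - exact: integrable_scale.
  - exact: integrable_scale.
  - by apply/aeW => p; exact: ler_normD.
rewrite !nrm1Z// !nrm1_sub2//; last 2 first.
- exact: measurable_right.
- exact: measurable_left.
by rewrite -mulrDr nrm1_left_right// ger0_norm// mulrA (mulrC _ L).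
Qed.

Lemma lax_lin z y : lax_step (fun p => 1 * z p + -1 * y p) =
  fun p => 1 * lax_step z p + -1 * lax_step y p.
Proof. by apply/funext => p; rewrite /lax_step /left_part /right_part; ring. Qed.

(** A shift in space keeps the norm of every time slice, and the two coefficients are nonnegative
    with sum [L], so nothing is lost in the splitting. *)
Lemma lax_slice (z : P -> R) (t : T) : measurable_fun [set: P] z ->
  (\int[leb]_x `|lax_step z (t, x)|%:E <= (L / dx)%:E * \int[leb]_x `|z (t, x)|%:E)%E.
Proof.
move=> mz.
have dxi : 0 <= dx^-1 by rewrite invr_ge0 ltW.
pose l (y : T) : \bar R := `|left_part z (t, y)|%:E.
pose r (y : T) : \bar R := `|right_part z (t, y)|%:E.
have ml : measurable_fun [set: T] l.
  apply/measurable_EFinP; apply: measurableT_comp => //.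
  exact: measurableT_comp (measurable_left mz) (pair1_measurable t).
have mr : measurable_fun [set: T] r.
  apply/measurable_EFinP; apply: measurableT_comp => //.
  exact: measurableT_comp (measurable_right mz) (pair1_measurable t).
have mls : measurable_fun [set: T] (fun y => l (y + dx)).
  by apply: (measurableT_comp ml); exact: measurable_funD.
have mrs : measurable_fun [set: T] (fun y => r (y + - dx)).
  by apply: (measurableT_comp mr); exact: measurable_funD.
have l0 y : (0 <= l y)%E by rewrite lee_fin.
have r0 y : (0 <= r y)%E by rewrite lee_fin.
apply: (@le_trans _ _ (\int[leb]_x (dx^-1%:E * (l (x + dx)%R + r (x + - dx)%R)))%E).
  apply: ge0_le_integral => //.
  - apply/measurable_EFinP; apply: measurableT_comp => //.
    apply: (measurableT_comp (f := lax_step z)); last exact: pair1_measurable.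
    by apply: measurable_funD; apply: measurable_funM => //;
      [apply: (measurableT_comp (measurable_left mz))|apply: (measurableT_comp (measurable_right mz))];
      exact: measurable_sub2l.
  - by apply: measurable_funeM; exact: emeasurable_funD.
  - move=> x _; rewrite /l /r -EFinD -EFinM lee_fin /lax_step /sub2/= subr0 opprK.
    by rewrite (le_trans (ler_normD _ _))// !normrM (ger0_norm dxi) mulrDr.
rewrite ge0_integralZl//; last 2 first.
- exact: emeasurable_funD.
- by move=> x _; exact: adde_ge0.
rewrite ge0_integralD// (ge0_integral_shift dx ml l0) (ge0_integral_shift (- dx) mr r0).
rewrite -ge0_integralD//.
rewrite [leRHS](_ : _ = dx^-1%:E * (L%:E * \int[leb]_x `|z (t, x)|%:E))%E; last first.
  by rewrite muleA -EFinM mulrC.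
apply: lee_pmul => //; first by apply: integral_ge0 => x _; exact: adde_ge0.
rewrite -ge0_integralZl//.
- rewrite le_eqVlt; apply/orP; left; apply/eqP; apply: eq_integral => x _.
  by rewrite /l /r -EFinD norm_left_right EFinM.
- apply/measurable_EFinP; apply: measurableT_comp => //.
  exact: measurableT_comp mz (pair1_measurable t).
- by rewrite lee_fin (le_trans _ (aL (0, 0))).
Qed.

End lax_friedrichs.

Lemma le_abs_Rintegral d (T : measurableType d) (R : realType)
    (mu : {measure set T -> \bar R}) (f : T -> R) : measurable_fun [set: T] f ->
  ((`|\int[mu]_x f x|%:E : \bar R) <= \int[mu]_x `|f x|%:E)%E.
Proof.
move=> /measurable_EFinP mf.
apply: (@le_trans _ _ (`|\int[mu]_x (f x)%:E|)%E); last exact: le_abse_integral.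
rewrite /Rintegral; case: (\int[mu]_x (f x)%:E)%E => [r| |] //=; by rewrite normr0 leey.
Qed.

Lemma patch_itvE (R : realType) (f : R -> R) (i : interval R) (s : R) :
  (f \_ [set` i]) s = if s \in i then f s else 0.
Proof. rewrite /patch; case: ifPn => [/set_mem/= ->//|/negP si].
by case: ifPn => // si'; exfalso; apply: si; exact/mem_set. Qed.

(** The value is the [fine] of a difference of two Tonelli integrals, each measurable in the
    parameter; parameters with a divergent integral are included. *)
Lemma measurable_Rintegral_param d1 d2 (T1 : measurableType d1)
    (T2 : measurableType d2) (R : realType)
    (m : {sigma_finite_measure set T2 -> \bar R}) (F : T1 * T2 -> R) :
  measurable_fun [set: T1 * T2] F ->
  measurable_fun [set: T1] (fun x => \int[m]_y F (x, y)).
Proof.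
move=> /measurable_EFinP mF; apply: (measurableT_comp (f := fine)) => //.
have mp := @measurable_fun_fubini_tonelli_F _ _ T1 T2 R m _
  (measurable_funepos mF) (funepos_ge0 _).
have mn := @measurable_fun_fubini_tonelli_F _ _ T1 T2 R m _
  (measurable_funeneg mF) (funeneg_ge0 _).
have := emeasurable_funB mp mn; congr (measurable_fun _ _).
apply/funext => x; rewrite [RHS]integralE; congr (_ - _)%E.
- by apply: eq_integral => r _; rewrite !funeposE.
- by apply: eq_integral => r _; rewrite !funenegE.
Qed.

(** * Space norms of the damped iterates at each time *)

Section iteration.
Context {R : realType}.
Local Notation leb := (@lebesgue_measure R).
Local Notation mu2 := (prod_measure leb leb).
Local Notation T := (measurableTypeR R).
Local Notation P := (T * T)%type.
Variables (k : P -> R) (lam : R).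
Hypothesis mk : measurable_fun [set: P] k.
Hypothesis k_ge0 : forall p, 0 <= k p.
Hypothesis k_neg : forall p, p.1 <= 0 -> k p = 0.
Hypothesis k_mass : forall t : R, 0 < t ->
  (\int[leb]_x (k (t, x))%:E <= (expR (- lam * t))%:E)%E.
Hypothesis k_semigroup : forall s t x : R, 0 < s -> 0 < t ->
  (\int[leb]_y (k (t, x - y) * k (s, y))%:E = (k (t + s, x))%:E)%E.
Hypothesis lam0 : 0 < lam.

Definition decay (c : R) : T -> R := (fun s => expR (- c * s)) \_ `[0, +oo[.

Lemma decay_ge0 c s : 0 <= decay c s.
Proof. by rewrite /decay /patch; case: ifP => // _; exact: expR_ge0. Qed.

Lemma measurable_decay c : measurable_fun [set: T] (decay c).
Proof. exact: measurable_expR_patch. Qed.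

(** By Tonelli and translation invariance in space, what counts is the mass of [damped k M] on the
    slice at time [t - r.1]. The general [nu] covers the datum and the upwind step alike. *)
Lemma gconv_slice (nu : {sigma_finite_measure set P -> \bar R}) (G : P -> R) (M t : R) :
  measurable_fun [set: P] G ->
  (\int[leb]_x `|gconv sub2 nu (damped k M) G (t, x)|%:E <=
   \int[nu]_r (decay (lam + M) (t - r.1) * `|G r|)%:E)%E.
Proof.
move=> mG; have mE := measurable_damped mk M.
have E0 p : 0 <= damped k M p by apply: damped_ge0.
pose F (z : T * P) := (damped k M (sub2 (t, z.1) z.2) * `|G z.2|)%:E.
have F0 z : (0 <= F z)%E by rewrite lee_fin mulr_ge0.
have mtz : measurable_fun [set: T * P] (fun z : T * P => sub2 (t, z.1) z.2).
  have m : measurable_fun [set: T * P] (fun z : T * P => ((t, z.1) : P, z.2)).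
    by apply: measurable_fun_pair => //=; exact: measurable_fun_pair.
  exact: (measurableT_comp measurable_sub2 m).
have mF : measurable_fun [set: T * P] F.
  apply/measurable_EFinP; apply: measurable_funM.
    exact: (measurableT_comp mE mtz).
  apply: measurableT_comp => //; exact: (measurableT_comp mG measurable_snd).
have mGslice x : measurable_fun [set: P] (fun r => damped k M (sub2 (t, x) r) * G r).
  apply: measurable_funM => //; exact: (measurableT_comp mE (measurable_sub2r (t, x))).
have mU : measurable_fun [set: T] (fun x => `|gconv sub2 nu (damped k M) G (t, x)|%:E).
  apply/measurable_EFinP; apply: measurableT_comp => //.
  apply: (@measurable_Rintegral_param _ _ T P R nu
    (fun z : T * P => damped k M (sub2 (t, z.1) z.2) * G z.2)).
  apply: measurable_funM; first exact: (measurableT_comp mE mtz).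
  exact: (measurableT_comp mG measurable_snd).
apply: (@le_trans _ _ (\int[leb]_x \int[nu]_r F (x, r))%E).
  apply: ge0_le_integral => //.
  - exact: measurable_fun_fubini_tonelli_F.
  - move=> x _; apply: (le_trans (le_abs_Rintegral nu (mGslice x))).
    rewrite le_eqVlt; apply/orP; left; apply/eqP; apply: eq_integral => r _.
    by rewrite /F /= normrM (ger0_norm (E0 _)).
rewrite (fubini_tonelli (m1 := leb) (m2 := nu) F mF F0).
apply: ge0_le_integral => //.
- by move=> r _; exact: integral_ge0.
- exact: measurable_fun_fubini_tonelli_G.
- apply/measurable_EFinP; apply: measurable_funM; last exact: measurableT_comp.
  exact: (measurableT_comp (measurable_decay (lam + M))
    (measurable_funB (measurable_cst t) measurable_fst)).
move=> r _; rewrite /F/=.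
have mEr : measurable_fun [set: T] (fun x => (damped k M (t - r.1, x))%:E).
  by apply/measurable_EFinP; exact: (measurableT_comp mE (pair1_measurable _)).
have mErs : measurable_fun [set: T] (fun x => (damped k M (t - r.1, x - r.2))%:E).
  apply: (measurableT_comp mEr); exact: measurable_funB.
rewrite [leLHS](_ : _ = (\int[leb]_x (damped k M (t - r.1, x - r.2))%:E) * `|G r|%:E)%E; last first.
  by rewrite -ge0_integralZr// => x _; rewrite lee_fin.
rewrite EFinM lee_pmul//.
- by apply: integral_ge0 => x _; rewrite lee_fin.
have := ge0_integral_shift (- r.2) mEr; rewrite /sub2/= => ->; last first.
  by move=> x; rewrite lee_fin.
exact: damped_slice.
Qed.

(** The exponents combine to [exp(- (lam + M) t) exp(M s)] on [0 <= s <= t]. Multiplied by [M], the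
    result is exactly what the damping removes from [decay lam t]. *)
Lemma decay_conv (M t : R) : 0 < M ->
  (\int[leb]_s (decay (lam + M) (t - s) * decay lam s)%:E =
   ((decay lam t - decay (lam + M) t) / M)%:E)%E.
Proof.
move=> M0; have Mn0 : M != 0 by rewrite gt_eqF.
have mexp : measurable_fun `]0, t[ (fun s => (expR (- - M * s))%:E).
  apply/measurable_EFinP; apply: measurable_funTS.
  by apply: (measurableT_comp (@measurable_expR R)); exact: measurable_funM.
transitivity (\int[leb]_s ((expR (- (lam + M) * t))%:E *
    (((fun s => expR (- - M * s)) \_ `[0%R, t]) s)%:E))%E.
  apply: eq_integral => s _; rewrite /decay !patch_itvE -EFinM; congr EFin.
  rewrite !in_itv/= !andbT subr_ge0.
  case: (leP s t) => st; case: (leP 0 s) => s0 /=; rewrite ?mulr0 ?mul0r//.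
  by rewrite -!expRD; congr expR; ring.
rewrite ge0_integralZl//; first last.
- by move=> s _; rewrite lee_fin /patch; case: ifP => // _; exact: expR_ge0.
- by apply/measurable_EFinP; exact: measurable_expR_patch.
rewrite integral_patch /decay !patch_itvE !in_itv/= !andbT.
case: (ltgtP t 0) => t0.
- by rewrite set_itv_ge ?bnd_simp -?ltNge// integral_set0 mule0 subrr mul0r.
- rewrite integral_expRN ?oppr_eq0// -EFinM; congr EFin.
  have -> : expR (- (lam + M) * t) = expR (- lam * t) * expR (- M * t).
    by rewrite -expRD; congr expR; ring.
  have e1 : expR (- M * t) * expR (- - M * t) = 1.
    by rewrite -expRD -expR0; congr expR; ring.
  rewrite mulrA mulrBr mulr1 -(mulrA _ _ (expR (- - M * t))) e1.
  by field.
- by rewrite t0 set_itv1 integral_set1 mule0 !mulr0 subrr mul0r.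
Qed.

Variables (a : P -> R) (L dx : R) (w0 : T -> R).
Hypothesis ma : measurable_fun [set: P] a.
Hypothesis aL : forall p, `|a p| <= L.
Hypothesis L0 : 0 < L.
Hypothesis dx0 : 0 < dx.
Hypothesis intw0 : leb.-integrable [set: T] (EFin \o w0).

(** Dirac mass in time times Lebesgue measure in space: an initial value then has the same form as a
    source in the plane, and Young, associativity and [resolvent] apply to both. *)
Definition source0 : {sigma_finite_measure set P -> \bar R} :=
  prod_measure (\d_ (0 : T)) leb.
Definition datum (r : P) := w0 r.2.

Let rate := L / dx.

Let rate0 : 0 < rate.
Proof. by rewrite divr_gt0. Qed.

Fixpoint lax_iter (n : nat) : P -> R :=
  if n is m.+1 then fun p => 1 * gconv sub2 source0 (damped k rate) datum p +
    1 * gconv sub2 mu2 (damped k rate) (lax_step a L dx (lax_iter m)) p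
  else fun=> 0.

Let mw0 : measurable_fun [set: T] w0.
Proof. exact: measurable_of_integrable intw0. Qed.

Lemma measurable_datum : measurable_fun [set: P] datum.
Proof. exact: (measurableT_comp mw0 measurable_snd). Qed.

Lemma integral_source0 (f : P -> \bar R) : measurable_fun [set: P] f ->
  (forall p, (0 <= f p)%E) ->
  (\int[source0]_r f r = \int[leb]_y f (0%R, y))%E.
Proof.
move=> mf f0.
rewrite [LHS](@fubini_tonelli1 _ _ _ _ _ (\d_ (0 : T)) leb f mf f0).
rewrite integral_dirac//; last exact: measurable_fun_fubini_tonelli_F.
by rewrite diracT mul1e.
Qed.

Lemma integrable_datum : source0.-integrable [set: P] (EFin \o datum).
Proof.
apply/integrableP; split; first by apply/measurable_EFinP; exact: measurable_datum.
rewrite integral_source0//; last first.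
  by apply: measurableT_comp => //; apply/measurable_EFinP; exact: measurable_datum.
by have /integrableP[] := intw0.
Qed.

Let intE : mu2.-integrable [set: P] (EFin \o damped k rate).
Proof. exact: (integrable_damped mk k_ge0 k_neg k_mass lam0 (ltW rate0)). Qed.

Lemma integrable_lax_iter n : mu2.-integrable [set: P] (EFin \o lax_iter n).
Proof.
elim: n => [|n IHn] /=; first exact: integrable0.
apply: integrable_lin.
- exact: (integrable_conv2 intE integrable_datum).
- exact: (integrable_conv2 intE (integrable_lax dx ma aL IHn)).
Qed.

(** The bound closes under induction without loss: the upwind step costs [rate], and [decay_conv]
    returns a factor [1 / rate]. *)
Lemma lax_iter_slice n t :
  (\int[leb]_x `|lax_iter n (t, x)|%:E <= (nrm1 leb w0 * decay lam t)%:E)%E.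
Proof.
elim: n t => [|n IHn] t.
  rewrite /= integral0_eq => [|x _]; last by rewrite normr0.
  by rewrite lee_fin mulr_ge0 ?nrm1_ge0 ?decay_ge0.
have mz := measurable_of_integrable (integrable_lax_iter n).
have mlax := measurable_of_integrable (integrable_lax dx ma aL (integrable_lax_iter n)).
have mabs (f : P -> R) : measurable_fun [set: P] f ->
    measurable_fun [set: T] (fun x => `|f (t, x)|%:E).
  move=> mf; apply/measurable_EFinP; apply: measurableT_comp => //.
  exact: (measurableT_comp mf (pair1_measurable t)).
pose A := gconv sub2 source0 (damped k rate) datum.
pose B := gconv sub2 mu2 (damped k rate) (lax_step a L dx (lax_iter n)).
have mA : measurable_fun [set: P] A.
  exact: measurable_of_integrable (integrable_conv2 intE integrable_datum).
have mB : measurable_fun [set: P] B.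
  apply: measurable_of_integrable (integrable_conv2 intE _).
  exact: (integrable_lax dx ma aL (integrable_lax_iter n)).
apply: (@le_trans _ _ (\int[leb]_x (`|A (t, x)|%:E + `|B (t, x)|%:E))%E).
  apply: ge0_le_integral => //.
  - exact: (mabs _ (measurable_of_integrable (integrable_lax_iter n.+1))).
  - by apply: emeasurable_funD; exact: mabs.
  - by move=> x _; rewrite -EFinD lee_fin /= !mul1r; exact: ler_normD.
rewrite ge0_integralD//; [|exact: mabs|exact: mabs].
(* The target splits into the share of the datum, which decays at rate [lam + rate], and the share
   of the upwind step in the form produced by [decay_conv]. *)
have -> : nrm1 leb w0 * decay lam t = nrm1 leb w0 * decay (lam + rate) t +
    nrm1 leb w0 * rate * ((decay lam t - decay (lam + rate) t) / rate).
  by field; rewrite gt_eqF.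
rewrite EFinD; apply: leeD.
  apply: (le_trans (gconv_slice source0 rate t measurable_datum)).
  rewrite integral_source0; first last.
  - by move=> p; rewrite lee_fin mulr_ge0 ?decay_ge0.
  - apply/measurable_EFinP; apply: measurable_funM; last first.
      exact: (measurableT_comp (@normr_measurable R setT) measurable_datum).
    exact: (measurableT_comp (measurable_decay (lam + rate))
      (measurable_funB (measurable_cst t) measurable_fst)).
  rewrite /datum/= subr0; under eq_integral do rewrite EFinM.
  rewrite ge0_integralZl//; first last.
  - by rewrite lee_fin decay_ge0.
  - by apply/measurable_EFinP; exact: measurableT_comp.
  by rewrite mulrC EFinM EFin_nrm1.
apply: (le_trans (gconv_slice mu2 rate t mlax)).
have mF : measurable_fun [set: P] (fun r => (decay (lam + rate) (t - r.1) *
    `|lax_step a L dx (lax_iter n) r|)%:E).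
  apply/measurable_EFinP; apply: measurable_funM; last exact: measurableT_comp.
  exact: (measurableT_comp (measurable_decay (lam + rate))
    (measurable_funB (measurable_cst t) measurable_fst)).
have F0 p : (0 <= (decay (lam + rate) (t - p.1) * `|lax_step a L dx (lax_iter n) p|)%:E)%E.
  by rewrite lee_fin mulr_ge0 ?decay_ge0.
rewrite [leLHS](@fubini_tonelli1 _ _ _ _ _ leb leb _ mF F0).
have md (c : R) : measurable_fun [set: T] (decay c) by exact: measurable_decay.
have mdt : measurable_fun [set: T] (fun s => decay (lam + rate) (t - s)).
  by apply: (measurableT_comp (md _)); exact: measurable_funB.
apply: (@le_trans _ _ (\int[leb]_s ((rate * nrm1 leb w0)%:E *
    (decay (lam + rate) (t - s) * decay lam s)%:E))%E).
  apply: ge0_le_integral => //.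
  - by move=> s _; exact: integral_ge0.
  - exact: measurable_fun_fubini_tonelli_F.
  - apply/measurable_EFinP; apply: measurable_funM => //.
    exact: measurable_funM.
  move=> s _; rewrite /fubini_F/=; under eq_integral do rewrite EFinM.
  rewrite ge0_integralZl//; first last.
  - by rewrite lee_fin decay_ge0.
  - apply/measurable_EFinP; apply: measurableT_comp => //.
    exact: (measurableT_comp mlax (pair1_measurable s)).
  rewrite [leRHS](_ : _ = (decay (lam + rate) (t - s))%:E *
      ((rate * nrm1 leb w0)%:E * (decay lam s)%:E))%E; last first.
    by rewrite -!EFinM; congr EFin; ring.
  apply: lee_pmul => //.
  - by rewrite lee_fin decay_ge0.
  - exact: integral_ge0.
  apply: (le_trans (lax_slice ma aL dx0 s mz)).
  rewrite (EFinM rate) -muleA; apply: lee_pmul => //.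
  - by rewrite lee_fin ltW.
  - exact: integral_ge0.
rewrite ge0_integralZl//; first last.
- by rewrite lee_fin mulr_ge0 ?nrm1_ge0// ltW.
- by move=> s _; rewrite lee_fin mulr_ge0 ?decay_ge0.
- by apply/measurable_EFinP; exact: measurable_funM.
by rewrite decay_conv// -EFinM (mulrC rate).
Qed.

End iteration.

(** Algebra of [lax_iter_mild] at one point. [E1], [E2] are the damped convolutions of the datum and
    of the upwind step, [kE1], [kE2] their convolutions with [k]; [h], [ks] are the undamped ones.
    [kl], [kr] carry shifted kernels, [kL], [kR] unshifted ones, against the left and right
    parts. *)
Lemma lax_algebra (R : realFieldType) (r d h L E1 E2 kE1 kE2 kl kr ks kL kR kZ kZ' Z' : R) :
  r * kE1 = h - E1 -> r * kE2 = ks - E2 -> kZ' = 1 * kE1 + 1 * kE2 ->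
  ks = d * kl + d * kr -> kL + kR = L * kZ -> r = L * d -> Z' = 1 * E1 + 1 * E2 ->
  Z' = h + (d * kl + - d * kL) - (d * kR + - d * kr) + r * (1 * kZ + -1 * kZ').
Proof.
move=> e1 e2 -> e4 e5 er ->; rewrite !mul1r mulN1r mulrBr mulrDr e1 e2 e4.
have -> : r * kZ = d * (kL + kR) by rewrite er e5; ring.
by ring.
Qed.

(** Here [x], [z] are successive errors, [y] the difference of the iterates, [w] the norm of the
    solution. Half of [x] on the right is absorbed on the left, whence the factor 2. *)
Lemma close_algebra (R : realFieldType) (x y z w c q L eta : R) :
  (2^-1 + c) * y <= eta -> x <= q * (L * z) + eta * (L * w) + c * y ->
  q * (L * z) <= 2^-1 * (x + y) -> x <= 2 * eta * (L * w + 1).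
Proof.
rewrite (mulrDl _ c) => ed h1 h2.
have -> : 2 * eta * (L * w + 1) = 2 * (eta * (L * w)) + 2 * eta by ring.
move: (eta * (L * w)) (c * y) (q * (L * z)) ed h1 h2 => b d e ed h1 h2.
lra.
Qed.

(** * Comparison of the iterates with the solution *)

Section comparison.
Context {R : realType}.
Local Notation leb := (@lebesgue_measure R).
Local Notation mu2 := (prod_measure leb leb).
Local Notation T := (measurableTypeR R).
Local Notation P := (T * T)%type.
Variables (k : P -> R) (lam : R).
Hypothesis mk : measurable_fun [set: P] k.
Hypothesis k_ge0 : forall p, 0 <= k p.
Hypothesis k_neg : forall p, p.1 <= 0 -> k p = 0.
Hypothesis k_mass : forall t : R, 0 < t ->
  (\int[leb]_x (k (t, x))%:E <= (expR (- lam * t))%:E)%E.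
Hypothesis k_semigroup : forall s t x : R, 0 < s -> 0 < t ->
  (\int[leb]_y (k (t, x - y) * k (s, y))%:E = (k (t + s, x))%:E)%E.
Hypothesis lam0 : 0 < lam.
Variables (a : P -> R) (L : R) (w0 : T -> R) (Q W : P -> R).
Hypothesis ma : measurable_fun [set: P] a.
Hypothesis aL : forall p, `|a p| <= L.
Hypothesis L0 : 0 < L.
Hypothesis intw0 : leb.-integrable [set: T] (EFin \o w0).
Hypothesis intQ : mu2.-integrable [set: P] (EFin \o Q).
Hypothesis intW : mu2.-integrable [set: P] (EFin \o W).
Hypothesis W_mild : {ae mu2, forall p, W p =
  gconv sub2 source0 k (datum w0) p - gconv sub2 mu2 Q (fun r => a r * W r) p}.

(** Discrete stand-ins for [Q], forward here and backward below: the form that the shifts of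
    [lax_step] take once they are moved to the kernel. *)
Definition right_quotient (dx : R) (p : P) := dx^-1 * k (sub2 p (0, - dx)) + - dx^-1 * k p.
Definition left_quotient (dx : R) (p : P) := dx^-1 * k p + - dx^-1 * k (sub2 p (0, dx)).

Let intk : mu2.-integrable [set: P] (EFin \o k).
Proof.
by have := integrable_damped mk k_ge0 k_neg k_mass lam0 (lexx 0); rewrite damped0.
Qed.

Lemma integrable_right_quotient dx : mu2.-integrable [set: P] (EFin \o right_quotient dx).
Proof. by apply: integrable_lin => //; exact: (integrable_sub2 _ intk). Qed.

Lemma integrable_left_quotient dx : mu2.-integrable [set: P] (EFin \o left_quotient dx).
Proof. by apply: integrable_lin => //; exact: (integrable_sub2 _ intk). Qed.

Section fixed_mesh.
Variable dx : R.
Hypothesis dx0 : 0 < dx.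

Let rate := L / dx.
Let rate0 : 0 < rate.
Proof. by rewrite divr_gt0. Qed.

Let intE : mu2.-integrable [set: P] (EFin \o damped k rate).
Proof. exact: (integrable_damped mk k_ge0 k_neg k_mass lam0 (ltW rate0)). Qed.

Let linr (nu : {sigma_finite_measure set P -> \bar R}) (A G H : P -> R) (c e : R) :=
  @gconv_linr _ P R mu2 sub2 measurable_sub2 ge0_integral_sub2l nu A G H c e.
Let linl (nu : {sigma_finite_measure set P -> \bar R}) (A B G : P -> R) (c e : R) :=
  @gconv_linl _ P R mu2 sub2 measurable_sub2 ge0_integral_sub2l nu A B G c e.

Let Z n := lax_iter k a L dx w0 n.
Let intZ n : mu2.-integrable [set: P] (EFin \o Z n).
Proof. exact: (integrable_lax_iter mk k_ge0 k_neg k_mass lam0 ma aL L0 dx0 intw0). Qed.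

(* The resolvent identity removes the damping [exp(-(L/dx) t)] of the
   iteration, whose right-hand side then becomes a discretization of the
   mild equation up to the difference of two successive iterates. *)
Lemma lax_iter_mild n : {ae mu2, forall p, Z n.+1 p =
  gconv sub2 source0 k (datum w0) p
  + gconv sub2 mu2 (right_quotient dx) (left_part a L (Z n)) p
  - gconv sub2 mu2 (left_quotient dx) (right_part a L (Z n)) p
  + rate * gconv sub2 mu2 k (fun r => 1 * Z n r + -1 * Z n.+1 r) p}.
Proof.
have intl := integrable_left ma aL (intZ n).
have intr := integrable_right ma aL (intZ n).
have intlax := integrable_lax dx ma aL (intZ n).
have intd := integrable_datum intw0.
have e1 := resolvent mk k_ge0 k_neg k_mass k_semigroup lam0 rate0 intd.
have e2 := resolvent mk k_ge0 k_neg k_mass k_semigroup lam0 rate0 intlax.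
have e3 := linr 1 1 intk (integrable_conv2 intE intd) (integrable_conv2 intE intlax).
have e4 := linr dx^-1 dx^-1 intk (integrable_sub2 (0, - dx) intl) (integrable_sub2 (0, dx) intr).
have e5 := linl dx^-1 (- dx^-1) (integrable_sub2 (0, - dx) intk) intk intl.
have e6 := linl dx^-1 (- dx^-1) intk (integrable_sub2 (0, dx) intk) intr.
have e7 := linr 1 1 intk intl intr.
have e8 := linr L 0 intk (intZ n) (intZ n).
have e9 := linr 1 (-1) intk (intZ n) (intZ n.+1).
apply: (filter_app _ _ e1); apply: (filter_app _ _ e2); apply: (filter_app _ _ e3).
apply: (filter_app _ _ e4); apply: (filter_app _ _ e5); apply: (filter_app _ _ e6).
apply: (filter_app _ _ e7); apply: (filter_app _ _ e8); apply: (filter_app _ _ e9).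
apply: aeW => p {}e9 {}e8 {}e7 {}e6 {}e5 {}e4 {}e3 {}e2 {}e1.
have shiftE (G : P -> R) (v : P) : measurable_fun [set: P] G ->
    gconv sub2 mu2 k (fun r => G (sub2 r v)) p = gconv sub2 mu2 (fun q => k (sub2 q v)) G p.
  move=> mG; apply/esym.
  exact: (gconv_shift measurable_sub2 sub2_shift ge0_integral_sub2l v p mk mG).
rewrite (shiftE _ (0, - dx) (measurable_of_integrable intl)) in e4.
rewrite (shiftE _ (0, dx) (measurable_of_integrable intr)) in e4.
rewrite -/(right_quotient dx) in e5; rewrite -/(left_quotient dx) in e6.
have e78 : gconv sub2 mu2 k (left_part a L (Z n)) p + gconv sub2 mu2 k (right_part a L (Z n)) p
    = L * gconv sub2 mu2 k (Z n) p.
  transitivity (L * gconv sub2 mu2 k (Z n) p + 0 * gconv sub2 mu2 k (Z n) p); last by rewrite mul0r addr0.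
  rewrite -e8 -[LHS]addr0 -[in LHS](subrr 1) -[X in X + _ + _]mul1r -[X in _ + X + _]mul1r subrr addr0 -e7.
  by congr (gconv _ _ _ _ _); apply/funext => r; rewrite /left_part /right_part; field.
rewrite e5 e6 e9.
exact: (lax_algebra e1 e2 e3 e4 e78 erefl erefl).
Qed.

Let diff n (r : P) := 1 * Z n r + -1 * Z n.+1 r.

Let intdiff n : mu2.-integrable [set: P] (EFin \o diff n).
Proof. exact: (integrable_lin 1 (-1) (intZ n) (intZ n.+1)). Qed.

(** Young's inequality, with mass at most [1 / (lam + rate)] against the cost [rate] of the upwind
    step. The ratio is below 1 on each mesh but tends to 1 as [dx -> 0]. *)
Lemma nrm1_diff n : nrm1 mu2 (diff n.+1) <= rate / (lam + rate) * nrm1 mu2 (diff n).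
Proof.
have intlax := integrable_lax dx ma aL (intdiff n).
have intl m := integrable_lax dx ma aL (intZ m).
have intd := integrable_datum intw0.
apply: (@le_trans _ _ (nrm1 mu2 (gconv sub2 mu2 (damped k rate) (lax_step a L dx (diff n))))).
  have e1 := linr 1 (-1) intE (intl n) (intl n.+1).
  have lx := lax_lin a L dx (Z n) (Z n.+1).
  rewrite -lx in e1.
  rewrite le_eqVlt; apply/orP; left; apply/eqP; apply: ae_eq_Rintegral.
  - by apply: measurableT_comp => //; exact: measurable_of_integrable (intdiff n.+1).
  - by apply: measurableT_comp => //; exact: measurable_of_integrable (integrable_conv2 intE intlax).
  apply: filterS e1 => p e1; congr (`|_|); rewrite e1 /diff /Z /=; ring.
apply: (le_trans (nrm1_conv2 intE intlax)).
rewrite -(mulrA rate) mulrCA; apply: ler_pM; try exact: nrm1_ge0.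
  exact: (nrm1_damped mk k_ge0 k_neg k_mass lam0 (ltW rate0)).
exact: (nrm1_lax ma aL dx0 (intdiff n)).
Qed.

Lemma nrm1_diff_exp n : nrm1 mu2 (diff n) <= (rate / (lam + rate)) ^+ n * nrm1 mu2 (diff 0).
Proof.
elim: n => [|n IHn]; first by rewrite expr0 mul1r.
rewrite exprS -mulrA (le_trans (nrm1_diff n))// ler_wpM2l//.
by rewrite divr_ge0// ?addr_ge0// ltW.
Qed.

Let err n (r : P) := 1 * Z n r + -1 * W r.

Let interr n : mu2.-integrable [set: P] (EFin \o err n).
Proof. exact: (integrable_lin 1 (-1) (intZ n) intW). Qed.

Variables (q eta : R).
Hypothesis rq : nrm1 mu2 (right_quotient dx) <= q.
Hypothesis lq : nrm1 mu2 (left_quotient dx) <= q.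
Hypothesis rQ : nrm1 mu2 (fun p => 1 * right_quotient dx p + -1 * Q p) <= eta.
Hypothesis lQ : nrm1 mu2 (fun p => 1 * left_quotient dx p + -1 * Q p) <= eta.

(** Subtract the equation of [W] from [lax_iter_mild]: [t1], [t2] carry the previous error, [t3],
    [t4] the error of the difference quotients, [t5] the residual of the iteration. Left and right
    parts recombine by [nrm1_left_right], so the previous error enters with the factor [q * L],
    which does not grow as the mesh is refined. *)
Lemma nrm1_err n : nrm1 mu2 (err n.+1) <=
  q * (L * nrm1 mu2 (err n)) + eta * (L * nrm1 mu2 W) + rate / lam * nrm1 mu2 (diff n).
Proof.
have irq := integrable_right_quotient dx; have ilq := integrable_left_quotient dx.
have intl := integrable_left ma aL (intZ n).
have intr := integrable_right ma aL (intZ n).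
have intlW := integrable_left ma aL intW.
have intrW := integrable_right ma aL intW.
have intle := integrable_left ma aL (interr n).
have intre := integrable_right ma aL (interr n).
have e0 := linr 1 (-1) intQ intrW intlW.
have e1 := linr 1 (-1) irq intl intlW.
have e2 := linr 1 (-1) ilq intr intrW.
have e3 := linl 1 (-1) irq intQ intlW.
have e4 := linl 1 (-1) ilq intQ intrW.
pose t1 := gconv sub2 mu2 (right_quotient dx) (left_part a L (err n)).
pose t2 := gconv sub2 mu2 (left_quotient dx) (right_part a L (err n)).
pose t3 := gconv sub2 mu2 (fun p => 1 * right_quotient dx p + -1 * Q p) (left_part a L W).
pose t4 := gconv sub2 mu2 (fun p => 1 * left_quotient dx p + -1 * Q p) (right_part a L W).
pose t5 := gconv sub2 mu2 k (diff n).
have intrQ := integrable_lin 1 (-1) irq intQ.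
have intlQ := integrable_lin 1 (-1) ilq intQ.
have i1 : mu2.-integrable [set: P] (EFin \o t1) := integrable_conv2 irq intle.
have i2 : mu2.-integrable [set: P] (EFin \o t2) := integrable_conv2 ilq intre.
have i3 : mu2.-integrable [set: P] (EFin \o t3) := integrable_conv2 intrQ intlW.
have i4 : mu2.-integrable [set: P] (EFin \o t4) := integrable_conv2 intlQ intrW.
have i5 : mu2.-integrable [set: P] (EFin \o t5) := integrable_conv2 intk (intdiff n).
have i12 := integrable_lin 1 (-1) i1 i2.
have i34 := integrable_lin 1 (-1) i3 i4.
have i1234 := integrable_lin 1 1 i12 i34.
have b12 := nrm1_lin_sub i1 i2.
have b34 := nrm1_lin_sub i3 i4.
have b1234 := nrm1_lin_add ler01 i12 i34.
have ball := nrm1_lin_add (ltW rate0) i1234 i5.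
rewrite mul1r in b1234.
apply: (@le_trans _ _ (nrm1 mu2 (fun p => 1 * (1 * (1 * t1 p + -1 * t2 p) + 1 * (1 * t3 p + -1 * t4 p)) + rate * t5 p))).
  rewrite le_eqVlt; apply/orP; left; apply/eqP; apply: ae_eq_Rintegral.
  - by apply: measurableT_comp => //; exact: measurable_of_integrable (interr n.+1).
  - by apply: measurableT_comp => //; exact: measurable_of_integrable (integrable_lin _ _ i1234 i5).
  have e5 := lax_iter_mild n.
  apply: (filter_app _ _ e0); apply: (filter_app _ _ e1); apply: (filter_app _ _ e2).
  apply: (filter_app _ _ e3); apply: (filter_app _ _ e4); apply: (filter_app _ _ e5).
  apply: filterS W_mild => p Wp {}e5 {}e4 {}e3 {}e2 {}e1 {}e0; congr (`|_|).
  have fe1 : (fun r => 1 * left_part a L (Z n) r + -1 * left_part a L W r) = left_part a L (err n).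
    by apply/funext => r; rewrite /left_part /err; ring.
  have fe2 : (fun r => 1 * right_part a L (Z n) r + -1 * right_part a L W r) = right_part a L (err n).
    by apply/funext => r; rewrite /right_part /err; ring.
  have fe0 : (fun r => 1 * right_part a L W r + -1 * left_part a L W r) = (fun r => a r * W r).
    by apply/funext => r; rewrite /left_part /right_part; field.
  rewrite fe1 in e1; rewrite fe2 in e2; rewrite fe0 in e0.
  rewrite /err e5 Wp e0 /t1 /t2 /t3 /t4 /t5 e1 e2 e3 e4 /diff.
  ring.
apply: (le_trans ball).
have n1 : nrm1 mu2 t1 <= q * nrm1 mu2 (left_part a L (err n)).
  by apply: (le_trans (nrm1_conv2 irq intle)); rewrite ler_wpM2r// nrm1_ge0.
have n2 : nrm1 mu2 t2 <= q * nrm1 mu2 (right_part a L (err n)).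
  by apply: (le_trans (nrm1_conv2 ilq intre)); rewrite ler_wpM2r// nrm1_ge0.
have n3 : nrm1 mu2 t3 <= eta * nrm1 mu2 (left_part a L W).
  by apply: (le_trans (nrm1_conv2 intrQ intlW)); rewrite ler_wpM2r// nrm1_ge0.
have n4 : nrm1 mu2 t4 <= eta * nrm1 mu2 (right_part a L W).
  by apply: (le_trans (nrm1_conv2 intlQ intrW)); rewrite ler_wpM2r// nrm1_ge0.
have n5 : rate * nrm1 mu2 t5 <= rate / lam * nrm1 mu2 (diff n).
  rewrite -(mulrA rate); apply: ler_wpM2l; first exact: ltW.
  apply: (le_trans (nrm1_conv2 intk (intdiff n))).
  rewrite ler_wpM2r ?nrm1_ge0//.
  have := nrm1_damped mk k_ge0 k_neg k_mass lam0 (lexx 0).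
  by rewrite damped0 addr0.
rewrite -(nrm1_left_right ma aL (interr n)) -(nrm1_left_right ma aL intW) !mulrDr.
apply: lerD n5; apply: (le_trans b1234); apply: lerD.
- by apply: (le_trans b12); apply: lerD.
- by apply: (le_trans b34); apply: lerD.
Qed.

Hypothesis qL : q * L <= 2^-1.
Hypothesis eta0 : 0 < eta.

(** On a fixed mesh [diff n] decays geometrically, so [n], chosen after [dx], can beat the large
    factor [rate / lam]. The error then bounds itself: [err n] differs from [err n.+1] by [diff n],
    and [q * L <= 1/2] absorbs it. *)
Lemma lax_iter_close : exists n, nrm1 mu2 (err n) <= 2 * eta * (L * nrm1 mu2 W + 1).
Proof.
pose rho := rate / (lam + rate).
have lr0 : 0 < lam + rate by rewrite addr_gt0.
have rho0 : 0 <= rho by rewrite divr_ge0// ltW.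
have rho1 : `|rho| < 1 by rewrite ger0_norm// ltr_pdivrMr// mul1r ltrDr.
have cvgr : rho ^+ n @[n --> \oo] --> (0 : R) by exact: cvg_expr.
(* The summand 1 keeps [C] positive even if the first difference vanishes. *)
pose C := (2^-1 + rate / lam) * nrm1 mu2 (diff 0) + 1.
have rl0 : 0 < rate / lam by rewrite divr_gt0.
have C0 : 0 < C by rewrite ltr_wpDl// mulr_ge0// ?nrm1_ge0// addr_ge0// ltW.
have [n _ rn] := (cvgrPdist_lt _ _).1 cvgr (eta / C) (divr_gt0 eta0 C0).
have {}rn := rn n (leqnn n).
rewrite sub0r normrN ger0_norm in rn; last exact: exprn_ge0.
exists n.+1.
have d0 := nrm1_ge0 mu2 (diff 0).
have ed : (2^-1 + rate / lam) * nrm1 mu2 (diff n) <= eta.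
  apply: (@le_trans _ _ (rho ^+ n * C)).
    apply: (@le_trans _ _ ((2^-1 + rate / lam) * (rho ^+ n * nrm1 mu2 (diff 0)))).
      by rewrite ler_wpM2l ?nrm1_diff_exp// addr_ge0// ltW.
    by rewrite mulrCA ler_wpM2l ?exprn_ge0// lerDl.
  by rewrite -ler_pdivlMr// ltW.
have en : nrm1 mu2 (err n) <= nrm1 mu2 (err n.+1) + nrm1 mu2 (diff n).
  apply: nrm1_triangle => //.
  - exact: measurable_of_integrable (interr n).
  - exact: intdiff.
  - apply/aeW => p; rewrite (_ : err n p = err n.+1 p + diff n p) ?ler_normD//.
    by rewrite /err /diff; ring.
have h1 := nrm1_err n.
have h2 : q * (L * nrm1 mu2 (err n)) <= 2^-1 * (nrm1 mu2 (err n.+1) + nrm1 mu2 (diff n)).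
  rewrite mulrA; apply: (@le_trans _ _ (2^-1 * nrm1 mu2 (err n))).
    by rewrite ler_wpM2r// nrm1_ge0.
  by rewrite ler_wpM2l.
exact: (close_algebra ed h1 h2).
Qed.

End fixed_mesh.

Hypothesis quotient_cvg : forall eta, 0 < eta -> exists dx, [/\ 0 < dx,
  nrm1 mu2 (fun p => 1 * right_quotient dx p + -1 * Q p) <= eta &
  nrm1 mu2 (fun p => 1 * left_quotient dx p + -1 * Q p) <= eta].
Hypothesis smallQ : nrm1 mu2 Q * L <= 4^-1.

(** The iterates satisfy the bound exactly and approach [W] in the norm of the plane, which controls
    the part over any set [A] of times. The freedom in [A] later allows localization in time. *)
Lemma contraction (A : set T) : measurable A ->
  (\int[leb]_(t in A) \int[leb]_x `|W (t, x)|%:E <=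
   (nrm1 leb w0)%:E * \int[leb]_(t in A) (decay lam t)%:E)%E.
Proof.
move=> mA.
have W0 := nrm1_ge0 mu2 W.
have mW := measurable_of_integrable intW.
have mabs (f : P -> R) : measurable_fun [set: P] f ->
    measurable_fun [set: P] (fun p => `|f p|%:E).
  by move=> mf; apply/measurable_EFinP; exact: measurableT_comp.
have abs0 (f : P -> R) p : (0 <= `|f p|%:E)%E by rewrite lee_fin.
apply/lee_addgt0Pr => e e0.
(* The first bound keeps the norm of the quotients times [L] below [1/4 + 1/4]; the second makes the
   final error at most [e]. *)
pose eta := Num.min (4^-1 / L) (e / (2 * (L * nrm1 mu2 W + 1))).
have c0 : 0 < 2 * (L * nrm1 mu2 W + 1).
  by rewrite mulr_gt0// ltr_wpDl// mulr_ge0// ltW.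
have eta0 : 0 < eta by rewrite lt_min !divr_gt0.
have eta1 : eta <= 4^-1 / L by rewrite ge_min lexx.
have eta2 : eta <= e / (2 * (L * nrm1 mu2 W + 1)) by rewrite ge_min lexx orbT.
have [dx [dx0 h1 h2]] := quotient_cvg eta0.
have irq := integrable_right_quotient dx; have ilq := integrable_left_quotient dx.
have qb (f : P -> R) : mu2.-integrable [set: P] (EFin \o f) ->
    nrm1 mu2 (fun p => 1 * f p + -1 * Q p) <= eta -> nrm1 mu2 f <= nrm1 mu2 Q + eta.
  move=> intf fQ; rewrite addrC.
  apply: (@le_trans _ _ (nrm1 mu2 (fun p => 1 * f p + -1 * Q p) + nrm1 mu2 Q)); last by rewrite lerD2r.
  apply: nrm1_triangle => //.
  - exact: measurable_of_integrable intf.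
  - exact: integrable_lin.
  - apply/aeW => p; rewrite {1}(_ : f p = (1 * f p + -1 * Q p) + Q p) ?ler_normD//; ring.
have qL : (nrm1 mu2 Q + eta) * L <= 2^-1.
  have etaL : eta * L <= 4^-1 by rewrite -ler_pdivlMr.
  by rewrite mulrDl (_ : 2^-1 = 4^-1 + 4^-1 :> R); [exact: lerD|lra].
have [n hn] := lax_iter_close dx0 (qb _ irq h1) (qb _ ilq h2) h1 h2 qL eta0.
pose Z := lax_iter k a L dx w0 n.
have intZ : mu2.-integrable [set: P] (EFin \o Z).
  exact: (integrable_lax_iter mk k_ge0 k_neg k_mass lam0 ma aL L0 dx0 intw0).
have mZ := measurable_of_integrable intZ.
pose D (p : P) := 1 * Z p + -1 * W p.
have intD : mu2.-integrable [set: P] (EFin \o D) by exact: integrable_lin.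
have mD := measurable_of_integrable intD.
have mF (f : P -> R) (mf : measurable_fun [set: P] f) :=
  measurable_fun_fubini_tonelli_F (m2 := leb) _ (mabs f mf) (abs0 f).
have slice (f : P -> R) : measurable_fun [set: P] f -> forall t,
    measurable_fun [set: T] (fun x => `|f (t, x)|%:E).
  by move=> mf t; exact: (measurableT_comp (mabs f mf) (pair1_measurable t)).
apply: (@le_trans _ _ (\int[leb]_(t in A) (\int[leb]_x `|Z (t, x)|%:E + \int[leb]_x `|D (t, x)|%:E))%E).
  apply: ge0_le_integral => //.
  - by move=> t _; exact: integral_ge0.
  - exact: measurable_funTS (mF W mW).
  - by apply: emeasurable_funD; [exact: measurable_funTS (mF Z mZ)|exact: measurable_funTS (mF D mD)].
  move=> t _; rewrite -ge0_integralD//; [|exact: slice|exact: slice].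
  apply: ge0_le_integral => //; [exact: slice|by apply: emeasurable_funD; exact: slice|].
  move=> x _; rewrite -EFinD lee_fin (_ : W (t, x) = Z (t, x) - D (t, x)) ?ler_normB//.
  by rewrite /D; ring.
rewrite ge0_integralD//; first last.
- exact: measurable_funTS (mF D mD).
- by move=> t _; exact: integral_ge0.
- exact: measurable_funTS (mF Z mZ).
- by move=> t _; exact: integral_ge0.
apply: leeD.
  rewrite -ge0_integralZl//; first last.
  - by rewrite lee_fin nrm1_ge0.
  - by move=> t _; rewrite lee_fin decay_ge0.
  - by apply/measurable_EFinP; apply: measurable_funTS; exact: measurable_decay.
  apply: ge0_le_integral => //.
  - by move=> t _; exact: integral_ge0.
  - exact: measurable_funTS (mF Z mZ).
  - apply/measurable_EFinP; apply: measurable_funTS; apply: measurable_funM => //.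
    exact: measurable_decay.
  - move=> t _; rewrite -EFinM.
    exact: (lax_iter_slice mk k_ge0 k_neg k_mass lam0 ma aL L0 dx0 intw0).
apply: (@le_trans _ _ (\int[leb]_t \int[leb]_x `|D (t, x)|%:E)%E).
  apply: ge0_subset_integral => //; first exact: mF D mD.
  by move=> t _; exact: integral_ge0.
rewrite -[leLHS](@fubini_tonelli1 _ _ _ _ _ leb leb _ (mabs D mD) (abs0 D)).
have := EFin_nrm1 intD; rewrite /= => <-; rewrite lee_fin.
apply: (le_trans hn); apply: (@le_trans _ _ (eta * (2 * (L * nrm1 mu2 W + 1)))).
  by rewrite mulrCA mulrA.
by rewrite -ler_pdivlMr.
Qed.

End comparison.

(** * Integrability of a bounded solution *)

Section bounded_to_integrable.
Context {R : realType}.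
Local Notation leb := (@lebesgue_measure R).
Local Notation mu2 := (prod_measure leb leb).
Local Notation T := (measurableTypeR R).
Local Notation P := (T * T)%type.
Variables (a : P -> R) (L C : R) (h Q W : P -> R).
Hypothesis ma : measurable_fun [set: P] a.
Hypothesis aL : forall p, `|a p| <= L.
Hypothesis L0 : 0 < L.
Hypothesis inth : mu2.-integrable [set: P] (EFin \o h).
Hypothesis intQ : mu2.-integrable [set: P] (EFin \o Q).
Hypothesis mW : measurable_fun [set: P] W.
Hypothesis WC : forall p, `|W p| <= C.
Hypothesis W_mild : {ae mu2, forall p, W p =
  h p - gconv sub2 mu2 Q (fun r => a r * W r) p}.
Hypothesis smallQ : nrm1 mu2 Q * L <= 4^-1.

Let C0 : 0 <= C.
Proof. exact: le_trans (WC (0, 0)). Qed.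

Lemma integrable_sub2r (f : P -> R) (p : P) : mu2.-integrable [set: P] (EFin \o f) ->
  mu2.-integrable [set: P] (EFin \o (fun r => f (sub2 p r))).
Proof.
apply: (@integrable_invariant _ _ _ mu2 (sub2 p)); first exact: measurable_sub2r.
by move=> g mg g0; exact: ge0_integral_sub2r.
Qed.

Lemma nrm1_sub2r (f : P -> R) (p : P) : measurable_fun [set: P] f ->
  nrm1 mu2 (fun r => f (sub2 p r)) = nrm1 mu2 f.
Proof.
move=> mf; have inv := @Rintegral_invariant _ _ _ mu2 (sub2 p)
  (fun g mg g0 => ge0_integral_sub2r p mg g0).
by rewrite /nrm1; apply: (inv (fun r => `|f r|)); exact: measurableT_comp.
Qed.

(** Neumann series stopped after [n] steps, in absolute values: inserting the bound into the
    equation produces [|h|], plus [L] times the convolution of [|Q|] with [|hn|], plus a remainder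
    multiplied by [L ||Q||_1 <= 1/4]. The norm stays below [2 ||h||_1] because [1 + 2/4 <= 2]. *)
Let iterate_bound n : exists hn : P -> R, [/\ mu2.-integrable [set: P] (EFin \o hn),
  nrm1 mu2 hn <= 2 * nrm1 mu2 h &
  {ae mu2, forall p, `|W p| <= `|hn p| + 2^-1 ^+ n * C}].
Proof.
elim: n => [|n [hn [inthn nhn Whn]]].
  exists (fun=> 0); split.
  - exact: integrable0.
  - rewrite [leLHS](_ : _ = 0) ?mulr_ge0 ?nrm1_ge0//.
    by rewrite /nrm1; under eq_Rintegral do rewrite normr0; rewrite Rintegral_cst// mul0r.
  - by apply/aeW => p; rewrite normr0 add0r expr0 mul1r.
have mQ := measurable_of_integrable intQ.
have mhn := measurable_of_integrable inthn.
have intaQ : mu2.-integrable [set: P] (EFin \o (fun p => `|Q p|)) := integrable_norm intQ.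
have intahn : mu2.-integrable [set: P] (EFin \o (fun p => `|hn p|)) := integrable_norm inthn.
have intah : mu2.-integrable [set: P] (EFin \o (fun p => `|h p|)) := integrable_norm inth.
pose c := gconv sub2 mu2 (fun p => `|Q p|) (fun p => `|hn p|).
have intc : mu2.-integrable [set: P] (EFin \o c) := integrable_conv2 intaQ intahn.
have nrmN (f : P -> R) : nrm1 mu2 (fun p => `|f p|) = nrm1 mu2 f.
  by apply: eq_Rintegral => p _; rewrite normr_id.
have c0 p : 0 <= c p by apply: Rintegral_ge0 => r _; rewrite mulr_ge0.
exists (fun p => 1 * `|h p| + L * c p); split.
- exact: integrable_lin.
- apply: (le_trans (nrm1_lin_add (ltW L0) intah intc)).
  have nc : L * nrm1 mu2 c <= 4^-1 * (2 * nrm1 mu2 h).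
    apply: (@le_trans _ _ (L * (nrm1 mu2 Q * nrm1 mu2 hn))).
      apply: ler_wpM2l; first exact: ltW.
      by apply: (le_trans (nrm1_conv2 intaQ intahn)); rewrite !nrmN.
    rewrite mulrA (mulrC L); apply: ler_pM => //.
    - by rewrite mulr_ge0 ?nrm1_ge0// ltW.
    - exact: nrm1_ge0.
  rewrite nrmN; have := nrm1_ge0 mu2 h.
  move: (nrm1 mu2 h) (L * nrm1 mu2 c) nc => x y; lra.
apply: (filter_app _ _ W_mild).
have aeint := ae_integrable_gconv measurable_sub2 ge0_integral_sub2l intaQ intahn.
apply: filterS aeint => p intp Wp.
have aW r : `|a r * W r| <= L * C by rewrite normrM ler_pM.
have intQp := integrable_sub2r p intQ.
have maW : measurable_fun [set: P] (fun r => a r * W r) by exact: (measurable_funM ma mW).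
have intQaW : mu2.-integrable [set: P] (EFin \o (fun r => Q (sub2 p r) * (a r * W r))).
  have := integrable_mulb maW aW intQp.
  by apply: eq_integrable => // r _ /=; rewrite mulrC.
have step : `|gconv sub2 mu2 Q (fun r => a r * W r) p| <= L * c p + 4^-1 * (2^-1 ^+ n * C).
  pose g r := L * (`|Q (sub2 p r)| * `|hn r|) + (L * (2^-1 ^+ n * C)) * `|Q (sub2 p r)|.
  have intg : mu2.-integrable [set: P] (EFin \o g).
    by apply: integrable_lin => //; exact: integrable_norm intQp.
  apply: (@le_trans _ _ (\int[mu2]_r g r)).
    apply: (le_trans (le_normr_Rintegral measurableT intQaW)).
    apply: ae_le_nrm1 => //; first exact: measurable_of_integrable intQaW.
    apply: filterS Whn => r Wr; rewrite !normrM /g.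
    rewrite (_ : _ + _ = `|Q (sub2 p r)| * (L * (`|hn r| + 2^-1 ^+ n * C))); last by ring.
    by apply: ler_wpM2l => //; apply: ler_pM.
  rewrite Rintegral_lin//; last exact: integrable_norm intQp.
  apply: lerD; first exact: lexx.
  rewrite -/(nrm1 mu2 (fun r => Q (sub2 p r))) nrm1_sub2r//.
  rewrite mulrAC; apply: ler_wpM2r; last by rewrite mulrC.
  by rewrite mulr_ge0 ?exprn_ge0.
rewrite Wp (le_trans (ler_normB _ _))// (ger0_norm (_ : 0 <= 1 * `|h p| + L * c p)); last first.
  by apply: addr_ge0; apply: mulr_ge0; [| |exact: ltW|exact: c0].
rewrite mul1r -addrA lerD2l (le_trans step)// lerD2l exprS -mulrA; apply: ler_wpM2r.
  by rewrite mulr_ge0 ?exprn_ge0.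
lra.
Qed.

(** The excess of [|W|] over [2^-n C] is dominated by a function of norm at most [2 ||h||_1] and
    increases to [|W|]; monotone convergence concludes. *)
Lemma bounded_integrable : mu2.-integrable [set: P] (EFin \o W).
Proof.
apply/integrableP; split; first exact/measurable_EFinP.
apply: (@le_lt_trans _ _ (2 * nrm1 mu2 h)%:E); last exact: ltry.
pose e n : R := 2^-1 ^+ n * C.
have e0 n : 0 <= e n by rewrite mulr_ge0 ?exprn_ge0.
pose g n (p : P) : \bar R := (Num.max (`|W p| - e n) 0)%:E.
have cve : e n @[n --> \oo] --> (0 : R).
  rewrite -[X in _ --> X](mul0r C); apply: cvgM; last exact: cvg_cst.
  apply: cvg_expr.
  by rewrite ger0_norm// invf_lt1// ltr1n.
have de : nonincreasing_seq e.
  apply/nonincreasing_seqP => n; rewrite /e exprS -mulrA ler_piMl//; first exact: e0.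
  by rewrite invf_le1// ler1n.
have mg n : measurable_fun [set: P] (g n).
  apply/measurable_EFinP; apply: measurable_maxr => //.
  by apply: measurable_funB => //; exact: measurableT_comp.
have limg p : limn (g ^~ p) = `|(W p)%:E|%E.
  apply/cvg_lim => //; apply: cvg_EFin; first exact: nearW.
  apply: (squeeze_cvgr (f := fun n => `|W p| - e n) (h := fun=> `|W p|)).
  - apply: nearW => n; rewrite /= le_max lexx /= ge_max normr_ge0 andbT.
    by rewrite lerBlDr lerDl.
  - by rewrite -[X in _ --> X]subr0; apply: cvgB => //; exact: cvg_cst.
  - exact: cvg_cst.
under eq_integral do rewrite -limg.
rewrite monotone_convergence//.
- apply: lime_le; last first.
    apply: nearW => n; have [hn [inthn nhn Whn]] := iterate_bound n.
    apply: (@le_trans _ _ (nrm1 mu2 hn)%:E); last by rewrite lee_fin.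
    rewrite EFin_nrm1//; apply: ae_ge0_le_integral => //.
    - by move=> p _; rewrite /g lee_fin le_max lexx orbT.
    - by apply: measurableT_comp => //; exact: measurable_int inthn.
    - apply: filterS Whn => p Wp _; rewrite /g lee_fin ge_max normr_ge0 andbT.
      by rewrite lerBlDr.
  apply: ereal_nondecreasing_is_cvgn => m n mn; apply: ge0_le_integral => //.
  - by move=> p _; rewrite /g lee_fin le_max lexx orbT.
  - by move=> p _; rewrite /g lee_fin ge_max !le_max lexx orbT andbT lerD2l lerN2 de.
- by move=> n p _; rewrite /g lee_fin le_max lexx orbT.
- by move=> p _ m n mn; rewrite /g lee_fin ge_max !le_max lexx orbT andbT lerD2l lerN2 de.
Qed.

End bounded_to_integrable.

(** * Powers and exponentials *)

Section derivative_rules.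
Context {R : realType}.
Implicit Types (f g : R -> R) (x c df dg : R).

Lemma der_eq f x df dg : is_derive x 1 f df -> df = dg -> is_derive x 1 f dg.
Proof. by move=> ? <-. Qed.

Lemma der_cst c x : is_derive x 1 (fun=> c) 0.
Proof. exact: is_derive_cst. Qed.

Lemma der_id x : is_derive x 1 (fun y : R => y) 1.
Proof. exact: is_derive_id. Qed.

Lemma der_add f g x df dg : is_derive x 1 f df -> is_derive x 1 g dg ->
  is_derive x 1 (fun y => f y + g y) (df + dg).
Proof. exact: is_deriveD. Qed.

Lemma der_sub f g x df dg : is_derive x 1 f df -> is_derive x 1 g dg ->
  is_derive x 1 (fun y => f y - g y) (df - dg).
Proof. exact: is_deriveB. Qed.

Lemma der_opp f x df : is_derive x 1 f df -> is_derive x 1 (fun y => - f y) (- df).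
Proof. exact: is_deriveN. Qed.

Lemma der_mul f g x df dg : is_derive x 1 f df -> is_derive x 1 g dg ->
  is_derive x 1 (fun y => f y * g y) (df * g x + f x * dg).
Proof. by move=> hf hg; have := is_deriveM hf hg; rewrite /GRing.scale /= addrC (mulrC (g x)). Qed.

Lemma der_scale c f x df : is_derive x 1 f df -> is_derive x 1 (fun y => c * f y) (c * df).
Proof. by move=> hf; have := is_deriveZ c hf. Qed.

Lemma der_comp f g x df dg : is_derive (g x) 1 f df -> is_derive x 1 g dg ->
  is_derive x 1 (fun y => f (g y)) (df * dg).
Proof. exact: is_derive1_comp. Qed.

Lemma der_exp f x df : is_derive x 1 f df ->
  is_derive x 1 (fun y => expR (f y)) (expR (f x) * df).
Proof. by apply: der_comp; exact: is_derive_expR. Qed.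

Lemma der_sin f x df : is_derive x 1 f df ->
  is_derive x 1 (fun y => sin (f y)) (cos (f x) * df).
Proof. by apply: der_comp; exact: is_derive_sin. Qed.

Lemma der_cos f x df : is_derive x 1 f df ->
  is_derive x 1 (fun y => cos (f y)) (- sin (f x) * df).
Proof. by apply: der_comp; exact: is_derive_cos. Qed.

Lemma der_pow f x df p : 0 < f x -> is_derive x 1 f df ->
  is_derive x 1 (fun y => f y `^ p) (p * f x `^ (p - 1) * df).
Proof. by move=> fx0; exact: der_comp (is_derive1_powR p fx0). Qed.

Lemma der_continuous f x df : is_derive x 1 f df -> {for x, continuous f}.
Proof. by case=> d _; apply: differentiable_continuous; exact/derivable1_diffP. Qed.

End derivative_rules.

Section power_functions.
Context {R : realType}.

Lemma continuous_normpow (p : R) : 0 < p -> continuous (fun x : R => `|x| `^ p).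
Proof.
move=> p0 x; have [->|x0] := eqVneq x 0.
  rewrite /continuous_at normr0 powR0 ?gt_eqF//; apply/cvgrPdist_lt => e e0.
  have e1 : (e `^ p^-1) `^ p = e by rewrite -powRrM mulVf ?gt_eqF// powRr1// ltW.
  exists (e `^ p^-1); first by rewrite /= powR_gt0.
  move=> y /=; rewrite sub0r normrN => ye.
  rewrite sub0r normrN (ger0_norm (powR_ge0 _ _)) -e1.
  by apply: gt0_ltr_powR; rewrite ?nnegrE ?powR_ge0.
have dx : {for `|x|, continuous (@powR R ^~ p)}.
  by apply: der_continuous; apply: is_derive1_powR; rewrite normr_gt0.
exact: (continuous_comp (@norm_continuous _ R x) dx).
Qed.

End power_functions.

(** * Fourier transform of the two-sided exponential *)

Section exponential_transform.
Context {R : realType}.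
Local Notation leb := (@lebesgue_measure R).
Local Notation T := (measurableTypeR R).

Definition expabs (d x : R) := expR (- d * `|x|).

Lemma continuous_expabs d : continuous (expabs d).
Proof.
move=> x; apply: (continuous_comp (f := fun x : R => - d * `|x|)); last exact: continuous_expR.
by apply: cvgM; [exact: cvg_cst|exact: norm_continuous].
Qed.

Lemma expabs_ge0 d x : 0 <= expabs d x.
Proof. exact: expR_ge0. Qed.

(** Primitive of [exp(- d x) (1 + cos(y x))]. The summand 1 makes the integrand nonnegative, as the
    fundamental theorem on a half-line asks; it is subtracted again in [Rintegral_expabs_cos]. *)
Definition transform_primitive (d y x : R) :=
  expR (- d * x) * ((y * sin (y * x) - d * cos (y * x)) / (d ^+ 2 + y ^+ 2) - d^-1).

Lemma is_derive_transform (d y x : R) : 0 < d ->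
  is_derive x 1 (transform_primitive d y) (expR (- d * x) * (1 + cos (y * x))).
Proof.
move=> d0; have dy0 : d ^+ 2 + y ^+ 2 != 0.
  by rewrite gt_eqF// ltr_wpDr ?sqr_ge0// exprn_gt0.
have dl := der_scale y (der_id x).
apply: (der_eq (der_mul (der_exp (der_scale (- d) (der_id x))) (der_sub
  (der_mul (der_sub (der_scale y (der_sin dl)) (der_scale d (der_cos dl)))
  (der_cst ((d ^+ 2 + y ^+ 2)^-1) x)) (der_cst d^-1 x)))).
by field; rewrite dy0 gt_eqF.
Qed.

Lemma cvg_transform_primitive (d y : R) : 0 < d ->
  transform_primitive d y x @[x --> +oo] --> 0.
Proof.
move=> d0; have dy0 : 0 < d ^+ 2 + y ^+ 2.
  by rewrite ltr_wpDr ?sqr_ge0// exprn_gt0.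
pose C := (`|y| + d) / (d ^+ 2 + y ^+ 2) + d^-1.
have bound x : `|transform_primitive d y x| <= C * expR (- d * x).
  rewrite /transform_primitive normrM mulrC (ger0_norm (expR_ge0 _)).
  rewrite ler_wpM2r ?expR_ge0// (le_trans (ler_normB _ _))// lerD//; last first.
    by rewrite ger0_norm// invr_ge0 ltW.
  have dyi : 0 <= (d ^+ 2 + y ^+ 2)^-1 by rewrite invr_ge0 ltW.
  rewrite normrM [X in _ * X](ger0_norm dyi).
  apply: ler_wpM2r => //; rewrite (le_trans (ler_normB _ _))// !normrM lerD//.
  - by rewrite ler_piMr// sin_max.
  - by rewrite gtr0_norm// ler_piMr ?cos_max// ltW.
have cy : (fun x : R => d * x) @ +oo --> +oo.
  apply/cvgryPge => A; near=> x.
  rewrite -ler_pdivrMl//; near: x; exact: nbhs_pinfty_ge.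
have ce : (C * expR (- d * x)) @[x --> +oo] --> 0.
  rewrite -[X in _ --> X](mulr0 C); apply: cvgM; first exact: cvg_cst.
  rewrite (_ : (fun x : R => expR (- d * x)) = (fun x : R => expR (- x)) \o (fun x => d * x)).
    exact: cvg_comp cy (@cvgr_expR R).
  by apply/funext => x /=; rewrite mulNr.
apply: norm_cvg0.
apply: (squeeze_cvgr (f := fun=> 0) (h := fun x => C * expR (- d * x))) => //.
- by apply: nearW => x; rewrite normr_ge0 bound.
- exact: cvg_cst.
Unshelve. all: end_near. Qed.

Lemma ge0_integral_even (f : R -> R) : (forall x, 0 <= f x) -> continuous f ->
  (forall x, f (- x) = f x) ->
  (\int[leb]_x (f x)%:E = 2%:E * \int[leb]_(x in `[0%R, +oo[) (f x)%:E)%E.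
Proof.
move=> f0 cf ef; rewrite ge0_symfun_integralT//; last by move=> x; rewrite /= ef.
by congr (_ * _)%E; congr (integral _ _ _); rewrite set_itvcy.
Qed.

Lemma integral_expabs1D (d y : R) : 0 < d ->
  (\int[leb]_x (expabs d x * (1 + cos (y * x)))%:E =
   (2 * (d / (d ^+ 2 + y ^+ 2) + d^-1))%:E)%E.
Proof.
move=> d0; have dy0 : d ^+ 2 + y ^+ 2 != 0.
  by rewrite gt_eqF// ltr_wpDr ?sqr_ge0// exprn_gt0.
have ccos : continuous (fun x : R => 1 + cos (y * x)).
  move=> x; apply: cvgD; first exact: cvg_cst.
  exact: der_continuous (der_cos (der_scale y (der_id x))).
rewrite ge0_integral_even.
- rewrite EFinM; congr (_ * _)%E.
  transitivity (\int[leb]_(x in `[0%R, +oo[) (expR (- d * x) * (1 + cos (y * x)))%:E)%E.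
    apply: eq_integral => x; rewrite inE/= in_itv/= andbT => x0.
    by rewrite /expabs ger0_norm.
  have dF x := is_derive_transform y x d0.
  rewrite (@ge0_continuous_FTC2y _ _ (transform_primitive d y) 0 0).
  + rewrite /transform_primitive !mulr0 expR0 sin0 cos0 -EFinB; congr EFin.
    by field; rewrite dy0 gt_eqF.
  + move=> x _; rewrite mulr_ge0 ?expR_ge0// -lerBlDl sub0r; exact: cos_geN1.
  + apply: continuous_subspaceT => x; apply: cvgM; last exact: ccos.
    exact: der_continuous (der_exp (der_scale (- d) (der_id x))).
  + exact: cvg_transform_primitive.
  + by move=> x _; case: (dF x).
  + by apply: cvg_at_right_filter; exact: der_continuous (dF 0).
  + by move=> x _; rewrite derive1E; case: (dF x).
- move=> x; rewrite mulr_ge0 ?expR_ge0// -lerBlDl sub0r; exact: cos_geN1.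
- by move=> x; apply: cvgM; [exact: continuous_expabs|exact: ccos].
- by move=> x; rewrite /expabs normrN mulrN cosN.
Qed.

Lemma integral_expabs (d : R) : 0 < d ->
  (\int[leb]_x (expabs d x)%:E = (2 / d)%:E)%E.
Proof.
move=> d0; rewrite ge0_integral_even.
- rewrite EFinM; congr (_ * _)%E; rewrite -integral0y_expRN//.
  apply: eq_integral => x; rewrite inE/= in_itv/= andbT => x0.
  by rewrite /expabs ger0_norm.
- by move=> x; exact: expabs_ge0.
- exact: continuous_expabs.
- by move=> x; rewrite /expabs normrN.
Qed.

Lemma integrable_expabs (d : R) : 0 < d -> leb.-integrable [set: T] (EFin \o expabs d).
Proof.
move=> d0; apply/integrableP; split.
  by apply/measurable_EFinP; apply: continuous_measurable_fun; exact: continuous_expabs.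
under eq_integral do rewrite /= ger0_norm ?expabs_ge0//.
by rewrite integral_expabs// ltry.
Qed.

Lemma Rintegral_expabs_cos (d y : R) : 0 < d ->
  \int[leb]_x (expabs d x * cos (y * x)) = 2 * d / (d ^+ 2 + y ^+ 2).
Proof.
move=> d0; have dy0 : d ^+ 2 + y ^+ 2 != 0.
  by rewrite gt_eqF// ltr_wpDr ?sqr_ge0// exprn_gt0.
have mcos : measurable_fun [set: T] (fun x : R => cos (y * x)).
  apply: continuous_measurable_fun => x.
  exact: der_continuous (der_cos (der_scale y (der_id x))).
have inte := integrable_expabs d0.
have intc : leb.-integrable [set: T] (EFin \o (fun x => expabs d x * cos (y * x))).
  apply: (le_integrable measurableT _ _ inte).
  - apply/measurable_EFinP; apply: measurable_funM => //.
    exact: measurable_of_integrable inte.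
  - by move=> x _; rewrite lee_fin normrM ler_piMr ?cos_max.
have h1 : \int[leb]_x (1 * expabs d x + 1 * (expabs d x * cos (y * x))) =
    2 * (d / (d ^+ 2 + y ^+ 2) + d^-1).
  rewrite /Rintegral -[RHS]/(fine (2 * (d / (d ^+ 2 + y ^+ 2) + d^-1))%:E) -integral_expabs1D//.
  by congr fine; apply: eq_integral => x _; congr EFin; ring.
have h2 : \int[leb]_x expabs d x = 2 / d by rewrite /Rintegral integral_expabs.
rewrite Rintegral_lin// h2 in h1.
apply: (addrI (1 * (2 / d))); rewrite -[X in _ + X]mul1r h1.
by field; rewrite dy0 gt_eqF.
Qed.

End exponential_transform.

Section rintegral_invariance.
Context {R : realType}.
Local Notation leb := (@lebesgue_measure R).
Local Notation T := (measurableTypeR R).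

Lemma Rintegral_shift (c : R) (f : T -> R) : measurable_fun [set: T] f ->
  \int[leb]_x f (x + c) = \int[leb]_x f x.
Proof.
apply: (Rintegral_invariant (phi := fun x : T => x + c)).
by move=> g mg g0; exact: ge0_integral_shift.
Qed.

Lemma Rintegral_opp (f : T -> R) : measurable_fun [set: T] f ->
  \int[leb]_x f (- x) = \int[leb]_x f x.
Proof.
apply: (Rintegral_invariant (phi := fun x : T => - x)).
by move=> g mg g0; exact: ge0_integral_opp.
Qed.

Lemma gt0_muleB (c : R) (x y : \bar R) : 0 < c ->
  (c%:E * (x - y) = c%:E * x - c%:E * y)%E.
Proof.
move=> c0; case: x => [x| |]; case: y => [y| |]; rewrite ?gt0_muley ?gt0_muleNy ?lte_fin//=.
by rewrite -[LHS]/((c * (x - y))%:E) mulrBr.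
Qed.

Lemma fine_gt0_mule (c : R) (x : \bar R) : 0 < c -> fine (c%:E * x) = c * fine x.
Proof.
by move=> c0; case: x => [x| |]//; rewrite ?gt0_muley ?gt0_muleNy ?lte_fin//= mulr0.
Qed.

Lemma Rintegral_scale (c : R) (f : T -> R) : 0 < c -> measurable_fun [set: T] f ->
  c * \int[leb]_x f (c * x) = \int[leb]_x f x.
Proof.
move=> c0 /measurable_EFinP mf; rewrite /Rintegral -fine_gt0_mule//.
rewrite integralE [in RHS]integralE.
rewrite -(ge0_integral_scale c0 (measurable_funepos mf))//.
rewrite -(ge0_integral_scale c0 (measurable_funeneg mf))//.
rewrite gt0_muleB//.
by congr (fine (_ * _ - _ * _))%E; apply: eq_integral => x _; rewrite ?funeposE ?funenegE.
Qed.

Lemma integrable_tensor (f g : T -> R) (c : T * T -> R) (C : R) :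
  leb.-integrable [set: T] (EFin \o f) -> leb.-integrable [set: T] (EFin \o g) ->
  measurable_fun [set: T * T] c -> (forall z, `|c z| <= C) ->
  (leb \x leb)%E.-integrable [set: T * T] (fun z => (c z * (f z.1 * g z.2))%:E).
Proof.
move=> intf intg mc cC.
have := @young_integrable _ _ T T R leb leb fst measurable_fst _ f g intf intg.
move=> /(_ (fun y h mh h0 => erefl)) inth.
exact: (integrable_mulb mc cC inth).
Qed.

End rintegral_invariance.

(** * Even and odd powers of real numbers *)

Section signed_powers.
Context {R : realType}.
Implicit Types (b x : R).

Definition npow b x := `|x| `^ b.
Definition spow b x := Num.sg x * `|x| `^ b.

Lemma npow_ge0 b x : 0 <= npow b x.
Proof. exact: powR_ge0. Qed.

Lemma npow0 b : 0 < b -> npow b 0 = 0.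
Proof. by move=> b0; rewrite /npow normr0 powR0// gt_eqF. Qed.

Lemma npowN b x : npow b (- x) = npow b x.
Proof. by rewrite /npow normrN. Qed.

Lemma spowN b x : spow b (- x) = - spow b x.
Proof. by rewrite /spow normrN sgrN mulNr. Qed.

Lemma norm_spow b x : 0 < b -> `|spow b x| = npow b x.
Proof.
move=> b0; rewrite /spow normrM normr_sg (ger0_norm (powR_ge0 _ _)).
by rewrite /npow; have [->|_] := eqVneq x 0; rewrite ?mul1r// mul0r normr0 powR0// gt_eqF.
Qed.

Lemma continuous_npow b : 0 < b -> continuous (npow b).
Proof. exact: continuous_normpow. Qed.

(** Trades the sign, discontinuous at 0, for maxima; continuity of [spow] then follows by
    composition. *)
Lemma spow_max b x : 0 < b -> spow b x = npow b (Num.max x 0) - npow b (Num.max (- x) 0).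
Proof.
move=> b0; rewrite /spow; case: (ltrgt0P x) => x0.
- by rewrite max_r ?oppr_le0 ?ltW// npow0// gtr0_sg// mul1r subr0 /npow gtr0_norm.
- by rewrite max_l ?oppr_ge0 ?ltW// npow0// ltr0_sg// mulN1r sub0r npowN /npow ltr0_norm.
- by rewrite x0 oppr0 maxxx npow0// sgr0 mul0r subr0.
Qed.

Lemma continuous_spow b : 0 < b -> continuous (spow b).
Proof.
move=> b0 x; rewrite /continuous_at spow_max//.
rewrite (_ : spow b = fun y => npow b (Num.max y 0) - npow b (Num.max (- y) 0)); last first.
  by apply/funext => y; exact: spow_max.
apply: cvgB.
  apply: (continuous_comp (f := fun y : R => Num.max y 0) (g := npow b)); last exact: continuous_npow.
  by apply: (@continuous_max _ _ (fun y : R => y) (fun=> 0)); [exact: cvg_id|exact: cvg_cst].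
apply: (continuous_comp (f := fun y : R => Num.max (- y) 0) (g := npow b)); last exact: continuous_npow.
by apply: (@continuous_max _ _ (fun y : R => - y) (fun=> 0)); [apply: cvgN; exact: cvg_id|exact: cvg_cst].
Qed.

Lemma mul_spow b x : 0 < b -> x * spow (b - 1) x = npow b x.
Proof.
move=> b0; rewrite /spow mulrA (mulrC x) -normrEsg /npow.
have [->|x0] := eqVneq x 0; first by rewrite normr0 mul0r powR0// gt_eqF.
by rewrite -{1}(powRr1 (normr_ge0 x)) -powRD ?normr_eq0 ?x0 ?implybT// addrCA subrr addr0.
Qed.

Lemma mul_npow b x : 0 < b -> x * npow (b - 1) x = spow b x.
Proof.
move=> b0; have [->|x0] := eqVneq x 0; first by rewrite /spow sgr0 !mul0r.
by rewrite {1}(numEsg x) -mulrA /npow -{1}(powRr1 (normr_ge0 x)) -powRD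
  ?normr_eq0 ?x0 ?implybT// addrCA subrr addr0.
Qed.

(** Away from 0 this is the power rule together with parity. At 0 the difference quotient is
    [spow (b - 1)] itself, which tends to 0 since [b > 1]. *)
Lemma der_npow b x : 1 < b -> is_derive x 1 (npow b) (b * spow (b - 1) x).
Proof.
move=> b1; have b0 : 0 < b by exact: lt_trans b1.
have pos (y : R) : 0 < y -> is_derive y 1 (npow b) (b * spow (b - 1) y).
  move=> y0; have h := is_derive1_powR b y0.
  rewrite /spow gtr0_sg// mul1r gtr0_norm//.
  apply: (near_eq_is_derive (f := (@powR R)^~ b)) h; near=> z; rewrite /npow gtr0_norm//.
  by near: z; exact: lt_nbhsr.
case: (ltrgt0P x) => [/pos//|x0|->].
- have x0' : 0 < - x by rewrite oppr_gt0.
  have h0 := der_opp (der_id x).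
  have h := der_comp (pos _ x0') h0.
  have -> : npow b = fun y => npow b (- y) by apply/funext => y; rewrite npowN.
  by apply: (der_eq h); rewrite spowN; ring.
- have hc : (fun h : R => h^-1 *: (npow b (h *: 1 + 0) - npow b 0)) @ 0^' --> 0.
    rewrite (_ : (fun h : R => h^-1 *: (npow b (h *: 1 + 0) - npow b 0)) = spow (b - 1)).
      have := @continuous_spow (b - 1) _ 0; rewrite /continuous_at {2}/spow sgr0 mul0r.
      move=> /(_ _)/cvg_within_filter; apply; lra.
    apply/funext => h; rewrite npow0// subr0 /GRing.scale /= mulr1 addr0 -mul_spow//.
    have [->|h0] := eqVneq h 0; last by rewrite mulrA mulVf// mul1r.
    by rewrite /spow sgr0 !mul0r mulr0.
  split; first by apply/cvg_ex; exists 0; exact: hc.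
  by rewrite /derive /spow sgr0 mul0r mulr0; apply: cvg_lim hc.
Unshelve. all: end_near. Qed.

Lemma der_spow b x : 1 < b -> is_derive x 1 (spow b) (b * npow (b - 1) x).
Proof.
move=> b1; have b0 : 0 < b by exact: lt_trans b1.
have pos (y : R) : 0 < y -> is_derive y 1 (spow b) (b * npow (b - 1) y).
  move=> y0; have h := is_derive1_powR b y0.
  apply: der_eq; last first.
    by rewrite /npow gtr0_norm.
  apply: near_eq_is_derive h; near=> z; have z0 : 0 < z by near: z; exact: lt_nbhsr.
  by rewrite /spow gtr0_norm// gtr0_sg// mul1r.
case: (ltrgt0P x) => [/pos//|x0|->].
- have x0' : 0 < - x by rewrite oppr_gt0.
  have h0 := der_opp (der_id x).
  have h1 := der_comp (pos _ x0') h0; have h := der_opp h1.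
  have -> : spow b = fun y => - spow b (- y) by apply/funext => y; rewrite spowN opprK.
  by apply: (der_eq h); rewrite npowN; ring.
- have hc : (fun h : R => h^-1 *: (spow b (h *: 1 + 0) - spow b 0)) @ 0^' --> 0.
    rewrite (_ : (fun h : R => h^-1 *: (spow b (h *: 1 + 0) - spow b 0)) = npow (b - 1)).
      have := @continuous_npow (b - 1) _ 0; rewrite /continuous_at npow0; last lra.
      move=> /(_ _)/cvg_within_filter; apply; lra.
    apply/funext => h; rewrite {2}/spow sgr0 mul0r subr0 /GRing.scale /= mulr1 addr0 -mul_npow//.
    have [->|h0] := eqVneq h 0; last by rewrite mulrA mulVf// mul1r.
    by rewrite npow0 ?mulr0//; lra.
  split; first by apply/cvg_ex; exists 0; exact: hc.
  by rewrite /derive npow0 ?mulr0; [apply: cvg_lim hc|lra].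
Unshelve. all: end_near. Qed.

(** Lets the stable multiplier be dominated by a two-sided exponential. *)
Lemma npow_ge_norm b x : 1 < b -> `|x| - 1 <= npow b x.
Proof.
move=> b1; have [x1|x1] := leP `|x| 1.
  by rewrite (le_trans _ (npow_ge0 _ _))// subr_le0.
have h : `|x| `^ 1 <= npow b x by apply: ler_powR; [exact: ltW|exact: ltW].
rewrite powRr1// in h; lra.
Qed.

End signed_powers.

Section lorentz.
Context {R : realType}.
Local Notation leb := (@lebesgue_measure R).
Local Notation T := (measurableTypeR R).

(** Fourier transform of [exp(- |x|)]. Its dilations are the approximate identity that appears when
    an integral is damped by [expabs d]. *)
Definition lorentz (z : R) := 2 / (1 + z ^+ 2).

Lemma lorentz_ge0 z : 0 <= lorentz z.
Proof. by rewrite divr_ge0// addr_ge0// sqr_ge0. Qed.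

Lemma continuous_lorentz : continuous lorentz.
Proof. by move=> z; apply: cvgM; [exact: cvg_cst|exact: continuous_oneDsqrV]. Qed.

Lemma integral_lorentz : (\int[leb]_z (lorentz z)%:E = (2 * pi)%:E)%E.
Proof.
rewrite (ge0_integral_even lorentz_ge0 continuous_lorentz); last by move=> x; rewrite /lorentz sqrrN.
under eq_integral do rewrite /lorentz EFinM.
rewrite ge0_integralZl//; last 2 first.
- apply: measurable_funTS; apply/measurable_EFinP; apply: continuous_measurable_fun.
  exact: continuous_oneDsqrV.
- by move=> x _; rewrite lee_fin invr_ge0 addr_ge0// sqr_ge0.
by rewrite integral0y_oneDsqr -!EFinM; congr EFin; field.
Qed.

Lemma measurable_lorentz : measurable_fun [set: T] (lorentz : T -> R).
Proof. by apply: continuous_measurable_fun; exact: continuous_lorentz. Qed.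

Lemma integrable_lorentz : leb.-integrable [set: T] (EFin \o lorentz).
Proof.
apply/integrableP; split; first by apply/measurable_EFinP; exact: measurable_lorentz.
under eq_integral do rewrite /= ger0_norm ?lorentz_ge0//.
by rewrite integral_lorentz ltry.
Qed.

End lorentz.

(** * The stable kernel *)

Section stable_kernel.
Context {R : realType} (beta A B : R).
Local Notation leb := (@lebesgue_measure R).
Local Notation T := (measurableTypeR R).

(** Real part of [exp(s (i xi)^beta + i c)] when [- A + i B = exp(i beta pi / 2)]. The free phase
    [c] accounts for translations, as [c = x xi], and for sines, by a shift of [pi / 2]. *)
Definition osc (s c xi : R) :=
  expR (- (A * s) * npow beta xi) * cos (B * s * spow beta xi + c).

Definition stable (s x : R) := (2 * pi)^-1 * \int[leb]_xi osc s (x * xi) xi.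

Hypotheses (b1 : 1 < beta) (A0 : 0 < A).

Let b0 : 0 < beta. Proof. exact: lt_trans b1. Qed.

Lemma measurable_npow : measurable_fun [set: T] (npow beta : T -> R).
Proof. by apply: continuous_measurable_fun; exact: continuous_npow. Qed.

Lemma measurable_spow : measurable_fun [set: T] (spow beta : T -> R).
Proof. by apply: continuous_measurable_fun; exact: continuous_spow. Qed.

Lemma measurable_cosR : measurable_fun [set: T] (@cos R : T -> R).
Proof. by apply: continuous_measurable_fun; exact: continuous_cos. Qed.

Lemma measurable_osc d (X : measurableType d) (s c xi : X -> R) :
  measurable_fun [set: X] s -> measurable_fun [set: X] c -> measurable_fun [set: X] xi ->
  measurable_fun [set: X] (fun z => osc (s z) (c z) (xi z)).
Proof.
move=> ms mc mxi; apply: measurable_funM.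
  apply: (measurableT_comp (@measurable_expR R)); apply: measurable_funM.
    by apply: measurable_funN; apply: measurable_funM => //; exact: measurable_cst.
  exact: (measurableT_comp measurable_npow).
apply: (measurableT_comp measurable_cosR); apply: measurable_funD => //.
apply: measurable_funM; first by apply: measurable_funM => //; exact: measurable_cst.
exact: (measurableT_comp measurable_spow).
Qed.

Lemma measurable_stable d (X : measurableType d) (s x : X -> R) :
  measurable_fun [set: X] s -> measurable_fun [set: X] x ->
  measurable_fun [set: X] (fun z => stable (s z) (x z)).
Proof.
move=> ms mx; apply: measurable_funM; first exact: measurable_cst.
have mF : measurable_fun [set: X * T] (fun z => osc (s z.1) (x z.1 * z.2) z.2).
  apply: measurable_osc.
  - exact: (measurableT_comp ms measurable_fst).
  - by apply: measurable_funM => //; exact: (measurableT_comp mx measurable_fst).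
  - exact: measurable_snd.
exact: (@measurable_Rintegral_param _ _ X T R leb _ mF).
Qed.

Lemma multiplier_le (s xi : R) : 0 < s ->
  expR (- (A * s) * npow beta xi) <= expR (A * s) * expabs (A * s) xi.
Proof.
move=> s0; rewrite /expabs -expRD ler_expR -subr_ge0.
rewrite (_ : _ - _ = A * s * (npow beta xi - (`|xi| - 1))); last by ring.
by apply: mulr_ge0; [rewrite ltW// mulr_gt0|rewrite subr_ge0; exact: npow_ge_norm].
Qed.

Lemma norm_osc_le (s c xi : R) : 0 < s ->
  `|osc s c xi| <= expR (A * s) * expabs (A * s) xi.
Proof.
move=> s0; rewrite normrM ger0_norm ?expR_ge0//; apply: le_trans (multiplier_le _ s0).
by rewrite ler_piMr ?expR_ge0// cos_max.
Qed.

Lemma norm_osc_le1 (s c xi : R) : 0 < s -> `|osc s c xi| <= 1.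
Proof.
move=> s0; rewrite normrM ger0_norm ?expR_ge0// -[leRHS]mulr1.
apply: ler_pM; rewrite ?expR_ge0// ?cos_max//.
by rewrite -expR0 ler_expR mulNr oppr_le0 mulr_ge0 ?npow_ge0// ltW// mulr_gt0.
Qed.

Lemma integrable_osc (s : R) (c : T -> R) : 0 < s -> measurable_fun [set: T] c ->
  leb.-integrable [set: T] (fun xi => (osc s (c xi) xi)%:E).
Proof.
move=> s0 mc; have As : 0 < A * s by exact: mulr_gt0.
have := integrable_scale (expR (A * s)) (integrable_expabs As); apply: le_integrable => //.
- by apply/measurable_EFinP; apply: measurable_osc => //; exact: measurable_cst.
- move=> xi _; rewrite lee_fin (le_trans (norm_osc_le _ _ s0))//.
  exact: ler_norm.
Qed.

Lemma osc_opp (s c xi : R) : osc s c (- xi) = osc s (- c) xi.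
Proof.
rewrite /osc npowN spowN; congr (_ * _).
by rewrite -cosN; congr cos; ring.
Qed.

(** The sine part is odd against an even weight and drops out. *)
Lemma Rintegral_expabs_phase (d k w : R) : 0 < d ->
  \int[leb]_y (expabs d y * cos (k + y * w)) = cos k * (2 * d / (d ^+ 2 + w ^+ 2)).
Proof.
move=> d0; have mw : measurable_fun [set: T] (fun y : R => w * y).
  by apply: measurable_funM => //; exact: measurable_cst.
have msin : measurable_fun [set: T] (@sin R : T -> R).
  by apply: continuous_measurable_fun; exact: continuous_sin.
have mc := measurableT_comp measurable_cosR mw.
have ms := measurableT_comp msin mw.
have intc := integrable_mulb mc (fun x => cos_max (w * x)) (integrable_expabs d0).
have ints := integrable_mulb ms (fun x => sin_max (w * x)) (integrable_expabs d0).
transitivity (\int[leb]_y (cos k * (cos (w * y) * expabs d y) + - sin k * (sin (w * y) * expabs d y))).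
  by apply: eq_Rintegral => y _; rewrite cosD (mulrC y w); ring.
rewrite (Rintegral_lin (cos k) (- sin k) intc ints).
rewrite (@Rintegral_odd R (fun y => sin (w * y) * expabs d y)); last 2 first.
- exact: measurable_of_integrable ints.
- by move=> y; rewrite mulrN sinN /expabs normrN mulNr.
rewrite mulr0 addr0; congr (_ * _); rewrite -Rintegral_expabs_cos//.
by apply: eq_Rintegral => y _; rewrite mulrC.
Qed.

Lemma integrable_osc_lorentz (s c d xi : R) : 0 < s -> 0 < d ->
  leb.-integrable [set: T] (fun eta => ((2 * d / (d ^+ 2 + (eta + xi) ^+ 2)) * osc s c eta)%:E).
Proof.
move=> s0 d0; have d20 : 0 < d ^+ 2 by rewrite exprn_gt0.
apply: (@integrable_mulb _ _ _ _ _ _ (2 * d / d ^+ 2)); last first.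
- by apply: (integrable_osc s0); exact: measurable_cst.
- move=> eta; rewrite ger0_norm; last first.
    by rewrite divr_ge0 ?mulr_ge0 ?addr_ge0 ?sqr_ge0// ltW.
  rewrite ler_pM2l ?mulr_gt0// lef_pV2 ?posrE// ?ltr_wpDr ?sqr_ge0//.
  by rewrite lerDl sqr_ge0.
- apply: continuous_measurable_fun => eta; apply: cvgM; first exact: cvg_cst.
  apply: cvgV; first by rewrite gt_eqF// ltr_wpDr ?sqr_ge0.
  apply: (der_continuous (f := fun eta => d ^+ 2 + (eta + xi) ^+ 2)).
Qed.

(* Both sides reduce, by [Rintegral_expabs_phase], to the same integral over the frequency [eta]; the
   substitution [eta = xi + d z] makes [2 d / (d^2 + (eta - xi)^2)] independent of [d]. *)
Lemma regularized_transform (s d xi c : R) : 0 < s -> 0 < d ->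
  \int[leb]_y (expabs d y * (stable s y * cos (y * xi + c))) =
  (2 * pi)^-1 * \int[leb]_z (osc s (- c) (xi + d * z) * lorentz z).
Proof.
move=> s0 d0; pose m xi := expR (- (A * s) * npow beta xi).
pose F (z : T * T) := cos (B * s * spow beta z.2 + z.1 * z.2) * cos (z.1 * xi + c)
  * (expabs d z.1 * m z.2).
have mm : measurable_fun [set: T] (m : T -> R).
  apply: (measurableT_comp (@measurable_expR R)); apply: measurable_funM; first exact: measurable_cst.
  exact: measurable_npow.
have intm : leb.-integrable [set: T] (EFin \o m).
  have As : 0 < A * s by exact: mulr_gt0.
  have := integrable_scale (expR (A * s)) (integrable_expabs As); apply: le_integrable => //.
    exact/measurable_EFinP.
  move=> x _; rewrite lee_fin ger0_norm ?expR_ge0// (le_trans (multiplier_le _ s0))//.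
  exact: ler_norm.
have intF : (leb \x leb)%E.-integrable [set: T * T] (EFin \o F).
  apply: (@integrable_tensor _ _ _ _ 1) => //; first exact: integrable_expabs.
    have m1 := @measurable_fst _ _ T T; have m2 := @measurable_snd _ _ T T.
    apply: measurable_funM; apply: (measurableT_comp measurable_cosR).
    - apply: measurable_funD; last exact: measurable_funM.
      by apply: measurable_funM; [exact: measurable_cst|exact: (measurableT_comp measurable_spow)].
    - by apply: measurable_funD; [apply: measurable_funM => //; exact: measurable_cst|exact: measurable_cst].
  by move=> z; rewrite normrM -[leRHS]mulr1; apply: ler_pM; rewrite ?cos_max.
transitivity ((2 * pi)^-1 * \int[leb]_y \int[leb]_eta F (y, eta)).
  rewrite -RintegralZl//; last exact: integrable_Rfubini1 intF.
  apply: eq_Rintegral => y _; rewrite /stable.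
  rewrite (_ : \int[leb]_eta F (y, eta) =
    (\int[leb]_eta osc s (y * eta) eta) * (expabs d y * cos (y * xi + c))); first ring.
  rewrite -RintegralMr; first by apply: eq_Rintegral => eta _; rewrite /F /osc /m /=; ring.
  have mc : measurable_fun [set: T] (fun eta : R => y * eta).
    by apply: measurable_funM => //; exact: measurable_cst.
  have := integrable_scale (expabs d y * cos (y * xi + c)) (integrable_osc s0 mc).
  by apply: eq_integrable => // eta _; rewrite mulrC.
congr (_ * _); rewrite (Rfubini1 intF) -(Rfubini2 intF).
have i1 := integrable_osc_lorentz c xi s0 d0.
have i2 := integrable_osc_lorentz (- c) (- xi) s0 d0.
transitivity (\int[leb]_eta (2^-1 * ((2 * d / (d ^+ 2 + (eta + xi) ^+ 2)) * osc s c eta) +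
    2^-1 * ((2 * d / (d ^+ 2 + (eta + - xi) ^+ 2)) * osc s (- c) eta))).
  apply: eq_Rintegral => eta _.
  have e k w : leb.-integrable [set: T] (EFin \o (fun y => expabs d y * cos (k + y * w))).
    have mk : measurable_fun [set: T] (fun y : R => cos (k + y * w)).
      apply: (measurableT_comp measurable_cosR); apply: measurable_funD; first exact: measurable_cst.
      by apply: measurable_funM => //; exact: measurable_cst.
    have := integrable_mulb mk (fun x => cos_max _) (integrable_expabs d0).
    by apply: eq_integrable => // y _; rewrite /= mulrC.
  transitivity (\int[leb]_y ((2^-1 * m eta) * (expabs d y * cos ((B * s * spow beta eta + c) + y * (eta + xi))) +
     (2^-1 * m eta) * (expabs d y * cos ((B * s * spow beta eta - c) + y * (eta - xi))))).
    apply: eq_Rintegral => y _; rewrite /F /=.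
    set u := B * s * spow beta eta + y * eta; set w := y * xi + c.
    rewrite (_ : _ + c + _ = u + w); last by rewrite /u /w; ring.
    rewrite (_ : _ - c + _ = u - w); last by rewrite /u /w; ring.
    by rewrite (cosB u w) (cosD u w); field.
  rewrite (Rintegral_lin _ _ (e _ _) (e _ _)) !Rintegral_expabs_phase// /osc -/(m eta); ring.
rewrite (Rintegral_lin _ _ i1 i2).
set f2 : T -> R := fun eta => (2 * d / (d ^+ 2 + (eta + - xi) ^+ 2)) * osc s (- c) eta.
have mf2 : measurable_fun [set: T] f2 by exact: measurable_of_integrable i2.
rewrite (_ : \int[leb]_x (2 * d / (d ^+ 2 + (x + xi) ^+ 2) * osc s c x) = \int[leb]_x f2 x); last first.
  rewrite -Rintegral_opp; last exact: measurable_of_integrable i1.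
  apply: eq_Rintegral => x _; rewrite osc_opp /f2; congr (_ / (_ + _) * _).
  by rewrite -sqrrN opprD opprK.
rewrite (_ : forall X : R, 2^-1 * X + 2^-1 * X = X); last by move=> X; field.
rewrite -(Rintegral_shift xi mf2) -(Rintegral_scale (f := fun x => f2 (x + xi)) d0); last first.
  by apply: (measurableT_comp mf2); apply: measurable_funD => //; exact: measurable_cst.
rewrite -RintegralZl//.
  apply: eq_Rintegral => z _; rewrite /f2 /lorentz addrK (addrC xi).
  have z0 : 1 + z ^+ 2 != 0 by rewrite gt_eqF// ltr_wpDr ?sqr_ge0.
  have z1 : d ^+ 2 + (d * z) ^+ 2 != 0 by rewrite gt_eqF// ltr_wpDr ?sqr_ge0// exprn_gt0.
  by field; rewrite z0 z1.
have mo : measurable_fun [set: T] (fun z => osc s (- c) (xi + d * z)).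
  apply: measurable_osc; [exact: measurable_cst|exact: measurable_cst|].
  apply: measurable_funD; first exact: measurable_cst.
  by apply: measurable_funM => //; exact: measurable_cst.
have := integrable_scale d^-1 (integrable_mulb mo (fun z => norm_osc_le1 _ _ s0) integrable_lorentz).
apply: eq_integrable => // z _; congr EFin; rewrite /f2 /lorentz addrK (addrC xi).
have z0 : 1 + z ^+ 2 != 0 by rewrite gt_eqF// ltr_wpDr ?sqr_ge0.
have z1 : d ^+ 2 + (d * z) ^+ 2 != 0 by rewrite gt_eqF// ltr_wpDr ?sqr_ge0// exprn_gt0.
by field; rewrite z0 z1 gt_eqF.
Qed.

Lemma continuous_osc (s c : R) : continuous (osc s c).
Proof.
move=> xi; apply: cvgM.
  apply: (continuous_comp (f := fun xi : R => - (A * s) * npow beta xi)); last exact: continuous_expR.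
  by apply: cvgM; [exact: cvg_cst|exact: continuous_npow].
apply: (continuous_comp (f := fun xi : R => B * s * spow beta xi + c)); last exact: continuous_cos.
apply: cvgD; last exact: cvg_cst.
by apply: cvgM; [exact: cvg_cst|exact: continuous_spow].
Qed.

(** Fourier inversion by Abel summation: in [regularized_transform] the parameter [d] survives only
    inside [osc], so dominated convergence by [lorentz], of mass [2 pi], yields the value at
    [xi]. *)
Lemma cvg_regularized_transform (s xi c : R) : 0 < s ->
  \int[leb]_y (expabs (harmonic n) y * (stable s y * cos (y * xi + c))) @[n --> \oo] -->
  osc s (- c) xi.
Proof.
move=> s0; rewrite (_ : (fun n => _) = fun n =>
    (2 * pi)^-1 * \int[leb]_z (osc s (- c) (xi + harmonic n * z) * lorentz z)); last first.
  by apply/funext => n; rewrite regularized_transform// harmonic_gt0.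
have [] := @Rdominated_cvg _ _ R leb
  (fun n z => osc s (- c) (xi + harmonic n * z) * lorentz z)
  (fun z => osc s (- c) xi * lorentz z) lorentz.
- move=> n; apply: measurable_funM; last exact: measurable_lorentz.
  apply: measurable_osc; [exact: measurable_cst|exact: measurable_cst|].
  apply: measurable_funD; first exact: measurable_cst.
  by apply: measurable_funM => //; exact: measurable_cst.
- move=> z; apply: cvgM; last exact: cvg_cst.
  apply: (cvg_comp (fun n => xi + harmonic n * z)); last exact: continuous_osc.
  have : xi + harmonic n * z @[n --> \oo] --> xi + 0 * z.
    by apply: cvgD; [exact: cvg_cst|apply: cvgM; [exact: cvg_harmonic|exact: cvg_cst]].
  by rewrite mul0r addr0.
- exact: integrable_lorentz.
- move=> n z; rewrite normrM (ger0_norm (lorentz_ge0 z)).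
  by rewrite ler_piMl ?lorentz_ge0// norm_osc_le1.
move=> _ h; rewrite (_ : osc s (- c) xi = (2 * pi)^-1 * \int[leb]_z (osc s (- c) xi * lorentz z)).
  by apply: cvgM; [exact: cvg_cst|exact: h].
rewrite RintegralZl//; last exact: integrable_lorentz.
rewrite {1}/Rintegral integral_lorentz /= mulrCA mulVf ?mulr1// mulf_neq0//.
by rewrite gt_eqF// pi_gt0.
Qed.

Lemma norm_stable_le (s x : R) : 0 < s -> `|stable s x| <= (2 * pi)^-1 * (expR (A * s) * (2 / (A * s))).
Proof.
move=> s0; have As : 0 < A * s by exact: mulr_gt0.
have p0 : 0 <= (2 * @pi R)^-1 by rewrite invr_ge0 mulr_ge0// pi_ge0.
rewrite normrM ger0_norm//; apply: ler_wpM2l => //.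
have mc : measurable_fun [set: T] (fun eta : R => x * eta).
  by apply: measurable_funM => //; exact: measurable_cst.
have io := integrable_osc s0 mc; have ie := integrable_scale (expR (A * s)) (integrable_expabs As).
rewrite -lee_fin; apply: (le_trans (le_abs_Rintegral leb (measurable_of_integrable io))).
apply: (@le_trans _ _ (\int[leb]_xi (expR (A * s) * expabs (A * s) xi)%:E)%E).
  apply: ge0_le_integral => //.
  - by apply/measurable_EFinP; apply: measurableT_comp => //; exact: measurable_of_integrable io.
  - by have /integrableP[] := ie.
  - by move=> xi _; rewrite lee_fin norm_osc_le.
rewrite -EFin_Rintegral// RintegralZl//; last exact: integrable_expabs.
by rewrite {1}/Rintegral integral_expabs.
Qed.

Hypothesis stable_ge0 : forall s x : R, 0 < s -> 0 <= stable s x.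

(** At frequency 0 the regularized transform is at most [(2 pi)^-1 * 2 pi = 1]; by nonnegativity the
    regularized masses increase to the full one. *)
Lemma stable_mass_le (s : R) : 0 < s -> (\int[leb]_x (stable s x)%:E <= 1)%E.
Proof.
move=> s0; pose g n (y : T) := (expabs (harmonic n) y * stable s y)%:E.
have ms : measurable_fun [set: T] (fun y => stable s y).
  by apply: measurable_stable => //; exact: measurable_cst.
have me n : measurable_fun [set: T] (expabs (harmonic n : R) : T -> R).
  by apply: continuous_measurable_fun; exact: continuous_expabs.
have mg n : measurable_fun [set: T] (g n) by apply/measurable_EFinP; exact: measurable_funM.
have g0 n y : [set: T] y -> (0 <= g n y)%E.
  by move=> _; rewrite lee_fin mulr_ge0 ?expabs_ge0// stable_ge0.
have ndg y : [set: T] y -> nondecreasing_seq (g ^~ y).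
  move=> _ n n' nn'; rewrite lee_fin ler_wpM2r ?stable_ge0// ler_expR !mulNr lerN2.
  by rewrite ler_wpM2r// lef_pV2 ?posrE// ler_nat.
have cvgg y : g n y @[n --> \oo] --> (stable s y)%:E.
  apply: cvg_EFin; first exact: nearW.
  rewrite -[X in _ --> X]mul1r; apply: cvgM; last exact: cvg_cst.
  rewrite -expR0 -(mul0r `|y|) -oppr0; apply: continuous_cvg; first exact: continuous_expR.
  by apply: cvgM; [apply: cvgN; exact: cvg_harmonic|exact: cvg_cst].
have h1 n : (\int[leb]_y g n y <= 1)%E.
  have := regularized_transform 0 0 s0 (harmonic_gt0 n : 0 < harmonic n :> R).
  have ie : leb.-integrable [set: T] (g n).
    have := integrable_mulb ms (fun y => norm_stable_le y s0) (integrable_expabs (harmonic_gt0 n)).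
    by apply: eq_integrable => // y _; rewrite /g mulrC.
  under eq_Rintegral do rewrite mulr0 addr0 cos0 mulr1.
  rewrite -EFin_Rintegral// => ->; rewrite lee_fin.
  have e : (2 * pi)^-1 * (2 * pi) = 1 :> R by rewrite mulVf// mulf_neq0// gt_eqF// pi_gt0.
  rewrite -[leRHS]e.
  apply: ler_wpM2l; first by rewrite invr_ge0 mulr_ge0// pi_ge0.
  rewrite [leRHS](_ : 2 * pi = \int[leb]_z lorentz z); last by rewrite /Rintegral integral_lorentz.
  apply: le_Rintegral => //; last first.
    by move=> z _; rewrite ler_piMl ?lorentz_ge0// (le_trans (ler_norm _))// norm_osc_le1.
  - exact: integrable_lorentz.
  - apply: (integrable_mulb _ (fun z => norm_osc_le1 _ _ s0) integrable_lorentz).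
    apply: measurable_osc; [exact: measurable_cst|exact: measurable_cst|].
    apply: measurable_funD; first exact: measurable_cst.
    by apply: measurable_funM => //; exact: measurable_cst.
have := fun t => @cvg_monotone_convergence _ _ _ t _ measurableT g mg g0 ndg.
rewrite (_ : (fun x => limn (g ^~ x)) = fun x => (stable s x)%:E); last first.
  by apply/funext => y; apply: cvg_lim.
move=> /(_ leb) h; rewrite -(cvg_lim _ h)//; apply: lime_le; first by apply/cvg_ex; eexists; exact: h.
exact: nearW.
Qed.

Lemma integrable_stable (s : R) : 0 < s -> leb.-integrable [set: T] (EFin \o stable s).
Proof.
move=> s0; apply/integrableP; split.
  by apply/measurable_EFinP; apply: measurable_stable => //; exact: measurable_cst.
apply: (@le_lt_trans _ _ 1%E); last by rewrite ltry.
apply: le_trans (stable_mass_le s0); under eq_integral do rewrite /= ger0_norm ?stable_ge0//.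
by [].
Qed.

(** Now that [stable s] is integrable, dominated convergence removes the regularization. The phase
    returns with opposite sign because [stable] is an inverse transform. *)
Lemma transform_stable (s xi c : R) : 0 < s ->
  \int[leb]_y (stable s y * cos (y * xi + c)) = osc s (- c) xi.
Proof.
move=> s0; have h0 := @cvg_regularized_transform s xi c s0; rewrite -(cvg_lim _ h0)//; apply/esym.
have ms : measurable_fun [set: T] (fun y => stable s y).
  by apply: measurable_stable => //; exact: measurable_cst.
have mc : measurable_fun [set: T] (fun y : R => cos (y * xi + c)).
  apply: (measurableT_comp measurable_cosR); apply: measurable_funD; last exact: measurable_cst.
  by apply: measurable_funM => //; exact: measurable_cst.
have [] := @Rdominated_cvg _ _ R leb
  (fun n y => expabs (harmonic n) y * (stable s y * cos (y * xi + c)))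
  (fun y => stable s y * cos (y * xi + c)) (stable s).
- move=> n; apply: measurable_funM; last exact: measurable_funM.
  by apply: continuous_measurable_fun; exact: continuous_expabs.
- move=> y; rewrite -[X in _ --> X]mul1r; apply: cvgM; last exact: cvg_cst.
  rewrite -expR0 -(mul0r `|y|) -oppr0; apply: continuous_cvg; first exact: continuous_expR.
  by apply: cvgM; [apply: cvgN; exact: cvg_harmonic|exact: cvg_cst].
- exact: integrable_stable.
- move=> n y; rewrite (normrM (expabs _ _)) (normrM (stable s y)) (ger0_norm (expabs_ge0 _ _)) (ger0_norm (stable_ge0 y s0)).
  rewrite -[leRHS]mul1r; apply: ler_pM.
  - exact: expabs_ge0.
  - exact: mulr_ge0 (stable_ge0 y s0) (normr_ge0 _).
  - by rewrite -expR0 ler_expR mulNr oppr_le0 mulr_ge0 ?harmonic_ge0.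
  - by apply: ler_piMr; [exact: stable_ge0|exact: cos_max].
by move=> _ h; exact: cvg_lim h.
Qed.

Lemma integrable_stableM (t s x : R) : 0 < t -> 0 < s ->
  leb.-integrable [set: T] (fun y => (stable t (x - y) * stable s y)%:E).
Proof.
move=> t0 s0; have mt : measurable_fun [set: T] (fun y : R => stable t (x - y)).
  apply: measurable_stable; first exact: measurable_cst.
  by apply: measurable_funB => //; exact: measurable_cst.
exact: (integrable_mulb mt (fun y => norm_stable_le _ t0) (integrable_stable s0)).
Qed.

(** The factor at time [t] is replaced by its Fourier integral; after Fubini the factor at time [s]
    is evaluated by [transform_stable], and the exponents of the multipliers add up. *)
Lemma stable_semigroup (t s x : R) : 0 < t -> 0 < s ->
  (\int[leb]_y (stable t (x - y) * stable s y)%:E = (stable (t + s) x)%:E)%E.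
Proof.
move=> t0 s0; rewrite -EFin_Rintegral; last exact: integrable_stableM.
congr EFin; pose m xi := expR (- (A * t) * npow beta xi).
have mm : measurable_fun [set: T] (m : T -> R).
  apply: (measurableT_comp (@measurable_expR R)); apply: measurable_funM; first exact: measurable_cst.
  exact: measurable_npow.
have intm : leb.-integrable [set: T] (EFin \o m).
  have At : 0 < A * t by exact: mulr_gt0.
  have := integrable_scale (expR (A * t)) (integrable_expabs At); apply: le_integrable => //.
    exact/measurable_EFinP.
  move=> z _; rewrite lee_fin ger0_norm ?expR_ge0// (le_trans (multiplier_le _ t0))//.
  exact: ler_norm.
pose F (z : T * T) := cos (B * t * spow beta z.2 + (x - z.1) * z.2) * (stable s z.1 * m z.2).
have intF : (leb \x leb)%E.-integrable [set: T * T] (EFin \o F).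
  apply: (@integrable_tensor _ _ _ _ 1) => //; first exact: integrable_stable.
    have m1 := @measurable_fst _ _ T T; have m2 := @measurable_snd _ _ T T.
    apply: (measurableT_comp measurable_cosR); apply: measurable_funD.
      by apply: measurable_funM; [exact: measurable_cst|exact: (measurableT_comp measurable_spow)].
    by apply: measurable_funM => //; apply: measurable_funB => //; exact: measurable_cst.
  by move=> z; rewrite cos_max.
transitivity ((2 * pi)^-1 * \int[leb]_y \int[leb]_eta F (y, eta)).
  rewrite -RintegralZl//; last exact: integrable_Rfubini1 intF.
  apply: eq_Rintegral => y _; rewrite {1}/stable -mulrA; congr (_ * _).
  have mc : measurable_fun [set: T] (fun eta : R => (x - y) * eta).
    by apply: measurable_funM => //; exact: measurable_cst.
  have i1 := integrable_osc t0 mc.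
  rewrite -RintegralMr; first by apply: eq_Rintegral => eta _; rewrite /F /osc /m /=; ring.
  have := integrable_scale (stable s y) i1.
  by apply: eq_integrable => // eta _; rewrite mulrC.
congr (_ * _); rewrite (Rfubini1 intF) -(Rfubini2 intF).
apply: eq_Rintegral => eta _.
rewrite (_ : osc (t + s) (x * eta) eta = m eta * osc s (B * t * spow beta eta + x * eta) eta); last first.
  by rewrite /osc /m mulrA -expRD; congr (expR _ * cos _); ring.
rewrite -(opprK (B * t * _ + _)) -transform_stable// -RintegralZl//.
  apply: eq_Rintegral => y _; rewrite /F /=.
  rewrite (_ : cos (_ + _) = cos (y * eta + - (B * t * spow beta eta + x * eta))); last first.
    by rewrite -cosN; congr cos; ring.
  by ring.
have mc : measurable_fun [set: T] (fun y : R => cos (y * eta + - (B * t * spow beta eta + x * eta))).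
  apply: (measurableT_comp measurable_cosR); apply: measurable_funD; last exact: measurable_cst.
  by apply: measurable_funM => //; exact: measurable_cst.
have := integrable_mulb mc (fun y => cos_max _) (integrable_stable s0).
by apply: eq_integrable => // y _; rewrite mulrC.
Qed.

(** Both powers in the exponent are homogeneous of degree [beta], so rescaling the frequency by
    [s^(1 / beta)] turns time 1 into time [s]. Estimates on the kernel reduce to time 1. *)
Lemma stable_scaling (s x : R) : 0 < s ->
  stable s x = s `^ (- beta^-1) * stable 1 (x * s `^ (- beta^-1)).
Proof.
move=> s0; set r := s `^ beta^-1; have r0 : 0 < r by exact: powR_gt0.
rewrite powRN -/r.
have mf : measurable_fun [set: T] (fun xi : R => osc 1 (x / r * xi) xi).
  by apply: measurable_osc => //; exact: measurable_funM.
rewrite /stable -(Rintegral_scale r0 mf) [RHS]mulrCA; congr (_ * _).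
rewrite mulrA mulVf ?gt_eqF// mul1r; apply: eq_Rintegral => xi _.
have e : r `^ beta = s by rewrite -powRrM mulVf ?gt_eqF// powRr1// ltW.
have en : npow beta (r * xi) = s * npow beta xi.
  by rewrite /npow normrM (gtr0_norm r0) powRM ?(ltW r0)// e.
have es : spow beta (r * xi) = s * spow beta xi.
  by rewrite /spow sgrM (gtr0_sg r0) mul1r -/(npow _ _) en mulrCA.
rewrite /osc en es.
have rn : r != 0 by rewrite gt_eqF.
by rewrite (_ : x / r * (r * xi) = x * xi); [congr (expR _ * cos _); ring|field].
Qed.

End stable_kernel.

(** * Positivity of the stable kernel *)

Section binomial_series.
Context {R : realType} (beta : R).
Hypothesis b12 : 1 < beta < 2.

(** Coefficient of [z^n] in [(1 - z)^beta]. For [1 < beta < 2] the one of degree 1 is the only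
    negative one. *)
Definition gbinom (n : nat) : R := \prod_(i < n) ((i%:R - beta) / i.+1%:R).

Lemma gbinomS n : gbinom n.+1 = gbinom n * ((n%:R - beta) / n.+1%:R).
Proof. by rewrite /gbinom big_ord_recr. Qed.

Lemma gbinom0 : gbinom 0 = 1.
Proof. by rewrite /gbinom big_ord0. Qed.

Lemma gbinom1 : gbinom 1 = - beta.
Proof. by rewrite gbinomS gbinom0 mul1r sub0r divr1. Qed.

Lemma gbinom_ge0 n : 0 <= gbinom n.+2.
Proof.
case/andP: b12 => b1 b2; elim: n => [|n IH].
  rewrite gbinomS gbinom1 mulrA divr_ge0// mulNr -mulrN mulr_ge0//; lra.
rewrite gbinomS mulr_ge0// divr_ge0// -!natr1.
have := ler0n R n; lra.
Qed.

(** The left-hand side is nonincreasing: one step multiplies it by [(n + 2 - beta) / (n + 1)], at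
    most 1 as [beta > 1]. *)
Lemma gbinom_decay n : (n.+1%:R * n.+2%:R) * gbinom n.+2 <= beta * (beta - 1).
Proof.
case/andP: b12 => b1 b2; elim: n => [|n IH].
  by rewrite gbinomS gbinom1 /= [leLHS](_ : _ = beta * (beta - 1))//; field.
apply: le_trans IH; rewrite gbinomS.
have n3 : n.+3%:R != 0 :> R by rewrite pnatr_eq0.
rewrite [leLHS](_ : _ = (n.+2%:R * gbinom n.+2) * (n.+2%:R - beta)); last by field.
rewrite [leRHS](_ : _ = (n.+2%:R * gbinom n.+2) * n.+1%:R); last by ring.
apply: ler_wpM2l; first by rewrite mulr_ge0// gbinom_ge0.
rewrite -(@natr1 R n.+1); lra.
Qed.

(** Defect of the truncated series in the differential equation of [(1 - z)^beta]; by [sum_gbinom]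
    it is also [beta] times the value of the truncation at [z = 1]. *)
Definition bdefect n : R := - (n.+1%:R * gbinom n.+1).

Lemma bdefect_le n : `|bdefect n.+1| <= beta * (beta - 1) * n.+1%:R^-1.
Proof.
rewrite /bdefect normrN ger0_norm ?mulr_ge0 ?gbinom_ge0//.
by rewrite ler_pdivlMr// mulrC mulrA; exact: gbinom_decay.
Qed.

Lemma cvg_bdefect : bdefect n @[n --> \oo] --> 0.
Proof.
rewrite -(cvg_shiftS bdefect); apply: norm_cvg0.
apply: (squeeze_cvgr (f := fun=> 0) (h := fun n => beta * (beta - 1) * harmonic n)).
- by apply: nearW => n; rewrite normr_ge0; exact: bdefect_le.
- exact: cvg_cst.
- rewrite -[X in _ --> X](mulr0 (beta * (beta - 1))).
  by apply: cvgM; [exact: cvg_cst|exact: cvg_harmonic].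
Qed.

Lemma sum_gbinom n : beta * \sum_(k < n.+1) gbinom k = bdefect n.
Proof.
have b0 : beta != 0 by case/andP: b12 => b1 _; rewrite gt_eqF// (lt_trans _ b1).
rewrite /bdefect; elim: n => [|n IH]; first by rewrite big_ord1 gbinom0 gbinom1; ring.
rewrite big_ord_recr mulrDr IH [gbinom n.+2]gbinomS.
have n2 : n.+2%:R != 0 :> R by rewrite pnatr_eq0.
by move: n2; rewrite -!natr1 => n2; field.
Qed.

Lemma bdefectS_le0 n : bdefect n.+1 <= 0.
Proof. by rewrite oppr_le0 mulr_ge0// gbinom_ge0. Qed.

(** Real part and, below, imaginary part of the truncated series at [z = e^(- i th)]; the prefix [d]
    marks their derivatives in [th]. *)
Definition cseries n (th : R) := \sum_(k < n.+1) gbinom k * cos (k%:R * th).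
Definition sseries n (th : R) := - \sum_(k < n.+1) gbinom k * sin (k%:R * th).
Definition dcseries n (th : R) := - \sum_(k < n.+1) k%:R * gbinom k * sin (k%:R * th).
Definition dsseries n (th : R) := - \sum_(k < n.+1) k%:R * gbinom k * cos (k%:R * th).

Lemma der_cseries n (th : R) : is_derive th 1 (cseries n) (dcseries n th).
Proof.
elim: n => [|n IH].
  have -> : cseries 0 = fun=> 1.
    by apply/funext => x; rewrite /cseries big_ord1 gbinom0 mul0r cos0 mulr1.
  by apply: (der_eq (der_cst _ _)); rewrite /dcseries big_ord1 !mul0r oppr0.
have -> : cseries n.+1 = fun x => cseries n x + gbinom n.+1 * cos (n.+1%:R * x).
  by apply/funext => x; rewrite /cseries big_ord_recr.
apply: (der_eq (der_add IH (der_scale _ (der_cos (der_scale _ (der_id _)))))).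
by rewrite (_ : dcseries n.+1 th = dcseries n th - n.+1%:R * gbinom n.+1 * sin (n.+1%:R * th)); [ring|rewrite /dcseries big_ord_recr opprD].
Qed.

Lemma der_sseries n (th : R) : is_derive th 1 (sseries n) (dsseries n th).
Proof.
elim: n => [|n IH].
  have -> : sseries 0 = fun=> 0.
    by apply/funext => x; rewrite /sseries big_ord1 gbinom0 mul0r sin0 mulr0 oppr0.
  by apply: (der_eq (der_cst _ _)); rewrite /dsseries big_ord1 !mul0r oppr0.
have -> : sseries n.+1 = fun x => sseries n x - gbinom n.+1 * sin (n.+1%:R * x).
  by apply/funext => x; rewrite /sseries big_ord_recr/= opprD.
apply: (der_eq (der_sub IH (der_scale _ (der_sin (der_scale _ (der_id _)))))).
by rewrite (_ : dsseries n.+1 th = dsseries n th - n.+1%:R * gbinom n.+1 * cos (n.+1%:R * th)); [ring|rewrite /dsseries big_ord_recr opprD].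
Qed.

(* The real and imaginary parts of [(1 - z) F' + beta F = bdefect n * z^n] for the truncation [F] of
   [(1 - z)^beta], at [z = e^(- i th)]. *)
Lemma ode_cseries n th : 2 * sin (th / 2) * dcseries n th =
  beta * cos (th / 2) * cseries n th + beta * sin (th / 2) * sseries n th
  - bdefect n * cos (n%:R * th + th / 2).
Proof.
elim: n => [|n IH].
  rewrite /dcseries /cseries /sseries /bdefect !big_ord1 gbinom0 gbinom1 !mul0r sin0 cos0 add0r; ring.
have -> : dcseries n.+1 th = dcseries n th - n.+1%:R * gbinom n.+1 * sin (n.+1%:R * th).
  by rewrite /dcseries big_ord_recr opprD.
have -> : cseries n.+1 th = cseries n th + gbinom n.+1 * cos (n.+1%:R * th).
  by rewrite /cseries big_ord_recr.
have -> : sseries n.+1 th = sseries n th - gbinom n.+1 * sin (n.+1%:R * th).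
  by rewrite /sseries big_ord_recr opprD.
rewrite mulrBr IH /bdefect [gbinom n.+2]gbinomS.
have -> : n%:R * th + th / 2 = n.+1%:R * th - th / 2 by rewrite -natr1; field.
have n2 : n.+2%:R != 0 :> R by rewrite pnatr_eq0.
rewrite cosB cosD; move: n2; rewrite -(@natr1 R n.+1) => n2; field.
by rewrite nat1r natr1 pnatr_eq0.
Qed.

Lemma ode_sseries n th : 2 * sin (th / 2) * dsseries n th =
  beta * cos (th / 2) * sseries n th - beta * sin (th / 2) * cseries n th
  + bdefect n * sin (n%:R * th + th / 2).
Proof.
elim: n => [|n IH].
  rewrite /dsseries /cseries /sseries /bdefect !big_ord1 gbinom0 gbinom1 !mul0r sin0 cos0 add0r; ring.
have -> : dsseries n.+1 th = dsseries n th - n.+1%:R * gbinom n.+1 * cos (n.+1%:R * th).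
  by rewrite /dsseries big_ord_recr opprD.
have -> : cseries n.+1 th = cseries n th + gbinom n.+1 * cos (n.+1%:R * th).
  by rewrite /cseries big_ord_recr.
have -> : sseries n.+1 th = sseries n th - gbinom n.+1 * sin (n.+1%:R * th).
  by rewrite /sseries big_ord_recr opprD.
rewrite mulrBr IH /bdefect [gbinom n.+2]gbinomS.
have -> : n%:R * th + th / 2 = n.+1%:R * th - th / 2 by rewrite -natr1; field.
have n2 : n.+2%:R != 0 :> R by rewrite pnatr_eq0.
rewrite sinB sinD; move: n2; rewrite -(@natr1 R n.+1) => n2; field.
by rewrite nat1r natr1 pnatr_eq0.
Qed.

(** Polar form: [1 - e^(- i th) = chord th * e^(i (pi - th) / 2)], so that [tilt] is the argument of
    its power [beta]. *)
Definition chord (th : R) := 2 * sin (th / 2).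
Definition tilt (th : R) := beta * (pi - th) / 2.

Lemma der_half (th : R) : is_derive th 1 (fun x : R => x / 2) 2^-1.
Proof. by apply: (der_eq (der_mul (der_id th) (der_cst 2^-1 th))); ring. Qed.

Lemma der_chord (th : R) : is_derive th 1 chord (cos (th / 2)).
Proof. by apply: (der_eq (der_scale 2 (der_sin (der_half th)))); field. Qed.

Lemma der_tilt (th : R) : is_derive th 1 tilt (- (beta / 2)).
Proof.
have e : tilt = fun x : R => (beta / 2) * (pi - x) by apply/funext => x; rewrite /tilt; field.
by rewrite e; apply: (der_eq (der_scale _ (der_sub (der_cst pi th) (der_id th)))); field.
Qed.

Lemma chord_gt0 (th : R) : 0 < th <= pi -> 0 < chord th.
Proof. by case/andP=> t0 tpi; rewrite mulr_gt0// sin_gt0_pi//; have := @pi_gt0 R; lra. Qed.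

(** Real part and, below, imaginary part of the truncated series divided by [(1 - z)^beta]. *)
Definition twist_re n th := chord th `^ (- beta) *
  (cseries n th * cos (tilt th) + sseries n th * sin (tilt th)).
Definition twist_im n th := chord th `^ (- beta) *
  (sseries n th * cos (tilt th) - cseries n th * sin (tilt th)).

(** Dividing by [(1 - z)^beta], a solution of the homogeneous equation, leaves only the defect in
    the derivative. *)
Lemma der_twist_re n (th : R) : 0 < th <= pi -> is_derive th 1 (twist_re n)
  (- (bdefect n * chord th `^ (- beta - 1) * cos (tilt th + (n%:R * th + th / 2)))).
Proof.
move=> th0; have c0 := chord_gt0 th0.
have dl := der_tilt th.
apply: (der_eq (der_mul (der_pow (- beta) c0 (der_chord th))
  (der_add (der_mul (der_cseries n th) (der_cos dl)) (der_mul (der_sseries n th) (der_sin dl))))).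
have e : chord th `^ (- beta) = chord th `^ (- beta - 1) * chord th.
  by rewrite -[X in _ = _ * X](powRr1 (ltW c0)) -powRD ?subrK// (gt_eqF c0) implybT.
rewrite e; set D := _ `^ _.
have := ode_cseries n th; have := ode_sseries n th; rewrite -/(chord th).
set u := cseries n th; set v := sseries n th; set u' := dcseries n th; set v' := dsseries n th.
set X := n%:R * th + _; move=> ev eu.
have sE : sin (th / 2) = chord th / 2 by rewrite /chord; field.
rewrite (_ : D * chord th * _ = D * ((chord th * u') * cos (tilt th) + (chord th * v') * sin (tilt th)
  + chord th * (beta / 2) * (u * sin (tilt th) - v * cos (tilt th)))); last by field.
by rewrite eu ev sE (cosD (tilt th)); field.
Qed.

Lemma der_twist_im n (th : R) : 0 < th <= pi -> is_derive th 1 (twist_im n)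
  (bdefect n * chord th `^ (- beta - 1) * sin (tilt th + (n%:R * th + th / 2))).
Proof.
move=> th0; have c0 := chord_gt0 th0.
have dl := der_tilt th.
apply: (der_eq (der_mul (der_pow (- beta) c0 (der_chord th))
  (der_sub (der_mul (der_sseries n th) (der_cos dl)) (der_mul (der_cseries n th) (der_sin dl))))).
have e : chord th `^ (- beta) = chord th `^ (- beta - 1) * chord th.
  by rewrite -[X in _ = _ * X](powRr1 (ltW c0)) -powRD ?subrK// (gt_eqF c0) implybT.
rewrite e; set D := _ `^ _.
have := ode_cseries n th; have := ode_sseries n th; rewrite -/(chord th).
set u := cseries n th; set v := sseries n th; set u' := dcseries n th; set v' := dsseries n th.
set X := n%:R * th + _; move=> ev eu.
have sE : sin (th / 2) = chord th / 2 by rewrite /chord; field.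
rewrite (_ : D * chord th * _ = D * ((chord th * v') * cos (tilt th) - (chord th * u') * sin (tilt th)
  + chord th * (beta / 2) * (v * sin (tilt th) + u * cos (tilt th)))); last by field.
by rewrite eu ev sE (sinD (tilt th)); field.
Qed.

Lemma MVT_bound (f df : R -> R) (th C : R) : 0 < th <= pi ->
  (forall x, 0 < x <= pi -> is_derive x 1 f (df x)) ->
  (forall x, th <= x <= pi -> `|df x| <= C) -> `|f th - f pi| <= C * pi.
Proof.
case/andP=> t0 tpi dfx dfC; have [] := @MVT_segment _ f df th pi tpi.
- by move=> x; rewrite in_itv/= => /andP[x1 x2]; apply: dfx; rewrite (lt_trans t0 x1) ltW.
- apply: continuous_in_subspaceT => x; rewrite inE/= in_itv/= => /andP[x1 x2].
  by apply: der_continuous; apply: dfx; rewrite (lt_le_trans t0 x1).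
move=> x; rewrite in_itv/= => /andP[x1 x2] e; rewrite distrC e normrM.
have dx : `|df x| <= C by apply: dfC; rewrite x1 x2.
apply: ler_pM => //; rewrite ger0_norm ?subr_ge0//; lra.
Qed.

Lemma chord_mono (th x : R) : 0 < th -> th <= x <= pi -> chord th <= chord x.
Proof.
move=> t0 /andP[tx xpi]; rewrite ler_pM2l//.
have pi0 := @pi_gt0 R.
have [<-//|tx'] := eqVneq th x.
have tx2 : th < x by rewrite lt_neqAle tx'.
apply/ltW; rewrite ltr_sin ?in_itv/=; lra.
Qed.

Lemma twist_re_pi n : twist_re n pi = 2 `^ (- beta) * cseries n pi.
Proof.
rewrite /twist_re /chord /tilt subrr mulr0 mul0r cos0 sin0 mulr0 addr0 mulr1.
by rewrite sin_pihalf mulr1.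
Qed.

Lemma twist_im_pi n : twist_im n pi = 0.
Proof.
rewrite /twist_im /chord /tilt subrr mulr0 mul0r cos0 sin0 mulr0 subr0 mulr1.
rewrite /sseries big1 ?oppr0 ?mulr0// => k _.
suff -> : sin (k%:R * @pi R) = 0 by rewrite mulr0.
by elim: (nat_of_ord k) => [|j IH]; rewrite ?mul0r ?sin0// -natr1 mulrDl mul1r sinDpi IH oppr0.
Qed.

Lemma twist_bound n (x th : R) : 0 < th -> th <= x <= pi ->
  `|bdefect n| * chord x `^ (- beta - 1) <= `|bdefect n| * chord th `^ (- beta - 1).
Proof.
move=> t0 /andP[tx xpi]; apply: ler_wpM2l => //.
have c0 : 0 < chord th by rewrite chord_gt0// t0 (le_trans tx).
have cx : chord th <= chord x by rewrite chord_mono// tx.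
rewrite -opprD !powRN lef_pV2 ?posrE ?powR_gt0// ?(lt_le_trans c0)//.
have b0 : 0 <= beta + 1 by case/andP: b12 => b1 _; lra.
by apply: ge0_ler_powR => //; rewrite nnegrE ltW// (lt_le_trans c0).
Qed.

(** On [[th, pi]] the chord is smallest at [th], which bounds the derivative by a multiple of
    [|bdefect n|]; the mean value theorem then makes the quotient constant in the limit. The
    reference point is [pi], where the series is real. *)
Lemma cvg_twist (th : R) (tw : nat -> R -> R) (d : nat -> R -> R) : 0 < th <= pi ->
  (forall n x, 0 < x <= pi -> is_derive x 1 (tw n)
    (bdefect n * chord x `^ (- beta - 1) * d n x)) ->
  (forall n x, `|d n x| <= 1) -> tw n th - tw n pi @[n --> \oo] --> 0.
Proof.
move=> th0 dtw d1; apply: norm_cvg0.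
pose K := chord th `^ (- beta - 1) * pi.
apply: (squeeze_cvgr (f := fun=> 0) (h := fun n => `|bdefect n| * K)).
- apply: nearW => n; rewrite normr_ge0 /K mulrA.
  apply: (MVT_bound th0 (dtw n)) => x tx; have /andP[t0 _] := th0.
  apply: le_trans (twist_bound n t0 tx).
  by rewrite !normrM (ger0_norm (powR_ge0 _ _)) ler_piMr// mulr_ge0// powR_ge0.
- exact: cvg_cst.
- rewrite -[X in _ --> X](mul0r K) -(@normr0 _ R); apply: cvgM; last exact: cvg_cst.
  by apply: cvg_norm; exact: cvg_bdefect.
Qed.

(** The single negative coefficient is [- beta], so the absolute sum exceeds the sum by [2 beta],
    and the latter is nonpositive by [bdefectS_le0]. *)
Lemma sum_abs_gbinom n : \sum_(k < n.+2) `|gbinom k| <= 2 * beta.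
Proof.
have b0 : 0 < beta by case/andP: b12 => b1 _; rewrite (lt_trans _ b1).
have -> : \sum_(k < n.+2) `|gbinom k| = \sum_(k < n.+2) gbinom k + 2 * beta.
  elim: n => [|n IH].
    by rewrite !big_ord_recr !big_ord0/= gbinom0 gbinom1 normr1 normrN gtr0_norm//; ring.
  by rewrite big_ord_recr IH [in RHS]big_ord_recr/= ger0_norm ?gbinom_ge0//; ring.
rewrite gerDr -(pmulr_rle0 _ b0) sum_gbinom; exact: bdefectS_le0.
Qed.

Lemma is_cvg_abs_gbinom : cvgn (series (fun k => `|gbinom k|)).
Proof.
apply: nondecreasing_is_cvgn; first by apply: nondecreasing_series => *; exact: normr_ge0.
exists (2 * beta) => _ [n _ <-]; apply: le_trans (sum_abs_gbinom n).
rewrite /series/= big_mkord -addn2 big_split_ord/= lerDl.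
by apply: sumr_ge0 => k _; exact: normr_ge0.
Qed.

Lemma is_cvg_gbinom (v : nat -> R) : (forall k, `|v k| <= 1) ->
  cvgn (fun n => \sum_(k < n.+1) gbinom k * v k).
Proof.
move=> v1; have h : cvgn (series (fun k => gbinom k * v k)).
  apply: normed_cvg; rewrite /=; apply: series_le_cvg is_cvg_abs_gbinom => // k.
  - exact: normr_ge0.
  - by rewrite /= normrM ler_piMr.
have e : (fun n => \sum_(k < n.+1) gbinom k * v k) = fun n => series (fun k => gbinom k * v k) n.+1.
  by apply/funext => n; rewrite /series/= big_mkord.
rewrite e; apply/cvg_ex; exists (limn (series (fun k => gbinom k * v k))).
by rewrite cvg_shiftS.
Qed.

Definition cpart th := limn (cseries ^~ th).
Definition spart th := limn (sseries ^~ th).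

Lemma cvg_cseries (th : R) : cseries n th @[n --> \oo] --> cpart th.
Proof. exact: (is_cvg_gbinom (v := fun k => cos (k%:R * th)) (fun k => cos_max _)). Qed.

Lemma cvg_sseries (th : R) : sseries n th @[n --> \oo] --> spart th.
Proof. exact: is_cvgN (is_cvg_gbinom (v := fun k => sin (k%:R * th)) (fun k => sin_max _)). Qed.

Lemma cpartN (th : R) : cpart (- th) = cpart th.
Proof.
rewrite /cpart; congr (limn _); apply/funext => n; apply: eq_bigr => k _.
by rewrite mulrN cosN.
Qed.

Lemma spartN (th : R) : spart (- th) = - spart th.
Proof.
apply: cvg_lim => //; rewrite (_ : sseries ^~ (- th) = fun n => - sseries n th).
  by apply: cvgN; exact: cvg_sseries.
apply/funext => n; rewrite /sseries; congr (GRing.opp _); rewrite -sumrN; apply: eq_bigr => k _.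
by rewrite mulrN sinN mulrN.
Qed.

Lemma cpart0 : cpart 0 = 0.
Proof.
have b0 : beta != 0 by case/andP: b12 => b1 _; rewrite gt_eqF// (lt_trans _ b1).
apply: cvg_lim => //; rewrite (_ : cseries ^~ 0 = fun n => beta^-1 * bdefect n).
  by rewrite -[X in _ --> X](mulr0 beta^-1); apply: cvgM; [exact: cvg_cst|exact: cvg_bdefect].
apply/funext => n; rewrite -sum_gbinom mulKf//; apply: eq_bigr => k _.
by rewrite mulr0 cos0 mulr1.
Qed.

Lemma spart0 : spart 0 = 0.
Proof. by have := spartN 0; rewrite oppr0; lra. Qed.

(** Degrees 0 and 1 contribute [1 + beta]; bounding the further cosines by [-1] gives [2] minus a
    sum of coefficients, and that sum is nonpositive. *)
Lemma cseries_pi_ge2 n : 2 <= cseries n.+1 pi.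
Proof.
have b0 : 0 < beta by case/andP: b12 => b1 _; rewrite (lt_trans _ b1).
apply: (@le_trans _ _ (2 - \sum_(k < n.+2) gbinom k)).
  by rewrite lerBrDl gerDr -(pmulr_rle0 _ b0) sum_gbinom; exact: bdefectS_le0.
elim: n => [|n IH].
  rewrite /cseries !big_ord_recr !big_ord0/= gbinom0 gbinom1 mul0r cos0 (_ : cos _ = -1); last by rewrite mul1r cospi.
  by lra.
rewrite /cseries big_ord_recr [leRHS]big_ord_recr opprD addrA; apply: lerD => //.
have := gbinom_ge0 n; have := cos_geN1 (n.+2%:R * @pi R).
by move=> c1 g0; rewrite -mulrN1; exact: ler_wpM2l.
Qed.

(** Limit of the series divided by [(1 - z)^beta], read off at [th = pi]. [walk_step] divides by it,
    so its positivity is what counts. *)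
Definition brho := 2 `^ (- beta) * cpart pi.

Lemma brho_gt0 : 0 < brho.
Proof.
rewrite mulr_gt0 ?powR_gt0// (@lt_le_trans _ _ 2)//.
rewrite /cpart; apply: limr_ge; first exact: (cvg_cseries (th := pi)).
by near=> n; rewrite -(@prednK n) ?cseries_pi_ge2//; near: n; exact: nbhs_infty_gt.
Unshelve. all: end_near. Qed.

Lemma cvg_twist_re (th : R) : 0 < th <= pi -> twist_re n th @[n --> \oo] --> brho.
Proof.
move=> th0; have h : twist_re n th - twist_re n pi @[n --> \oo] --> 0.
  apply: (cvg_twist th0 (d := fun n x => - cos (tilt x + (n%:R * x + x / 2)))) => n x.
    by move=> x0; apply: (der_eq (der_twist_re n x0)); rewrite mulrN.
  by rewrite normrN cos_max.
rewrite (_ : twist_re ^~ th = fun n => (twist_re n th - twist_re n pi) +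
    2 `^ (- beta) * cseries n pi); last first.
  by apply/funext => n; rewrite -twist_re_pi subrK.
rewrite -[brho]add0r; apply: cvgD => //; apply: cvgM; first exact: cvg_cst.
exact: cvg_cseries.
Qed.

Lemma cvg_twist_im (th : R) : 0 < th <= pi -> twist_im n th @[n --> \oo] --> 0.
Proof.
move=> th0; have h : twist_im n th - twist_im n pi @[n --> \oo] --> 0.
  apply: (cvg_twist th0 (d := fun n x => sin (tilt x + (n%:R * x + x / 2)))) => n x.
    exact: der_twist_im.
  exact: sin_max.
by move: h; under eq_cvg do rewrite twist_im_pi subr0.
Qed.

(** Undoing the division: on the circle the series sums to [brho (1 - z)^beta], of which this is the
    real part. *)
Lemma cpartE (th : R) : 0 < th <= pi -> cpart th = brho * chord th `^ beta * cos (tilt th).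
Proof.
move=> th0; have c0 := chord_gt0 th0; apply: cvg_lim => //.
rewrite (_ : cseries ^~ th = fun n => chord th `^ beta *
  (twist_re n th * cos (tilt th) - twist_im n th * sin (tilt th))); last first.
  apply/funext => n; rewrite /twist_re /twist_im powRN.
  have : chord th `^ beta != 0 by rewrite gt_eqF// powR_gt0.
  set D := _ `^ _ => D0; have := cos2Dsin2 (tilt th).
  set u := cseries n th; set v := sseries n th; set co := cos _; set si := sin _ => e.
  rewrite (_ : D * _ = u * (co ^+ 2 + si ^+ 2)); last by field.
  by rewrite e mulr1.
rewrite [X in _ --> X](_ : _ = chord th `^ beta * (brho * cos (tilt th) - 0 * sin (tilt th))).
  apply: cvgM; first exact: cvg_cst; apply: cvgB; apply: cvgM; try exact: cvg_cst.
    exact: cvg_twist_re.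
  exact: cvg_twist_im.
ring.
Qed.

Lemma spartE (th : R) : 0 < th <= pi -> spart th = brho * chord th `^ beta * sin (tilt th).
Proof.
move=> th0; have c0 := chord_gt0 th0; apply: cvg_lim => //.
rewrite (_ : sseries ^~ th = fun n => chord th `^ beta *
  (twist_re n th * sin (tilt th) + twist_im n th * cos (tilt th))); last first.
  apply/funext => n; rewrite /twist_re /twist_im powRN.
  have : chord th `^ beta != 0 by rewrite gt_eqF// powR_gt0.
  set D := _ `^ _ => D0; have := cos2Dsin2 (tilt th).
  set u := cseries n th; set v := sseries n th; set co := cos _; set si := sin _ => e.
  rewrite (_ : D * _ = v * (co ^+ 2 + si ^+ 2)); last by field.
  by rewrite e mulr1.
rewrite [X in _ --> X](_ : _ = chord th `^ beta * (brho * sin (tilt th) + 0 * cos (tilt th))).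
  apply: cvgM; first exact: cvg_cst; apply: cvgD; apply: cvgM; try exact: cvg_cst.
    exact: cvg_twist_re.
  exact: cvg_twist_im.
ring.
Qed.

End binomial_series.

(** * Complex numbers through their real and imaginary parts *)

Section complex_parts.
Local Open Scope complex_scope.
Context {R : realType}.
Implicit Types (x y z w : R[i]).

Definition cis (t : R) : R[i] := cos t +i* sin t.

Lemma ReM x y : complex.Re (x * y) =
  complex.Re x * complex.Re y - complex.Im x * complex.Im y.
Proof. by case: x => a b; case: y. Qed.

Lemma ImM x y : complex.Im (x * y) =
  complex.Re x * complex.Im y + complex.Im x * complex.Re y.
Proof. by case: x => a b; case: y. Qed.

Lemma ReD x y : complex.Re (x + y) = complex.Re x + complex.Re y.
Proof. by case: x => a b; case: y. Qed.

Lemma ImD x y : complex.Im (x + y) = complex.Im x + complex.Im y.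
Proof. by case: x => a b; case: y. Qed.

Lemma ReN x : complex.Re (- x) = - complex.Re x. Proof. by case: x. Qed.

Lemma ImN x : complex.Im (- x) = - complex.Im x. Proof. by case: x. Qed.

Lemma cisD (s t : R) : cis (s + t) = cis s * cis t.
Proof. by rewrite /cis cosD sinD; simpc; congr (_ +i* _); rewrite addrC. Qed.

Lemma normc_le1 z : (`|z| <= 1) = (complex.Re z ^+ 2 + complex.Im z ^+ 2 <= 1).
Proof.
rewrite normc_def -[1 in LHS]/(1%:C) lecR -[1 in LHS]sqrtr1.
by rewrite ler_sqrt.
Qed.

Lemma norm_cis (t : R) : `|cis t| = 1.
Proof. by rewrite normc_def /= cos2Dsin2 sqrtr1. Qed.

Lemma norm_realc (t : R) : 0 <= t -> `|t%:C| = t%:C.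
Proof. by move=> t0; rewrite normc_def /= expr0n addr0 sqrtr_sqr ger0_norm. Qed.

Lemma normc_le_parts z : `|z| <= (`|complex.Re z| + `|complex.Im z|)%:C.
Proof.
rewrite normc_def lecR -[leRHS]ger0_norm ?addr_ge0// -sqrtr_sqr ler_sqrt ?sqr_ge0//.
rewrite sqrrD !real_normK ?num_real// -addrA lerD2l lerDr mulrn_wge0// mulr_ge0.
Qed.

Lemma normc_ge_Im z : `|complex.Im z|%:C <= `|z|.
Proof.
by rewrite normc_def lecR -sqrtr_sqr ler_sqrt ?addr_ge0 ?sqr_ge0// lerDr sqr_ge0.
Qed.

Lemma norm_parts_le1 z : `|z| <= 1 -> `|complex.Re z| <= 1 /\ `|complex.Im z| <= 1.
Proof.
move=> z1; split; rewrite -lecR (le_trans _ z1)//; [exact: normc_ge_Re|exact: normc_ge_Im].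
Qed.

(** Telescoping factorization of the difference of powers into [n] products of modulus at most 1. *)
Lemma norm_subX_le z w n : `|z| <= 1 -> `|w| <= 1 -> `|z ^+ n - w ^+ n| <= n%:R * `|z - w|.
Proof.
move=> z1 w1; rewrite subrXX normrM mulrC; apply: ler_wpM2r => //.
rewrite (le_trans (ler_norm_sum _ _ _))//.
rewrite -[leRHS]mulr1 -[n in leRHS]card_ord mulr_natl -sumr_const; apply: ler_sum => i _.
by rewrite normrM !normrX mulr_ile1 ?exprn_ge0 ?exprn_ile1.
Qed.

Lemma cvg_complexX (z_ : nat -> R[i]) z k :
  complex.Re (z_ n) @[n --> \oo] --> complex.Re z ->
  complex.Im (z_ n) @[n --> \oo] --> complex.Im z ->
  (complex.Re (z_ n ^+ k) @[n --> \oo] --> complex.Re (z ^+ k)) /\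
  (complex.Im (z_ n ^+ k) @[n --> \oo] --> complex.Im (z ^+ k)).
Proof.
move=> cR cI; elim: k => [|k [IR II]].
  by rewrite expr0; split; exact: cvg_cst.
split.
- under eq_fun do rewrite exprS ReM.
  by rewrite exprS ReM; apply: cvgB; exact: cvgM.
- under eq_fun do rewrite exprS ImM.
  by rewrite exprS ImM; apply: cvgD; exact: cvgM.
Qed.

Lemma Re_sum n (F : nat -> R[i]) :
  complex.Re (\sum_(k < n) F k) = \sum_(k < n) complex.Re (F k).
Proof. by elim: n => [|n IH]; rewrite ?big_ord0// !big_ord_recr ReD IH. Qed.

Lemma Im_sum n (F : nat -> R[i]) :
  complex.Im (\sum_(k < n) F k) = \sum_(k < n) complex.Im (F k).
Proof. by elim: n => [|n IH]; rewrite ?big_ord0// !big_ord_recr ImD IH. Qed.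

End complex_parts.

(** * Functions of positive type *)

Section positive_definite.
Local Open Scope complex_scope.
Context {R : realType}.
Local Notation leb := (@lebesgue_measure R).
Local Notation T := (measurableTypeR R).

(* A surrogate for being the Fourier transform of a positive measure which, unlike the latter, is
   obviously stable under bounded pointwise limits. *)
Definition positive_type (f : R -> R[i]) :=
  [/\ measurable_fun [set: T] (fun xi : T => complex.Re (f xi)),
      measurable_fun [set: T] (fun xi : T => complex.Im (f xi)),
      (exists M, forall xi, `|complex.Re (f xi)| <= M /\ `|complex.Im (f xi)| <= M) &
      forall x d, 0 < d ->
        0 <= \int[leb]_xi (expabs d xi * complex.Re (f xi * cis (x * xi)))].

Lemma measurable_cos_scale (x : R) : measurable_fun [set: T] (fun xi : T => cos (x * xi)).
Proof. apply: continuous_measurable_fun => xi; exact: der_continuous (der_cos (der_scale x (der_id xi))). Qed.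

Lemma measurable_sin_scale (x : R) : measurable_fun [set: T] (fun xi : T => sin (x * xi)).
Proof. apply: continuous_measurable_fun => xi; exact: der_continuous (der_sin (der_scale x (der_id xi))). Qed.

Lemma measurable_Re_cis f x : positive_type f ->
  measurable_fun [set: T] (fun xi : T => complex.Re (f xi * cis (x * xi))).
Proof.
case=> mR mI _ _; under eq_fun do rewrite ReM.
by apply: measurable_funB; apply: measurable_funM => //;
  [exact: measurable_cos_scale|exact: measurable_sin_scale].
Qed.

Lemma norm_Re_cis (z : R[i]) (t M : R) : `|complex.Re z| <= M -> `|complex.Im z| <= M ->
  `|complex.Re (z * cis t)| <= M + M.
Proof.
move=> z1 z2; rewrite ReM (le_trans (ler_normB _ _))// !normrM; apply: lerD.
  by rewrite -[leRHS]mulr1; apply: ler_pM => //; exact: cos_max.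
by rewrite -[leRHS]mulr1; apply: ler_pM => //; exact: sin_max.
Qed.

Lemma integrable_positive_type f x d : positive_type f -> 0 < d ->
  leb.-integrable [set: T] (fun xi => (expabs d xi * complex.Re (f xi * cis (x * xi)))%:E).
Proof.
move=> pf d0; have [_ _ [M fM] _] := pf.
have h := integrable_mulb (measurable_Re_cis x pf)
  (fun xi => norm_Re_cis _ (fM xi).1 (fM xi).2) (integrable_expabs d0).
by apply: eq_integrable h => // xi _; rewrite mulrC.
Qed.

Lemma positive_type0 : positive_type (fun=> 0).
Proof.
split; [exact: measurable_cst|exact: measurable_cst|by exists 0 => xi; rewrite normr0|].
by move=> x d d0; apply: Rintegral_ge0 => xi _; rewrite mul0r mulr0.
Qed.

Lemma positive_type1 : positive_type (fun=> 1).
Proof.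
split; [exact: measurable_cst|exact: measurable_cst|by exists 1 => xi /=; rewrite normr0 normr1|].
move=> x d d0; under eq_Rintegral do rewrite mul1r /=.
by rewrite Rintegral_expabs_cos// divr_ge0 ?mulr_ge0 ?addr_ge0 ?sqr_ge0// ltW.
Qed.

Lemma positive_typeD f g : positive_type f -> positive_type g ->
  positive_type (fun xi => f xi + g xi).
Proof.
move=> pf pg; have [fR fI [M fM] fp] := pf; have [gR gI [N gN] gp] := pg; split.
- by under eq_fun do rewrite ReD; exact: measurable_funD.
- by under eq_fun do rewrite ImD; exact: measurable_funD.
- exists (M + N) => xi; rewrite ReD ImD.
  by split; rewrite (le_trans (ler_normD _ _))//; apply: lerD; apply fM || apply gN.
- move=> x d d0; rewrite (_ : Rintegral _ _ _ = \int[leb]_xi (1 * (expabs d xi * complex.Re (f xi * cis (x * xi)))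
    + 1 * (expabs d xi * complex.Re (g xi * cis (x * xi))))); last first.
    by apply: eq_Rintegral => xi _; rewrite mulrDl ReD; ring.
  rewrite Rintegral_lin; [|exact: integrable_positive_type..].
  by rewrite !mul1r; exact: addr_ge0 (fp x d d0) (gp x d d0).
Qed.

(** Multiplication by a character translates [x] to [x + y] in the positivity condition, which is
    imposed for all [x]. *)
Lemma positive_type_cis f (w y : R) : 0 <= w -> positive_type f ->
  positive_type (fun xi => w%:C * cis (y * xi) * f xi).
Proof.
move=> w0 pf; have [fR fI [M fM] fp] := pf.
have mc := measurable_cos_scale y; have ms := measurable_sin_scale y.
have mw : measurable_fun [set: T] (fun=> w : R) by exact: measurable_cst.
have eR xi : complex.Re (w%:C * cis (y * xi) * f xi) =
    w * (cos (y * xi) * complex.Re (f xi) - sin (y * xi) * complex.Im (f xi)).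
  by rewrite !(ReM, ImM) /=; ring.
have eI xi : complex.Im (w%:C * cis (y * xi) * f xi) =
    w * (cos (y * xi) * complex.Im (f xi) + sin (y * xi) * complex.Re (f xi)).
  by rewrite !(ReM, ImM) /=; ring.
have bd (a b u v : R) : `|a| <= 1 -> `|b| <= 1 -> `|u| <= M -> `|v| <= M ->
    `|a * u| + `|b * v| <= 1 * M + 1 * M.
  by move=> *; rewrite !normrM; apply: lerD; exact: ler_pM.
split.
- under eq_fun do rewrite eR.
  by apply: measurable_funM => //; apply: measurable_funB; exact: measurable_funM.
- under eq_fun do rewrite eI.
  by apply: measurable_funM => //; apply: measurable_funD; exact: measurable_funM.
- exists (w * (1 * M + 1 * M)) => xi; have [f1 f2] := fM xi.
  rewrite eR eI !normrM (ger0_norm w0); split; apply: ler_wpM2l => //.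
    by rewrite (le_trans (ler_normB _ _))// bd// ?cos_max ?sin_max.
  by rewrite (le_trans (ler_normD _ _))// bd// ?cos_max ?sin_max.
- move=> x d d0; rewrite (_ : Rintegral _ _ _ =
    \int[leb]_xi (w * (expabs d xi * complex.Re (f xi * cis ((x + y) * xi))))).
    rewrite RintegralZl//; first by rewrite mulr_ge0// fp.
    exact: integrable_positive_type.
  apply: eq_Rintegral => xi _; rewrite (mulrDl x) cisD.
  by rewrite !(ReM, ImM) /=; ring.
Qed.

Lemma positive_type_sum f n (w y : nat -> R) : (forall k, 0 <= w k) -> positive_type f ->
  positive_type (fun xi => (\sum_(k < n) (w k)%:C * cis (y k * xi)) * f xi).
Proof.
move=> w0 pf; elim: n => [|n IH].
  by under eq_fun do rewrite big_ord0 mul0r; exact: positive_type0.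
under eq_fun do rewrite big_ord_recr mulrDl.
by apply: positive_typeD => //; exact: positive_type_cis.
Qed.

Lemma positive_type_exp n (w y : nat -> R) k : (forall k, 0 <= w k) ->
  positive_type (fun xi => (\sum_(k < n) (w k)%:C * cis (y k * xi)) ^+ k).
Proof.
move=> w0; elim: k => [|k IH].
  by under eq_fun do rewrite expr0; exact: positive_type1.
by under eq_fun do rewrite exprS; exact: positive_type_sum.
Qed.

(** At fixed [d] the bound 1 and the weight [expabs d] allow dominated convergence. *)
Lemma positive_type_cvg (f_ : nat -> R -> R[i]) f :
  (forall n, positive_type (f_ n)) -> (forall n xi, `|f_ n xi| <= 1) ->
  (forall xi, complex.Re (f_ n xi) @[n --> \oo] --> complex.Re (f xi)) ->
  (forall xi, complex.Im (f_ n xi) @[n --> \oo] --> complex.Im (f xi)) ->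
  positive_type f.
Proof.
move=> pf f1 cR cI.
have b1 n xi := norm_parts_le1 (f1 n xi).
have le1 (u_ : nat -> R) u : (forall n, `|u_ n| <= 1) -> u_ n @[n --> \oo] --> u -> `|u| <= 1.
  move=> u1 cu; have cn : `|u_ n| @[n --> \oo] --> `|u| by apply: cvg_norm.
  rewrite -(cvg_lim _ cn)//.
  by apply: limr_le; [apply/cvg_ex; eexists; exact: cn|exact: nearW].
split.
- by apply: (measurable_fun_cvg (h := fun n xi => complex.Re (f_ n xi))) => [n|xi _]; [case: (pf n)|exact: cR].
- by apply: (measurable_fun_cvg (h := fun n xi => complex.Im (f_ n xi))) => [n|xi _]; [case: (pf n)|exact: cI].
- by exists 1 => xi; split; [apply: le1 (cR xi) => n; case: (b1 n xi)|apply: le1 (cI xi) => n; case: (b1 n xi)].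
- move=> x d d0; have [] := @Rdominated_cvg _ _ R leb
    (fun n xi => expabs d xi * complex.Re (f_ n xi * cis (x * xi)))
    (fun xi => expabs d xi * complex.Re (f xi * cis (x * xi))) (fun xi => 2 * expabs d xi).
  + move=> n; exact: measurable_of_integrable (integrable_positive_type x (pf n) d0).
  + move=> xi; apply: cvgM; first exact: cvg_cst.
    under eq_fun do rewrite ReM.
    by rewrite ReM; apply: cvgB; apply: cvgM => //; exact: cvg_cst.
  + exact: integrable_scale (integrable_expabs d0).
  + move=> n xi; rewrite normrM ger0_norm ?expabs_ge0// mulrC ler_wpM2r ?expabs_ge0//.
    by have [h1 h2] := b1 n xi; rewrite (le_trans (norm_Re_cis _ h1 h2)).
  move=> _ h; rewrite -(cvg_lim _ h)//; apply: limr_ge; first by apply/cvg_ex; eexists; exact: h.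
  by apply: nearW => n; have [_ _ _ p] := pf n; exact: p.
Qed.

End positive_definite.

Lemma cvg_near_eq {R : realType} (f g : nat -> R) (l : R) : f n @[n --> \oo] --> l ->
  (\forall n \near \oo, f n = g n) -> g n @[n --> \oo] --> l.
Proof. by move=> fl fg; apply: cvg_trans fl; exact: near_eq_cvg. Qed.

(** * Random walks converging to the stable law *)

Section stable_positivity.
Local Open Scope complex_scope.
Context {R : realType} (beta : R).
Local Notation leb := (@lebesgue_measure R).
Local Notation T := (measurableTypeR R).
Hypothesis b12 : 1 < beta < 2.

Let b0 : 0 < beta. Proof. by case/andP: b12 => b1 _; rewrite (lt_trans _ b1). Qed.

(** The coefficient of degree 1, divided by [beta], is [-1]. In [walk_char] it would sit at
    displacement 0; setting it to 0 amounts to adding the constant 1 to the symbol. *)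
Definition walk_weight (k : nat) : R := if k == 1 then 0 else beta^-1 * gbinom beta k.

Lemma walk_weight_ge0 k : 0 <= walk_weight k.
Proof.
case: k => [|[|k]]; rewrite /walk_weight//=; first by rewrite gbinom0 mulr1 invr_ge0 ltW.
by rewrite mulr_ge0 ?invr_ge0 ?gbinom_ge0// ltW.
Qed.

(** Characteristic function of a step of length [(1 - k) h] with weight [walk_weight k], truncated.
    As in the shifted Grünwald formula, moving the grid by one cell puts the negative coefficient on
    the diagonal. *)
Definition walk_char N h (xi : R) : R[i] :=
  \sum_(k < N.+2) (walk_weight k)%:C * cis (((1 - k%:R) * h) * xi).

Lemma sum_walk_weight N (F : nat -> R) : \sum_(k < N.+2) walk_weight k * F k =
  F 1 + beta^-1 * \sum_(k < N.+2) gbinom beta k * F k.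
Proof.
elim: N => [|N IH].
  rewrite !big_ord_recr !big_ord0/= /walk_weight/= gbinom0 gbinom1; field.
  by rewrite gt_eqF.
rewrite big_ord_recr IH [in RHS]big_ord_recr /walk_weight/=; ring.
Qed.

(** The weights are nonnegative, and by [sum_walk_weight] their sum differs from 1 by [beta^-1]
    times a partial sum of binomial coefficients, which is nonpositive. *)
Lemma norm_walk_char N h xi : `|walk_char N h xi| <= 1.
Proof.
rewrite (le_trans (ler_norm_sum _ _ _))//.
rewrite (_ : \sum_(i < _) _ = (\sum_(k < N.+2) walk_weight k)%:C); last first.
  rewrite rmorph_sum/=; apply: eq_bigr => k _.
  by rewrite normrM norm_cis mulr1 norm_realc// walk_weight_ge0.
rewrite -[1 in leRHS]/(1%:C) lecR.
have := sum_walk_weight N (fun=> 1).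
under eq_bigr do rewrite mulr1; under [in RHS]eq_bigr do rewrite mulr1.
move=> ->; rewrite gerDl pmulr_rle0 ?invr_gt0// -(pmulr_rle0 _ b0) sum_gbinom.
  exact: bdefectS_le0.
exact: b12.
Qed.

(** This is [1 + beta^-1 e^(i th)] times the sum of the series, the second factor acting on the
    oscillating term only; as [th] decreases to 0 it behaves like [1 + beta^-1 brho (i th)^beta]. *)
Definition walk_limit h (xi : R) : R[i] :=
  let th := h * xi in
  (1 + beta^-1 * (cos th * cpart beta th - sin th * spart beta th)) +i*
  (beta^-1 * (sin th * cpart beta th + cos th * spart beta th)).

Lemma Re_walk_char N h xi : let th := h * xi in complex.Re (walk_char N h xi) =
  1 + beta^-1 * (cos th * cseries beta N.+1 th - sin th * sseries beta N.+1 th).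
Proof.
move=> th; rewrite /walk_char (Re_sum _ (fun k => (walk_weight k)%:C * cis (((1 - k%:R) * h) * xi))).
rewrite (eq_bigr (fun k : 'I_N.+2 => walk_weight k * cos ((1 - k%:R) * th))); last first.
  by move=> k _; rewrite ReM /= mul0r subr0 mulrA.
rewrite (sum_walk_weight N (fun k => cos ((1 - k%:R) * th))) subrr mul0r cos0; congr (1 + _ * _).
rewrite /cseries /sseries mulrN opprK !mulr_sumr -big_split/=; apply: eq_bigr => k _.
by rewrite mulrBl mul1r cosB; ring.
Qed.

Lemma Im_walk_char N h xi : let th := h * xi in complex.Im (walk_char N h xi) =
  beta^-1 * (sin th * cseries beta N.+1 th + cos th * sseries beta N.+1 th).
Proof.
move=> th; rewrite /walk_char (Im_sum _ (fun k => (walk_weight k)%:C * cis (((1 - k%:R) * h) * xi))).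
rewrite (eq_bigr (fun k : 'I_N.+2 => walk_weight k * sin ((1 - k%:R) * th))); last first.
  by move=> k _; rewrite ImM /= mul0r addr0 mulrA.
rewrite (sum_walk_weight N (fun k => sin ((1 - k%:R) * th))) subrr mul0r sin0 add0r; congr (_ * _).
rewrite /cseries /sseries mulrN !mulr_sumr -sumrB; apply: eq_bigr => k _.
by rewrite mulrBl mul1r sinB; ring.
Qed.

Lemma cvg_walk_char h xi :
  (complex.Re (walk_char N h xi) @[N --> \oo] --> complex.Re (walk_limit h xi)) /\
  (complex.Im (walk_char N h xi) @[N --> \oo] --> complex.Im (walk_limit h xi)).
Proof.
have cc : cseries beta N.+1 (h * xi) @[N --> \oo] --> cpart beta (h * xi).
  by rewrite (cvg_shiftS (cseries beta ^~ (h * xi))); exact: cvg_cseries.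
have cs : sseries beta N.+1 (h * xi) @[N --> \oo] --> spart beta (h * xi).
  by rewrite (cvg_shiftS (sseries beta ^~ (h * xi))); exact: cvg_sseries.
split.
- under eq_fun do rewrite Re_walk_char.
  apply: cvgD; first exact: cvg_cst.
  by apply: cvgM; [exact: cvg_cst|apply: cvgB; apply: cvgM => //; exact: cvg_cst].
- under eq_fun do rewrite Im_walk_char.
  by apply: cvgM; [exact: cvg_cst|apply: cvgD; apply: cvgM => //; exact: cvg_cst].
Qed.

Lemma norm_walk_limit h xi : `|walk_limit h xi| <= 1.
Proof.
rewrite normc_le1; have [cR cI] := cvg_walk_char h xi.
have c : complex.Re (walk_char N h xi) ^+ 2 + complex.Im (walk_char N h xi) ^+ 2 @[N --> \oo] -->
    complex.Re (walk_limit h xi) ^+ 2 + complex.Im (walk_limit h xi) ^+ 2.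
  by apply: cvgD; apply: cvgM.
rewrite -(cvg_lim _ c)//; apply: limr_le; first by apply/cvg_ex; eexists; exact: c.
by apply: nearW => N; rewrite -normc_le1 norm_walk_char.
Qed.

Lemma positive_type_walk h n : positive_type (fun xi => walk_limit h xi ^+ n).
Proof.
apply: (positive_type_cvg (f_ := fun N xi => walk_char N h xi ^+ n)).
- by move=> N; exact: (@positive_type_exp R N.+2 walk_weight (fun k => (1 - k%:R) * h) n walk_weight_ge0).
- by move=> N xi; rewrite normrX exprn_ile1// norm_walk_char.
- by move=> xi; have [cR cI] := cvg_walk_char h xi; case: (cvg_complexX n cR cI).
- by move=> xi; have [cR cI] := cvg_walk_char h xi; case: (cvg_complexX n cR cI).
Qed.

Lemma walk_limitN h xi : walk_limit h (- xi) = (walk_limit h xi)^*.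
Proof.
rewrite /walk_limit /= mulrN cosN sinN cpartN spartN//.
by congr (_ +i* _); ring.
Qed.

Lemma walk_limit0 h : walk_limit h 0 = 1.
Proof.
by rewrite /walk_limit /= mulr0 cpart0// spart0// !(mulr0, subrr, addr0).
Qed.

Definition damping (p q : R) : R[i] := (expR (- p))%:C * cis q.

Lemma dampingX p q n : damping p q ^+ n = damping (n%:R * p) (n%:R * q).
Proof.
elim: n => [|n IH].
  by rewrite expr0 /damping !mul0r oppr0 expR0 /cis cos0 sin0 mul1r.
rewrite exprS IH /damping -!natr1 !mulrDl !mul1r opprD expRD cisD rmorphM.
by rewrite mulrACA; congr (_ * _); exact: mulrC.
Qed.

Lemma norm_damping p q : 0 <= p -> `|damping p q| <= 1.
Proof.
move=> p0; rewrite normrM norm_cis mulr1 norm_realc ?expR_ge0//.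
by rewrite -[1 in leRHS]/(1%:C) lecR -expR0 ler_expR oppr_le0.
Qed.

Lemma cvg_diff_quotient (g h_ : nat -> R) (G : R -> R) (dG : R) : is_derive (0 : R) 1 G dG ->
  h_ n @[n --> \oo] --> 0 -> (forall n, h_ n != 0) ->
  (h_ n)^-1 * (G (h_ n) - G 0) @[n --> \oo] --> dG.
Proof.
move=> [dG1 dG2] h0 hn0.
have h0' : h_ n @[n --> \oo] --> 0^'.
  move=> S; rewrite /dnbhs /within/= => /h0; rewrite /nbhs/=; apply: filterS => n /=.
  exact.
have c : (fun h => h^-1 *: (G (h *: 1 + 0) - G 0)) @ 0^' --> dG.
  by rewrite -dG2; exact: dG1.
have := cvg_comp _ _ h0' c; apply: cvg_trans; apply: near_eq_cvg; apply: nearW => n /=.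
by rewrite /GRing.scale /= mulr1 addr0.
Qed.

Variables (s : R).
Hypothesis s0 : 0 < s.

Let A := - cos (beta * pi / 2).
Let B := sin (beta * pi / 2).

(** The mesh [h] with [(n + 1) beta^-1 brho h^beta = s], for which [n + 1] steps of the walk make up
    the time [s]. *)
Definition walk_step (n : nat) : R := (s * beta / (n.+1%:R * brho beta)) `^ beta^-1.

Lemma walk_step_gt0 n : 0 < walk_step n.
Proof. rewrite powR_gt0//; apply: divr_gt0; first exact: mulr_gt0.
exact: mulr_gt0 (ltr0Sn _ _) (brho_gt0 b12). Qed.

Lemma walk_stepX n : n.+1%:R * beta^-1 * brho beta * walk_step n `^ beta = s.
Proof.
have r0 := brho_gt0 b12.
rewrite -powRrM mulVf ?gt_eqF// powRr1; last by rewrite divr_ge0// mulr_ge0// ltW.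
by field; rewrite !gt_eqF.
Qed.

Lemma cvg_walk_step : walk_step n @[n --> \oo] --> 0.
Proof.
have r0 := brho_gt0 b12; have bi : 0 < beta^-1 by rewrite invr_gt0.
rewrite (_ : walk_step = fun n => (s * beta / brho beta) `^ beta^-1 * npow beta^-1 (harmonic n)); last first.
  apply/funext => n; rewrite /npow ger0_norm ?harmonic_ge0// -powRM ?harmonic_ge0//.
    by congr (_ `^ _); rewrite /= invfM; ring.
  by rewrite divr_ge0 ?(ltW r0)// mulr_ge0// ltW.
rewrite -[X in _ --> X](mulr0 ((s * beta / brho beta) `^ beta^-1)).
apply: cvgM; first exact: cvg_cst.
rewrite -(npow0 bi); apply: continuous_cvg; [exact: continuous_npow|exact: cvg_harmonic].
Qed.

Lemma cvg_walk_angle (xi : R) : 0 < xi -> \forall n \near \oo, 0 < walk_step n * xi <= pi.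
Proof.
move=> x0; have h : walk_step n * xi @[n --> \oo] --> 0 * xi.
  by apply: cvgM; [exact: cvg_walk_step|exact: cvg_cst].
rewrite mul0r in h; have /cvgr_lt h' := h.
near=> n; rewrite mulr_gt0 ?walk_step_gt0//= ltW//; near: n; apply: h'; exact: pi_gt0.
Unshelve. all: end_near. Qed.

(** With [h] the mesh, [chord (h xi) / h] tends to [xi]; by the choice of [h], [s] times its power
    [beta] is the left-hand side. *)
Lemma cvg_walk_amplitude (xi : R) : 0 < xi ->
  n.+1%:R * (beta^-1 * brho beta * chord (walk_step n * xi) `^ beta) @[n --> \oo] -->
  s * npow beta xi.
Proof.
move=> x0; have q : (walk_step n)^-1 * (chord (walk_step n * xi) - chord (0 * xi)) @[n --> \oo] --> xi.
  have d : is_derive (0 : R) 1 (fun h : R => chord (h * xi)) xi.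
    have dl : is_derive (0 : R) 1 (fun h : R => h * xi) xi.
      by apply: (der_eq (der_mul (der_id 0) (der_cst xi 0))); ring.
    apply: (der_eq (der_comp (f := @chord R) (g := fun h : R => h * xi) (der_chord (0 * xi)) dl)).
    by rewrite !mul0r cos0 mul1r.
  apply: (cvg_diff_quotient (fun=> 0) d cvg_walk_step) => n.
  by rewrite gt_eqF// walk_step_gt0.
have c0 : chord 0 = 0 :> R by rewrite /chord mul0r sin0 mulr0.
rewrite mul0r c0 in q.
have qb : npow beta ((walk_step n)^-1 * (chord (walk_step n * xi) - 0)) @[n --> \oo] --> npow beta xi.
  by apply: continuous_cvg => //; exact: continuous_npow.
apply: (cvg_near_eq (cvgM (cvg_cst s) qb)); near=> n; have th : 0 < walk_step n * xi <= pi by near: n; exact: cvg_walk_angle.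
have ch := chord_gt0 th; have hn := walk_step_gt0 n.
rewrite /= subr0 /npow ger0_norm; last by rewrite mulr_ge0 ?invr_ge0 ?ltW.
rewrite powRM ?invr_ge0 ?ltW// -{1}(walk_stepX n).
have -> : (walk_step n)^-1 `^ beta = (walk_step n `^ beta)^-1.
  by rewrite -powR_inv1 ?ltW// -powRrM mulN1r powRN.
have : walk_step n `^ beta != 0 by rewrite gt_eqF// powR_gt0.
set z := walk_step n `^ beta => z0; field.
by rewrite z0 gt_eqF.
Unshelve. all: end_near. Qed.

Lemma cvg_walk_phase (xi : R) : walk_step n * xi + tilt beta (walk_step n * xi) @[n --> \oo] -->
  beta * pi / 2.
Proof.
have h : walk_step n * xi @[n --> \oo] --> 0.
  by rewrite -(mul0r xi); apply: cvgM; [exact: cvg_walk_step|exact: cvg_cst].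
rewrite [X in _ --> X](_ : _ = 0 + beta * (pi - 0) / 2); last by rewrite subr0 add0r.
apply: cvgD => //; apply: cvgM; last exact: cvg_cst.
by apply: cvgM; [exact: cvg_cst|apply: cvgB => //; exact: cvg_cst].
Qed.

Lemma cvg_scaled_walk (xi : R) : 0 < xi ->
  (n.+1%:R * (complex.Re (walk_limit (walk_step n) xi) - 1) @[n --> \oo] -->
     s * npow beta xi * cos (beta * pi / 2)) /\
  (n.+1%:R * complex.Im (walk_limit (walk_step n) xi) @[n --> \oo] -->
     s * npow beta xi * sin (beta * pi / 2)).
Proof.
move=> x0; have ph := cvg_walk_phase xi; have am := cvg_walk_amplitude x0.
split.
- have c : cos (walk_step n * xi + tilt beta (walk_step n * xi)) @[n --> \oo] --> cos (beta * pi / 2).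
    by apply: continuous_cvg => //; exact: continuous_cos.
  apply: (cvg_near_eq (cvgM am c)); near=> n.
  have th : 0 < walk_step n * xi <= pi by near: n; exact: cvg_walk_angle.
  rewrite /walk_limit /= cpartE// spartE// cosD; ring.
- have c : sin (walk_step n * xi + tilt beta (walk_step n * xi)) @[n --> \oo] --> sin (beta * pi / 2).
    by apply: continuous_cvg => //; exact: continuous_sin.
  apply: (cvg_near_eq (cvgM am c)); near=> n.
  have th : 0 < walk_step n * xi <= pi by near: n; exact: cvg_walk_angle.
  rewrite /walk_limit /= cpartE// spartE// sinD; ring.
Unshelve. all: end_near. Qed.

Lemma cvg_scaled_damping (p q : R) :
  (n.+1%:R * (complex.Re (damping (p / n.+1%:R) (q / n.+1%:R)) - 1) @[n --> \oo] --> - p) /\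
  (n.+1%:R * complex.Im (damping (p / n.+1%:R) (q / n.+1%:R)) @[n --> \oo] --> q).
Proof.
have hn n : harmonic n != 0 :> R by rewrite gt_eqF// harmonic_gt0.
have de := der_exp (der_scale (- p) (der_id (0 : R))).
have dq := der_scale q (der_id (0 : R)).
split.
- have d : is_derive (0 : R) 1 (fun u : R => expR (- p * u) * cos (q * u)) (- p).
    by apply: (der_eq (der_mul de (der_cos dq))); rewrite !mulr0 expR0 cos0 sin0; ring.
  have := cvg_diff_quotient (fun=> 0) d cvg_harmonic hn; apply: cvg_trans.
  apply: near_eq_cvg; apply: nearW => n.
  by rewrite !mulr0 expR0 cos0 mulr1 ReM /= mul0r subr0 invrK mulNr.
- have d : is_derive (0 : R) 1 (fun u : R => expR (- p * u) * sin (q * u)) q.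
    by apply: (der_eq (der_mul de (der_sin dq))); rewrite !mulr0 expR0 cos0 sin0; ring.
  have := cvg_diff_quotient (fun=> 0) d cvg_harmonic hn; apply: cvg_trans.
  apply: near_eq_cvg; apply: nearW => n.
  by rewrite !mulr0 sin0 mulr0 subr0 ImM /= mul0r addr0 invrK mulNr.
Qed.

Definition stable_char (xi : R) : R[i] :=
  damping (A * s * npow beta xi) (B * s * spow beta xi).

Hypothesis A0 : 0 < A.

(** [b n] is a root of order [n + 1] of [stable_char xi], and [a n] is one step of the walk. Both
    are [1 + z / (n + 1)] to first order with the same [z], so [(n + 1) (a n - b n)] tends to 0, and
    [norm_subX_le] carries this over to the powers. *)
Lemma cvg_walk_gt0 (xi : R) : 0 < xi ->
  (complex.Re (walk_limit (walk_step n) xi ^+ n.+1) @[n --> \oo] --> complex.Re (stable_char xi)) /\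
  (complex.Im (walk_limit (walk_step n) xi ^+ n.+1) @[n --> \oo] --> complex.Im (stable_char xi)).
Proof.
move=> x0; pose p := A * s * npow beta xi; pose q := B * s * spow beta xi.
have [aR aI] := cvg_scaled_walk x0; have [dR dI] := cvg_scaled_damping p q.
pose a n := walk_limit (walk_step n) xi; pose b n := damping (p / n.+1%:R) (q / n.+1%:R).
have bX n : b n ^+ n.+1 = stable_char xi.
  by rewrite dampingX; congr damping; rewrite mulrCA mulfV ?mulr1// pnatr_eq0.
have p0 n : 0 <= p / n.+1%:R by rewrite divr_ge0// mulr_ge0 ?npow_ge0// ltW// mulr_gt0.
pose err n := `|n.+1%:R * complex.Re (a n - b n)| + `|n.+1%:R * complex.Im (a n - b n)|.
have err0 : err n @[n --> \oo] --> 0.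
  rewrite -(addr0 0) -(@normr0 _ R); apply: cvgD; apply: cvg_norm.
    rewrite (_ : 0 = s * npow beta xi * cos (beta * pi / 2) - - p); last by rewrite /p /A; ring.
    apply: (cvg_near_eq (cvgB aR dR)); apply: nearW => n.
    rewrite -[LHS]/(n.+1%:R * (complex.Re (a n) - 1) - n.+1%:R * (complex.Re (b n) - 1)).
    by rewrite ReD ReN; ring.
  rewrite (_ : 0 = s * npow beta xi * sin (beta * pi / 2) - q); last first.
    by rewrite /q /B /spow gtr0_sg// mul1r -/(npow _ _); ring.
  apply: (cvg_near_eq (cvgB aI dI)); apply: nearW => n.
  rewrite -[LHS]/(n.+1%:R * complex.Im (a n) - n.+1%:R * complex.Im (b n)).
  by rewrite ImD ImN; ring.
have errb n : `|a n ^+ n.+1 - stable_char xi| <= (err n)%:C.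
  rewrite -(bX n) (le_trans (norm_subX_le _ _ _)) ?norm_walk_limit ?norm_damping//.
  rewrite /err !normrM -mulrDr (ger0_norm (ler0n _ _)).
  rewrite rmorphM /= rmorph_nat; apply: ler_wpM2l => //; exact: normc_le_parts.
split.
- apply/subr_cvg0; apply: norm_cvg0; apply: (squeeze_cvgr (f := fun=> 0) (h := err)) => //.
    apply: nearW => n; rewrite normr_ge0 -lecR (le_trans _ (errb n))//.
    by rewrite -raddfB; exact: normc_ge_Re.
  exact: cvg_cst.
- apply/subr_cvg0; apply: norm_cvg0; apply: (squeeze_cvgr (f := fun=> 0) (h := err)) => //.
    apply: nearW => n; rewrite normr_ge0 -lecR (le_trans _ (errb n))//.
    by rewrite -raddfB; exact: normc_ge_Im.
  exact: cvg_cst.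
Qed.

Lemma stable_charN (xi : R) : stable_char (- xi) = (stable_char xi)^*.
Proof.
by rewrite /stable_char npowN spowN mulrN /damping /cis cosN sinN; simpc.
Qed.

(** Negative frequencies follow by conjugation, and at frequency 0 both sides are 1. *)
Lemma cvg_walk (xi : R) :
  (complex.Re (walk_limit (walk_step n) xi ^+ n.+1) @[n --> \oo] --> complex.Re (stable_char xi)) /\
  (complex.Im (walk_limit (walk_step n) xi ^+ n.+1) @[n --> \oo] --> complex.Im (stable_char xi)).
Proof.
case: (ltrgt0P xi) => [|x0|->]; first exact: cvg_walk_gt0.
- have x0' : 0 < - xi by rewrite oppr_gt0.
  have [cR cI] := cvg_walk_gt0 x0'.
  have e n : walk_limit (walk_step n) xi ^+ n.+1 = (walk_limit (walk_step n) (- xi) ^+ n.+1)^*.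
    by rewrite walk_limitN -rmorphXn; apply/esym; exact: conjcK.
  have ReJ (z : R[i]) : complex.Re z^* = complex.Re z by case: z.
  have ImJ (z : R[i]) : complex.Im z^* = - complex.Im z by case: z.
  split; under eq_fun do rewrite e.
    by under eq_fun do rewrite ReJ; rewrite -(opprK xi) stable_charN ReJ opprK.
  under eq_fun do rewrite ImJ; rewrite -(opprK xi) stable_charN ImJ.
  by rewrite opprK; exact: cvgN.
- have e n : walk_limit (walk_step n) 0 ^+ n.+1 = stable_char 0.
    rewrite walk_limit0 expr1n /stable_char npow0// /spow sgr0 mul0r !mulr0.
    by rewrite /damping oppr0 expR0 /cis cos0 sin0; simpc.
  by split; under eq_fun do rewrite e; exact: cvg_cst.
Qed.

Lemma positive_type_stable_char : positive_type stable_char.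
Proof.
apply: (positive_type_cvg (f_ := fun n xi => walk_limit (walk_step n) xi ^+ n.+1)).
- by move=> n; exact: positive_type_walk.
- by move=> n xi; rewrite normrX exprn_ile1// norm_walk_limit.
- by move=> xi; case: (cvg_walk xi).
- by move=> xi; case: (cvg_walk xi).
Qed.

(** Positivity holds for the integral damped by [expabs (harmonic n)], and the damping tends to
    1. *)
Lemma stable_ge0 x : 0 <= stable beta A B s x.
Proof.
have b1 : 1 < beta by case/andP: b12.
rewrite mulr_ge0 ?invr_ge0 ?mulr_ge0 ?pi_ge0//.
have mx : measurable_fun [set: T] (fun xi : T => x * xi).
  by apply: measurable_funM => //; exact: measurable_cst.
have io := integrable_osc B b1 A0 s0 mx.
have e xi : complex.Re (stable_char xi * cis (x * xi)) = osc beta A B s (x * xi) xi.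
  rewrite /stable_char /damping !(ReM, ImM) /= /osc cosD.
  rewrite (_ : - (A * s * npow beta xi) = - (A * s) * npow beta xi); last by ring.
  by ring.
have [] := @Rdominated_cvg _ _ R leb
  (fun n xi => expabs (harmonic n) xi * osc beta A B s (x * xi) xi)
  (fun xi => osc beta A B s (x * xi) xi) (fun xi => `|osc beta A B s (x * xi) xi|).
- move=> n; apply: measurable_funM; last exact: measurable_of_integrable io.
  by apply: continuous_measurable_fun; exact: continuous_expabs.
- move=> xi; rewrite -[X in _ --> X]mul1r; apply: cvgM; last exact: cvg_cst.
  rewrite -expR0 -(mul0r `|xi|) -oppr0; apply: continuous_cvg; first exact: continuous_expR.
  by apply: cvgM; [apply: cvgN; exact: cvg_harmonic|exact: cvg_cst].
- exact: integrable_norm io.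
- move=> n xi; rewrite normrM (ger0_norm (expabs_ge0 _ _)).
  by rewrite ler_piMl// -expR0 ler_expR mulNr oppr_le0 mulr_ge0 ?harmonic_ge0.
move=> _ h; rewrite -(cvg_lim _ h)//; apply: limr_ge; first by apply/cvg_ex; eexists; exact: h.
apply: nearW => n; have [_ _ _ pos] := positive_type_stable_char.
have := pos x _ (harmonic_gt0 n); congr (_ <= _).
by apply: eq_Rintegral => xi _; rewrite e.
Qed.

End stable_positivity.

(** * The derivative of the stable kernel *)

Section real_derivatives.
Context {R : realType}.
Local Notation leb := (@lebesgue_measure R).
Local Notation T := (measurableTypeR R).

Lemma der_Rintegral (f df : R -> T -> R) (G : T -> R) (a : R) :
  (forall (x : R) (y : T), is_derive x 1 (f ^~ y : R -> R) (df x y)) ->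
  (forall x, leb.-integrable [set: T] (EFin \o f x)) ->
  leb.-integrable [set: T] (EFin \o G) -> (forall x y, `|df x y| <= G y) ->
  is_derive a 1 (fun x => \int[leb]_y f x y) (\int[leb]_y df a y).
Proof.
move=> dfE intf intG dfG.
have Ia : `]a - 1, a + 1[%classic a by rewrite /= in_itv/=; apply/andP; split; lra.
have G0 y : 0 <= G y by exact: le_trans (dfG a y).
have pE x y : partial1of2 f x y = df x y by rewrite partial1of2E; case: (dfE x y).
have dF x y : `]a - 1, a + 1[%classic x -> [set: T] y -> derivable (f ^~ y) x 1.
  by move=> _ _; case: (dfE x y).
have Gb x y : `]a - 1, a + 1[%classic x -> [set: T] y -> `|partial1of2 f x y| <= G y.
  by move=> _ _; rewrite pE.
have h1 := derivable_under_integral measurableT Ia (fun x _ => intf x) dF G0 intG Gb.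
have h2 := differentiation_under_integral measurableT Ia (fun x _ => intf x) dF G0 intG Gb.
split; first exact: h1.
by rewrite -derive1E h2; apply: eq_Rintegral => y _; rewrite pE.
Qed.

Lemma cvg_expabs_nat (d : R) : 0 < d -> expabs d n%:R @[n --> \oo] --> 0.
Proof.
move=> d0; have h : expR (- x) @[x --> +oo] --> (0 : R) := @cvgr_expR R.
have c : d * n%:R @[n --> \oo] --> +oo.
  apply/cvgryPge => C; near=> n; rewrite -ler_pdivrMl//.
  by near: n; exact: nbhs_infty_ger.
have := cvg_comp _ _ c h; apply: cvg_trans; apply: near_eq_cvg; apply: nearW => n.
by rewrite /= /expabs ger0_norm// mulNr.
Unshelve. all: end_near. Qed.

(** Fundamental theorem on [[- (n + 1), n + 1]], where the boundary terms vanish in the limit. *)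
Lemma Rintegral_derive0 (H dH : T -> R) (K d : R) : 0 < d ->
  (forall x : R, is_derive x 1 (H : R -> R) (dH x)) -> continuous (dH : R -> R) ->
  leb.-integrable [set: T] (EFin \o dH) -> (forall x, `|H x| <= K * expabs d x) ->
  \int[leb]_x dH x = 0.
Proof.
move=> d0 HdH cdH idH HK.
have mdH := measurable_of_integrable idH.
pose D n := [set` `[- n.+1%:R, n.+1%:R]] : set T.
have mD n : measurable (D n) by exact: measurable_itv.
have FTC n : \int[leb]_x (dH \_ (D n)) x = H n.+1%:R - H (- n.+1%:R).
  rewrite /Rintegral; have -> : (\int[leb]_x ((dH \_ (D n)) x)%:E = \int[leb]_(x in D n) (dH x)%:E)%E.
    by rewrite [RHS]integral_mkcond; apply: eq_integral => x _; rewrite /patch; case: ifP.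
  rewrite (@continuous_FTC2 _ dH H)//.
  - by have := ltr0Sn R n; lra.
  - exact: continuous_subspaceT.
  - split.
    + by move=> x _; case: (HdH x).
    + by apply: cvg_at_right_filter; exact: der_continuous (HdH _).
    + by apply: cvg_at_left_filter; exact: der_continuous (HdH _).
  - by move=> x _; rewrite derive1E; case: (HdH x).
have [] := @Rdominated_cvg _ _ R leb (fun n => dH \_ (D n)) dH (fun x => `|dH x|).
- by move=> n; apply/(measurable_restrictT _ (mD n)); exact: measurable_funTS.
- move=> x; apply: (cvg_near_eq (f := fun=> dH x)); first exact: cvg_cst.
  near=> n; have Dx : D n x.
    rewrite /D/= in_itv/= -ler_norml; apply: (@le_trans _ _ n%:R); last by rewrite ler_nat.
    by near: n; exact: nbhs_infty_ger.
  by rewrite /patch mem_set.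
- exact: integrable_norm idH.
- by move=> n x; rewrite /patch; case: ifP => // _; rewrite normr0.
move=> _ h; rewrite -(cvg_lim _ h)//; apply: cvg_lim => //.
under eq_fun do rewrite FTC.
have hK (s : nat -> R) : (forall n, `|s n| = n.+1%:R) -> H (s n) @[n --> \oo] --> 0.
  move=> sn; apply: norm_cvg0; apply: (squeeze_cvgr (f := fun=> 0) (h := fun n => K * expabs d n.+1%:R)).
  - apply: nearW => n; rewrite normr_ge0 (le_trans (HK _))//.
    by rewrite /expabs sn (ger0_norm (ler0n _ _)).
  - exact: cvg_cst.
  - rewrite -[X in _ --> X](mulr0 K); apply: cvgM; first exact: cvg_cst.
    by rewrite (cvg_shiftS (fun n => expabs d n%:R)); exact: cvg_expabs_nat.
have : H n.+1%:R - H (- n.+1%:R) @[n --> \oo] --> 0 - 0.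
  by apply: cvgB; apply: hK => n; rewrite ?normrN ger0_norm.
by rewrite subr0.
Unshelve. all: end_near. Qed.

End real_derivatives.

Section stable_derivative.
Context {R : realType} (beta A B : R).
Local Notation leb := (@lebesgue_measure R).
Local Notation T := (measurableTypeR R).
Hypotheses (b1 : 1 < beta) (A0 : 0 < A).

Let b0 : 0 < beta. Proof. exact: lt_trans b1. Qed.
Let b10 : 0 < beta - 1. Proof. by rewrite subr_gt0. Qed.
Let b20 : 0 < 2 * beta - 1. Proof. have := b1; lra. Qed.

(** Raise [y <= e^y], at [y = c |x| / b], to the power [b]. *)
Lemma npow_le_exp (b c x : R) : 0 < b -> 0 < c ->
  npow b x <= (b / c) `^ b * expR (c * `|x|).
Proof.
move=> hb hc; have bc : 0 < b / c by rewrite divr_gt0.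
have h : `|x| <= b / c * expR (c * `|x| / b).
  rewrite -ler_pdivrMl// invf_div mulrAC (le_trans _ (expR_ge1Dx _))//; lra.
apply: le_trans (ge0_ler_powR (ltW hb) _ _ h) _; rewrite ?nnegrE//.
  exact: mulr_ge0 (ltW bc) (expR_ge0 _).
rewrite powRM ?expR_ge0 ?(ltW bc)// -expRM; rewrite le_eqVlt; apply/orP; left; apply/eqP.
by congr (_ * expR _); rewrite divfK// gt_eqF.
Qed.

Let m (xi : R) := expR (- A * npow beta xi).

(** Half of the exponential rate [A] absorbs the power. *)
Lemma damped_npow_le (b : R) : 0 < b -> exists C, forall xi,
  m xi * npow b xi <= C * expabs (A / 2) xi.
Proof.
move=> hb; have A2 : 0 < A / 2 by rewrite divr_gt0.
exists (expR A * (b / (A / 2)) `^ b) => xi.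
have h1 : m xi <= expR A * expabs A xi.
  by have := multiplier_le b1 A0 xi (ltr01 : 0 < 1 :> R); rewrite mulr1.
have h2 := npow_le_exp xi hb A2.
apply: le_trans (ler_pM (expR_ge0 _) (npow_ge0 _ _) h1 h2) _.
rewrite le_eqVlt; apply/orP; left; apply/eqP.
have -> : expabs (A / 2) xi = expabs A xi * expR (A / 2 * `|xi|).
  by rewrite /expabs -expRD; congr expR; field.
ring.
Qed.

Lemma damped_le : exists C, forall xi, m xi <= C * expabs (A / 2) xi.
Proof.
exists (expR A) => xi; have := multiplier_le b1 A0 xi (ltr01 : 0 < 1 :> R).
rewrite mulr1 => /le_trans; apply; rewrite ler_wpM2l ?expR_ge0// ler_expR -subr_ge0.
by rewrite (_ : _ - _ = A / 2 * `|xi|); [rewrite mulr_ge0// ltW// divr_gt0|field].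
Qed.

(** The x-derivative of the kernel at time 1, differentiated under the integral; the phase
    [- pi / 2] turns the cosine of [osc] into a sine. *)
Definition dstable (x : R) := - (2 * pi)^-1 * \int[leb]_xi (xi * osc beta A B 1 (x * xi - pi / 2) xi).

Lemma measurable_dstable : measurable_fun [set: T] dstable.
Proof.
apply: measurable_funM; first exact: measurable_cst.
have mF : measurable_fun [set: T * T] (fun z : T * T => z.2 * osc beta A B 1 (z.1 * z.2 - pi / 2) z.2).
  have m1 := @measurable_fst _ _ T T; have m2 := @measurable_snd _ _ T T.
  apply: measurable_funM => //; apply: measurable_osc => //.
  by apply: measurable_funB; [exact: measurable_funM|exact: measurable_cst].
exact: (@measurable_Rintegral_param _ _ T T R leb _ mF).
Qed.

Lemma integrable_damped_npow b : 0 < b -> leb.-integrable [set: T] (fun xi => (m xi * npow b xi)%:E).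
Proof.
move=> hb; have A2 : 0 < A / 2 by rewrite divr_gt0.
have [C hC] := damped_npow_le hb.
have := integrable_scale C (integrable_expabs A2); apply: le_integrable => //.
  apply/measurable_EFinP; apply: continuous_measurable_fun => xi; apply: cvgM; last exact: continuous_npow.
  apply: (continuous_comp (f := fun xi : R => - A * npow beta xi)); last exact: continuous_expR.
  by apply: cvgM; [exact: cvg_cst|exact: continuous_npow].
move=> xi _; rewrite lee_fin ger0_norm; last by rewrite mulr_ge0 ?expR_ge0 ?npow_ge0.
by rewrite (le_trans (hC xi))// ler_norm.
Qed.

Lemma oscE x xi : osc beta A B 1 (x * xi) xi = m xi * cos (B * spow beta xi + x * xi).
Proof. by rewrite /osc !mulr1. Qed.

Lemma osc_shiftE x xi :
  osc beta A B 1 (x * xi - pi / 2) xi = m xi * sin (B * spow beta xi + x * xi).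
Proof. by rewrite /osc !mulr1 addrA cosBpihalf. Qed.

Lemma npow1 (xi : R) : npow 1 xi = `|xi|.
Proof. by rewrite /npow powRr1. Qed.

Lemma norm_osc_shift_le x xi : `|xi * osc beta A B 1 (x * xi - pi / 2) xi| <= m xi * npow 1 xi.
Proof.
rewrite osc_shiftE npow1 !normrM (ger0_norm (expR_ge0 _)) mulrC -mulrA ler_wpM2l ?expR_ge0//.
by rewrite ler_piMl// sin_max.
Qed.

Lemma der_stable (x : R) : is_derive x 1 (stable beta A B 1) (dstable x).
Proof.
have mx (y : R) : measurable_fun [set: T] (fun xi : T => y * xi).
  by apply: measurable_funM => //; exact: measurable_cst.
have h := @der_Rintegral R (fun x xi => osc beta A B 1 (x * xi) xi)
  (fun x xi => - (xi * osc beta A B 1 (x * xi - pi / 2) xi)) (fun xi => m xi * npow 1 xi) x.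
apply: (der_eq (der_scale ((2 * pi)^-1) (h _ _ _ _))).
- move=> y xi.
  have -> : (fun y => osc beta A B 1 (y * xi) xi) = fun y => m xi * cos (B * spow beta xi + y * xi).
    by apply/funext => z; rewrite oscE.
  have d := der_add (der_cst (B * spow beta xi) y) (der_mul (der_id y) (der_cst xi y)).
  by apply: (der_eq (der_scale (m xi) (der_cos d))); rewrite osc_shiftE; ring.
- by move=> y; apply: integrable_osc => //; exact: ltr01.
- exact: integrable_damped_npow.
- by move=> y xi; rewrite normrN; exact: norm_osc_shift_le.
- rewrite /dstable mulNr -mulrN; congr (_ * _).
  rewrite -mulN1r -RintegralZl//; first by apply: eq_Rintegral => xi _; rewrite mulN1r.
  have := integrable_damped_npow (ltr01 : 0 < 1 :> R); apply: le_integrable => //.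
    apply/measurable_EFinP; apply: measurable_funM => //; apply: measurable_osc => //.
    by apply: measurable_funB; [exact: mx|exact: measurable_cst].
  move=> xi _; rewrite lee_fin (le_trans (norm_osc_shift_le _ _))// ler_norm//.
Qed.

Let cosp x xi := cos (B * spow beta xi + x * xi).
Let sinp x xi := sin (B * spow beta xi + x * xi).
Let Sd xi := spow (beta - 1) xi.
Let Nd xi := npow (beta - 1) xi.
Let aa xi := - (A * beta * npow beta xi).
Let bb xi := B * beta * spow beta xi.
Let PP xi := A * beta * Sd xi.
Let QQ xi := B * beta * Nd xi.

(* With [F = xi exp(psi)], [psi] the exponent, this is the imaginary part of [F'' e^(i x xi)], and
   [decay_primitive] that of [(F' - i x F) e^(i x xi)], whose derivative is [(F'' + x^2 F) e^(i x xi)]. *)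
Definition decay_remainder x xi := m xi *
  ((- (A * beta * (beta * Sd xi)) - (1 + aa xi) * PP xi - bb xi * QQ xi) * sinp x xi +
   ((1 + aa xi) * QQ xi + B * beta * (beta * Nd xi) - bb xi * PP xi) * cosp x xi).

Definition decay_primitive x xi := m xi *
  ((1 + aa xi) * sinp x xi + (bb xi - x * xi) * cosp x xi).

Lemma der_decay_primitive (x xi : R) : is_derive xi 1 (decay_primitive x)
  (x ^+ 2 * (xi * (m xi * sinp x xi)) + decay_remainder x xi).
Proof.
have dN := der_npow xi b1; have dS := der_spow xi b1.
have dm := der_exp (der_scale (- A) dN).
have dph := der_add (der_scale B dS) (der_scale x (der_id xi)).
have da := der_add (der_cst 1 xi) (der_opp (der_scale (A * beta) dN)).
have db := der_sub (der_scale (B * beta) dS) (der_scale x (der_id xi)).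
apply: (der_eq (der_mul dm (der_add (der_mul da (der_sin dph)) (der_mul db (der_cos dph))))).
rewrite /decay_remainder -/(m xi) -/(sinp x xi) -/(cosp x xi) /aa /bb /PP /QQ -/(Sd xi) -/(Nd xi).
(* Writing the powers of order [beta] as [xi] times powers of order [beta - 1] leaves a polynomial
   identity. *)
rewrite -(mul_spow xi b0) -/(Sd xi) -(mul_npow xi b0) -/(Nd xi).
by move: (m xi) (sinp x xi) (cosp x xi) (Sd xi) (Nd xi) => u v w p q; ring.
Qed.

Let kap := A * beta + `|B| * beta.

(** Two derivatives of [xi exp(psi)] produce the factor [2 psi' + xi psi'' + xi psi'^2], of orders
    [beta - 1] and [2 beta - 1]. Both are positive, so the bound is integrable; it does not depend
    on [x]. *)
Lemma norm_decay_remainder x xi : `|decay_remainder x xi| <=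
  kap * (beta + 1) * (m xi * npow (beta - 1) xi) + kap ^+ 2 * (m xi * npow (2 * beta - 1) xi).
Proof.
have eN : npow (2 * beta - 1) xi = npow beta xi * Nd xi.
  rewrite /Nd /npow -powRD; first by congr (_ `^ _); ring.
  by rewrite gt_eqF// addr_gt0.
have nA : `|A| = A by rewrite gtr0_norm.
have nb : `|beta| = beta by rewrite gtr0_norm.
have na : `|aa xi| = A * beta * npow beta xi.
  by rewrite normrN (normrM (A * beta)) (normrM A) nA nb (ger0_norm (npow_ge0 _ _)).
have nbb : `|bb xi| = `|B| * beta * npow beta xi.
  by rewrite /bb (normrM (B * beta)) (normrM B) nb norm_spow.
have nP : `|PP xi| = A * beta * Nd xi.
  by rewrite /PP /Sd (normrM (A * beta)) (normrM A) nA nb norm_spow.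
have nQ : `|QQ xi| = `|B| * beta * Nd xi.
  by rewrite /QQ (normrM (B * beta)) (normrM B) nb (ger0_norm (npow_ge0 _ _)).
have na' : `|A * beta * (beta * Sd xi)| = A * beta * (beta * Nd xi).
  by rewrite /Sd (normrM (A * beta)) (normrM A) (normrM beta) nA nb norm_spow.
have nb' : `|B * beta * (beta * Nd xi)| = `|B| * beta * (beta * Nd xi).
  by rewrite (normrM (B * beta)) (normrM B) (normrM beta) nb (ger0_norm (npow_ge0 _ _)).
have n1a : `|1 + aa xi| <= 1 + A * beta * npow beta xi by rewrite -na (le_trans (ler_normD _ _))// normr1.
have N0 : 0 <= npow beta xi by exact: npow_ge0.
have N0' : 0 <= Nd xi by exact: npow_ge0.
have X : `|- (A * beta * (beta * Sd xi)) - (1 + aa xi) * PP xi - bb xi * QQ xi| <=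
   A * beta * (beta * Nd xi) + (1 + A * beta * npow beta xi) * (A * beta * Nd xi) +
   (`|B| * beta * npow beta xi) * (`|B| * beta * Nd xi).
  rewrite (le_trans (ler_normB _ _))//; apply: lerD; last by rewrite normrM nbb nQ.
  rewrite (le_trans (ler_normB _ _))//; apply: lerD; first by rewrite normrN na'.
  by rewrite normrM nP ler_wpM2r// !mulr_ge0// ltW.
have Y : `|(1 + aa xi) * QQ xi + B * beta * (beta * Nd xi) - bb xi * PP xi| <=
   (1 + A * beta * npow beta xi) * (`|B| * beta * Nd xi) + `|B| * beta * (beta * Nd xi) +
   (`|B| * beta * npow beta xi) * (A * beta * Nd xi).
  rewrite (le_trans (ler_normB _ _))//; apply: lerD; last by rewrite normrM nbb nP.
  rewrite (le_trans (ler_normD _ _))//; apply: lerD; last by rewrite nb'.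
  by rewrite normrM nQ ler_wpM2r// !mulr_ge0// ltW.
rewrite /decay_remainder normrM (ger0_norm (expR_ge0 _)) eN -/(Nd xi).
rewrite [leRHS](_ : _ = m xi * (kap * (beta + 1) * Nd xi + kap ^+ 2 * (npow beta xi * Nd xi))); last by ring.
apply: ler_wpM2l; first exact: expR_ge0.
rewrite (le_trans (ler_normD _ _))// !normrM.
have Xs := ler_pM (normr_ge0 _) (normr_ge0 _) X (sin_max (B * spow beta xi + x * xi)).
have Yc := ler_pM (normr_ge0 _) (normr_ge0 _) Y (cos_max (B * spow beta xi + x * xi)).
apply: le_trans (lerD Xs Yc) _.
by rewrite le_eqVlt; apply/orP; left; apply/eqP; rewrite /kap; ring.
Qed.

Let continuous_m : continuous m.
Proof.
move=> xi; apply: (continuous_comp (f := fun xi : R => - A * npow beta xi)); last exact: continuous_expR.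
by apply: cvgM; [exact: cvg_cst|exact: continuous_npow].
Qed.

Let continuous_phase x : continuous (fun xi => B * spow beta xi + x * xi).
Proof.
move=> xi; apply: cvgD; apply: cvgM; try exact: cvg_cst; last exact: cvg_id.
exact: continuous_spow.
Qed.

Let continuous_sinp x : continuous (sinp x).
Proof. by move=> xi; apply: continuous_comp; [exact: continuous_phase|exact: continuous_sin]. Qed.

Let continuous_cosp x : continuous (cosp x).
Proof. by move=> xi; apply: continuous_comp; [exact: continuous_phase|exact: continuous_cos]. Qed.

Let continuous_scale_ (c : R) (f : R -> R) : continuous f -> continuous (fun xi => c * f xi).
Proof. by move=> cf xi; apply: cvgM; [exact: cvg_cst|exact: cf]. Qed.

Lemma continuous_decay_remainder x : continuous (decay_remainder x).
Proof.
have cS : continuous Sd by exact: continuous_spow.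
have cN : continuous Nd by exact: continuous_npow.
have c1 : continuous (fun xi => 1 + aa xi).
  move=> xi; apply: cvgD; first exact: cvg_cst.
  by apply: cvgN; apply: continuous_scale_; exact: continuous_npow.
have cb : continuous bb by apply: continuous_scale_; exact: continuous_spow.
have cP : continuous PP by exact: continuous_scale_.
have cQ : continuous QQ by exact: continuous_scale_.
have c2 : continuous (fun xi => A * beta * (beta * Sd xi)) by do 2 apply: continuous_scale_.
have c3 : continuous (fun xi => B * beta * (beta * Nd xi)) by do 2 apply: continuous_scale_.
move=> xi; apply: cvgM; first exact: continuous_m.
apply: cvgD; apply: cvgM; [|exact: continuous_sinp| |exact: continuous_cosp].
- apply: cvgB; last by apply: cvgM; [exact: cb|exact: cQ].
  apply: cvgB; last by apply: cvgM; [exact: c1|exact: cP].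
  by apply: cvgN; exact: c2.
- apply: cvgB; last by apply: cvgM; [exact: cb|exact: cP].
  apply: cvgD; last exact: c3.
  by apply: cvgM; [exact: c1|exact: cQ].
Qed.

(** Two integrations by parts in frequency at once: the derivative of [decay_primitive] has integral
    0, which expresses [x^2] times the transform by the remainder. *)
Lemma dstable_decay : exists C, forall x, x ^+ 2 * `|dstable x| <= C.
Proof.
pose G xi := kap * (beta + 1) * (m xi * npow (beta - 1) xi) + kap ^+ 2 * (m xi * npow (2 * beta - 1) xi).
have iG : leb.-integrable [set: T] (EFin \o G).
  exact: integrable_lin (integrable_damped_npow b10) (integrable_damped_npow b20).
exists ((2 * pi)^-1 * \int[leb]_xi G xi) => x.
have p0 : 0 <= (2 * @pi R)^-1 by rewrite invr_ge0 mulr_ge0// pi_ge0.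
have im : leb.-integrable [set: T] (EFin \o (fun xi => xi * (m xi * sinp x xi))).
  have := integrable_damped_npow (ltr01 : 0 < 1 :> R); apply: le_integrable => //.
    apply/measurable_EFinP; apply: continuous_measurable_fun => xi.
    by apply: cvgM; [exact: cvg_id|apply: cvgM; [exact: continuous_m|exact: continuous_sinp]].
  move=> xi _; have := norm_osc_shift_le x xi; rewrite osc_shiftE lee_fin => /le_trans; apply.
  exact: ler_norm.
have ir : leb.-integrable [set: T] (EFin \o decay_remainder x).
  apply: (le_integrable _ _ _ iG) => //.
    by apply/measurable_EFinP; apply: continuous_measurable_fun; exact: continuous_decay_remainder.
  by move=> xi _; rewrite lee_fin (le_trans (norm_decay_remainder _ _))// ler_norm.
have e0 : \int[leb]_xi (x ^+ 2 * (xi * (m xi * sinp x xi)) + 1 * decay_remainder x xi) = 0.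
  have [C0 h0] := damped_le; have [C1 h1] := damped_npow_le b0.
  have [C2 h2] := damped_npow_le (ltr01 : 0 < 1 :> R).
  apply: (Rintegral_derive0 (H := decay_primitive x) (K := C0 + kap * C1 + `|x| * C2) (d := A / 2)).
  - by rewrite divr_gt0.
  - by move=> xi; rewrite mul1r; exact: der_decay_primitive.
  - move=> xi; apply: cvgD; apply: cvgM; try exact: cvg_cst; last exact: continuous_decay_remainder.
    by apply: cvgM; [exact: cvg_id|apply: cvgM; [exact: continuous_m|exact: continuous_sinp]].
  - exact: integrable_lin im ir.
  - move=> xi; rewrite normrM (ger0_norm (expR_ge0 _)).
    apply: (@le_trans _ _ (m xi + kap * (m xi * npow beta xi) + `|x| * (m xi * npow 1 xi))).
      rewrite [leRHS](_ : _ = m xi * ((1 + A * beta * npow beta xi) * 1 +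
        (`|B| * beta * npow beta xi + `|x| * npow 1 xi) * 1)); last by rewrite /kap; ring.
      apply: ler_wpM2l; first exact: expR_ge0.
      rewrite (le_trans (ler_normD _ _))// !normrM; apply: lerD; apply: ler_pM => //.
      + rewrite (le_trans (ler_normD _ _))// normr1 lerD2l normrN (normrM (A * beta)) (normrM A).
        by rewrite (gtr0_norm A0) (gtr0_norm b0) (ger0_norm (npow_ge0 _ _)).
      + exact: sin_max.
      + rewrite (le_trans (ler_normB _ _))//; apply: lerD; last by rewrite normrM npow1.
        by rewrite /bb (normrM (B * beta)) (normrM B) (gtr0_norm b0) norm_spow.
      + exact: cos_max.
    rewrite (mulrDl (C0 + _)) (mulrDl C0); apply: lerD; [apply: lerD => //|].
      by rewrite -mulrA ler_wpM2l// /kap addr_ge0// mulr_ge0// ltW.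
    by rewrite -mulrA ler_wpM2l.
rewrite (Rintegral_lin _ _ im ir) mul1r in e0.
have eI : x ^+ 2 * \int[leb]_xi (xi * (m xi * sinp x xi)) = - \int[leb]_xi decay_remainder x xi by lra.
rewrite -(ger0_norm (sqr_ge0 x)) -normrM /dstable.
rewrite (_ : \int[leb]_xi (xi * osc beta A B 1 (x * xi - pi / 2) xi) = \int[leb]_xi (xi * (m xi * sinp x xi))); last first.
  by apply: eq_Rintegral => xi _; rewrite osc_shiftE.
rewrite mulrCA eI mulrNN normrM (ger0_norm p0) ler_wpM2l//.
rewrite (le_trans (le_normr_Rintegral _ ir))//.
apply: le_Rintegral => //; first exact: integrable_norm ir.
by move=> xi _; exact: norm_decay_remainder.
Qed.

(** Boundedness and decay like [x^-2] combine into a multiple of the integrable function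
    [lorentz]. *)
Lemma norm_dstable_le : exists C, forall x, `|dstable x| <= C * lorentz x.
Proof.
have [C hC] := dstable_decay.
have p0 : 0 <= (2 * @pi R)^-1 by rewrite invr_ge0 mulr_ge0// pi_ge0.
pose M := (2 * pi)^-1 * \int[leb]_xi (m xi * npow 1 xi).
have i1 := integrable_damped_npow (ltr01 : 0 < 1 :> R).
have hM x : `|dstable x| <= M.
  rewrite normrM normrN (ger0_norm p0) ler_wpM2l//.
  have im : leb.-integrable [set: T] (EFin \o (fun xi => xi * osc beta A B 1 (x * xi - pi / 2) xi)).
    apply: le_integrable i1 => //.
      apply/measurable_EFinP; apply: measurable_funM => //; apply: measurable_osc => //.
      by apply: measurable_funB; [apply: measurable_funM => //; exact: measurable_cst|exact: measurable_cst].
    by move=> xi _; rewrite lee_fin (le_trans (norm_osc_shift_le _ _))// ler_norm.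
  rewrite (le_trans (le_normr_Rintegral _ im))//.
  apply: le_Rintegral => //; first exact: integrable_norm im.
  by move=> xi _; exact: norm_osc_shift_le.
exists ((M + C) / 2) => x; have x1 : 0 < 1 + x ^+ 2 by rewrite ltr_wpDr ?sqr_ge0.
rewrite /lorentz (_ : _ * _ = (M + C) / (1 + x ^+ 2)); last by field; rewrite gt_eqF.
rewrite ler_pdivlMr// mulrDr mulr1; apply: lerD => //.
by rewrite mulrC.
Qed.

Lemma integrable_dstable : leb.-integrable [set: T] (EFin \o dstable).
Proof.
have [C hC] := norm_dstable_le.
have := integrable_scale C (@integrable_lorentz R); apply: le_integrable => //.
  by apply/measurable_EFinP; exact: measurable_dstable.
by move=> x _; rewrite lee_fin (le_trans (hC x))// ler_norm.
Qed.

End stable_derivative.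

Lemma mean_value {R : realType} (f df : R -> R) (x h : R) :
  (forall y : R, is_derive y 1 f (df y)) ->
  exists c, `|c - x| <= `|h| /\ f (x + h) - f x = df c * h.
Proof.
move=> dfE; have cf a b : {within `[a, b], continuous f}.
  by apply: continuous_subspaceT => y; exact: der_continuous (dfE y).
have [h0|h0] := leP 0 h.
- have xh : x <= x + h by rewrite lerDl.
  have [c] := @MVT_segment _ f df x (x + h) xh (fun y _ => dfE y) (cf _ _).
  rewrite in_itv/= => /andP[c1 c2] e; exists c; split; last by rewrite e; congr (_ * _); ring.
  by rewrite !ger0_norm ?subr_ge0// lerBlDl.
- have xh : x + h <= x by rewrite gerDl ltW.
  have [c] := @MVT_segment _ f df (x + h) x xh (fun y _ => dfE y) (cf _ _).
  rewrite in_itv/= => /andP[c1 c2] e; exists c; split.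
    by rewrite ler0_norm ?subr_le0// (ltr0_norm h0) opprB; lra.
  by rewrite -opprB e; ring.
Qed.

Lemma norm_quotient_le {R : realType} (h u v : R) : 1 < `|h| ->
  `|h^-1 * (u - v)| <= `|u| + `|v|.
Proof.
move=> h1; rewrite normrM normfV (le_trans _ (ler_normB _ _))//.
by rewrite ler_piMl// invf_le1 ?ltW// (lt_trans _ h1).
Qed.

(** * Convergence in L^1 of the difference quotients of the kernel *)

Section difference_quotients.
Context {R : realType} (beta A B : R).
Local Notation leb := (@lebesgue_measure R).
Local Notation T := (measurableTypeR R).
Hypotheses (b1 : 1 < beta) (A0 : 0 < A).
Hypothesis intp : leb.-integrable [set: T] (EFin \o stable beta A B 1).

Let p := stable beta A B 1.
Let dp := dstable beta A B.

Definition quotient_error (h x : R) := 1 * (h^-1 * (p (x + h) - p x)) + -1 * dp x.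

Lemma measurable_p : measurable_fun [set: T] (p : T -> R).
Proof. by apply: measurable_stable => //; exact: measurable_cst. Qed.

Lemma measurable_quotient_error h : measurable_fun [set: T] (quotient_error h : T -> R).
Proof.
apply: measurable_funD; apply: measurable_funM; try exact: measurable_cst.
  apply: measurable_funM; first exact: measurable_cst.
  apply: measurable_funB; last exact: measurable_p.
  by apply: (measurableT_comp measurable_p); apply: measurable_funD => //; exact: measurable_cst.
exact: measurable_dstable.
Qed.

Let intq h : leb.-integrable [set: T] (EFin \o (fun x => h^-1 * (p (x + h) - p x))).
Proof.
have ips : leb.-integrable [set: T] (EFin \o (fun x => p (x + h))).
  apply: (integrable_invariant (phi := fun x : T => x + h)) => //.
    by apply: measurable_funD => //; exact: measurable_cst.
  by move=> g mg g0; exact: ge0_integral_shift.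
have := integrable_lin h^-1 (- h^-1) ips intp; apply: eq_integrable => // x _.
by rewrite /= -/p; congr EFin; ring.
Qed.

Lemma integrable_quotient_error h : leb.-integrable [set: T] (EFin \o quotient_error h).
Proof. exact: integrable_lin (intq h) (integrable_dstable B b1 A0). Qed.

(** The mean value theorem gives the derivative at a point [c] within distance 1 of [x], where
    [1 + x^2 <= 3 (1 + c^2)]; hence the factor 3. *)
Lemma quotient_le : exists C, 0 <= C /\ forall h x, h != 0 -> `|h| <= 1 ->
  `|h^-1 * (p (x + h) - p x)| <= C * lorentz x.
Proof.
have [C hC] := norm_dstable_le B b1 A0.
have C0 : 0 <= C.
  have := hC 0; rewrite /lorentz expr0n addr0 divr1 => /(le_trans (normr_ge0 _)).
  by rewrite pmulr_lge0.
exists (C * 3); split=> [|h x h0 h1]; first by rewrite mulr_ge0.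
have [c [cx ->]] := mean_value x h (der_stable B b1 A0).
rewrite mulrC mulfK//; apply: le_trans (hC c) _; rewrite -mulrA ler_wpM2l//.
have x1 : 0 < 1 + x ^+ 2 by rewrite ltr_wpDr ?sqr_ge0.
have c1 : 0 < 1 + c ^+ 2 by rewrite ltr_wpDr ?sqr_ge0.
rewrite /lorentz mulrCA ler_pM2l// ler_pdivlMr// mulrC ler_pdivrMr//.
have : (c - x) ^+ 2 <= 1 by rewrite -real_normK ?num_real// expr_le1// (le_trans cx).
nra.
Qed.

(** Uniform in all steps, large ones included, because scaling in time produces steps [d * rate t],
    unbounded as [t -> 0]. For [|h| > 1] the triangle inequality is enough. *)
Lemma nrm1_quotient_error_le : exists C, forall h, h != 0 -> nrm1 leb (quotient_error h) <= C.
Proof.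
have [C [C0 hC]] := quotient_le.
have idp := integrable_dstable B b1 A0.
exists (C * nrm1 leb (@lorentz R) + 2 * nrm1 leb p + nrm1 leb dp) => h h0.
apply: le_trans (nrm1_lin_sub (intq h) idp) _; rewrite lerD2r.
have [h1|h1] := leP `|h| 1.
  apply: (@le_trans _ _ (C * nrm1 leb (@lorentz R))); last by rewrite lerDl mulr_ge0// nrm1_ge0.
  rewrite -(ger0_norm C0) -nrm1Z; last exact: integrable_lorentz.
  have le := @ae_le_nrm1 _ T R leb (fun x => h^-1 * (p (x + h) - p x)) (fun x => `|C * lorentz x|)
    (measurable_of_integrable (intq h)) (integrable_norm (integrable_scale C (@integrable_lorentz R))).
  apply: le; apply: aeW => x; rewrite [leRHS]ger0_norm; last by rewrite mulr_ge0 ?lorentz_ge0.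
  exact: hC.
apply: (@le_trans _ _ (2 * nrm1 leb p)); last by rewrite lerDr mulr_ge0// nrm1_ge0.
have ips : leb.-integrable [set: T] (EFin \o (fun x => p (x + h))).
  apply: (integrable_invariant (phi := fun x : T => x + h)) => //.
    by apply: measurable_funD => //; exact: measurable_cst.
  by move=> g mg g0; exact: ge0_integral_shift.
have e : nrm1 leb (fun x => p (x + h)) = nrm1 leb p.
  rewrite /nrm1; apply: (Rintegral_shift h (f := fun x => `|p x|)).
  by apply: measurableT_comp => //; exact: measurable_p.
have -> : 2 * nrm1 leb p = nrm1 leb (fun x => p (x + h)) + nrm1 leb p by rewrite e; ring.
have tri := @nrm1_triangle _ T R leb _ _ _ (measurable_of_integrable (intq h)) ips intp.
by apply: tri; apply: aeW => x; exact: norm_quotient_le.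
Qed.

Lemma cvg_nrm1_quotient_error (h : nat -> R) : h n @[n --> \oo] --> 0 -> (forall n, h n != 0) ->
  nrm1 leb (quotient_error (h n)) @[n --> \oo] --> 0.
Proof.
move=> h0 hn0; have [C [C0 hC]] := quotient_le.
have idp := integrable_dstable B b1 A0.
(* Set to 0 while [|h n| > 1], so that the domination by [quotient_le] holds for every [n]; this
   changes finitely many terms. *)
pose f n (x : R) := if `|h n| <= 1 then `|quotient_error (h n) x| else 0.
have h1 : \forall n \near \oo, `|h n| <= 1.
  by have /cvgr0_norm_le := h0; apply.
have mf n : measurable_fun [set: T] (f n : T -> R).
  rewrite /f; case: (`|h n| <= 1); last exact: measurable_cst.
  by apply: measurableT_comp => //; exact: measurable_quotient_error.
have cf x : f ^~ x @ \oo --> (0 : R).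
  have c : `|quotient_error (h n) x| @[n --> \oo] --> (0 : R).
    rewrite -(@normr0 _ R); apply: cvg_norm.
    rewrite (_ : 0 = 1 * dp x + -1 * dp x); last by ring.
    apply: cvgD; last exact: cvg_cst.
    apply: cvgM; first exact: cvg_cst.
    have d : is_derive (0 : R) 1 (fun u : R => p (x + u)) (dp x).
      have dx := der_add (der_cst x (0 : R)) (der_id (0 : R)).
      apply: (der_eq (der_comp (f := p) (der_stable B b1 A0 (x + 0)) dx)).
      by rewrite addr0 add0r mulr1.
    have := cvg_diff_quotient (fun=> 0) d h0 hn0.
    by rewrite addr0.
  apply: (cvg_near_eq c); near=> n; rewrite /f ifT//; near: n; exact: h1.
have [] := @Rdominated_cvg _ _ R leb f (fun=> 0) (fun x => C * lorentz x + 1 * `|dp x|) mf cf.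
- exact: integrable_lin (@integrable_lorentz R) (integrable_norm idp).
- move=> n x; rewrite /f; case: ifPn => [hn1|_]; last first.
    by rewrite normr0 addr_ge0// mulr_ge0// lorentz_ge0.
  rewrite normr_id (le_trans (ler_normD _ _))// mul1r mulN1r normrN mul1r lerD2r.
  exact: hC.
rewrite /Rintegral integral0 /= => _ c; apply: (cvg_near_eq c); near=> n.
rewrite /nrm1 /Rintegral; congr fine; apply: eq_integral => x _; rewrite /f ifT//.
near: n; exact: h1.
Unshelve. all: end_near. Qed.

End difference_quotients.

(** * The time weight with singularity t^(- gam) *)

Section singular_weight.
Context {R : realType}.
Local Notation leb := (@lebesgue_measure R).
Local Notation T := (measurableTypeR R).
Variable gam : R.
Hypothesis gam01 : 0 < gam < 1.

Let pw (t : R) := t `^ (- gam).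

Let mpw : measurable_fun [set: T] (pw : T -> R).
Proof. exact: measurable_powR. Qed.

Lemma integral_singular_le :
  (\int[leb]_t ((pw \_ `]0%R, 1%R]) t)%:E <= ((1 - gam)^-1)%:E)%E.
Proof.
case/andP: gam01 => g0 g1.
(* Truncation away from the singularity; the shift by 2 keeps the left end strictly below 1. *)
pose D n := [set` `[n.+2%:R^-1, 1%R]] : set T.
have mD n : measurable (D n) by exact: measurable_itv.
pose g n (t : T) := ((pw \_ (D n)) t)%:E.
have mg n : measurable_fun [set: T] (g n).
  by apply/measurable_EFinP/(measurable_restrictT _ (mD n)); exact: measurable_funTS.
have g_ge0 n t : [set: T] t -> (0 <= g n t)%E.
  by move=> _; rewrite lee_fin /patch; case: ifP => // _; exact: powR_ge0.
have nD n k t : (n <= k)%N -> D n t -> D k t.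
  move=> nk; rewrite /D/= !in_itv/= => /andP[h1 h2]; rewrite h2 andbT (le_trans _ h1)//.
  by rewrite lef_pV2 ?posrE// ler_nat !ltnS.
have ndg t : [set: T] t -> nondecreasing_seq (g ^~ t).
  move=> _ n k nk; rewrite lee_fin /patch; case: ifPn => [|_].
    by rewrite inE => /(nD _ _ _ nk) Dk; rewrite mem_set.
  by case: ifP => // _; exact: powR_ge0.
have cvgg t : g n t @[n --> \oo] --> ((pw \_ `]0%R, 1%R]) t)%:E.
  apply: cvg_EFin; first exact: nearW.
  apply: (cvg_near_eq (f := fun=> (pw \_ `]0%R, 1%R]) t)); first exact: cvg_cst.
  have [tI|tI] := pselect (`]0%R, 1%R]%classic t); last first.
    apply: nearW => n /=; rewrite /patch memNset// memNset// => Dt; apply: tI.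
    move: Dt; rewrite /D/= !in_itv/= => /andP[h1 ->]; rewrite andbT.
    by rewrite (lt_le_trans _ h1)// invr_gt0.
  have t0 : 0 < t by move: tI; rewrite /= in_itv/= => /andP[].
  near=> n; rewrite /= /patch mem_set// mem_set//.
  move: tI; rewrite /D/= !in_itv/= => /andP[_ ->]; rewrite andbT.
  apply: (@le_trans _ _ (harmonic n)); first by rewrite lef_pV2 ?posrE// ler_nat.
  near: n; have /cvgr0_norm_le := @cvg_harmonic R; move=> /(_ _ t0); apply: filterS => n.
  by rewrite ger0_norm// harmonic_ge0.
pose F (t : R) := (1 - gam)^-1 * t `^ (1 - gam).
have dF (t : R) : 0 < t -> is_derive t 1 F (pw t).
  move=> t0; apply: (der_eq (der_scale _ (is_derive1_powR (1 - gam) t0))).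
  by rewrite mulrA mulVf ?mul1r ?gt_eqF ?subr_gt0// /pw; congr (_ `^ _); ring.
have gle n : (\int[leb]_t g n t <= ((1 - gam)^-1)%:E)%E.
  rewrite integral_patch.
  have n0 : 0 < n.+2%:R^-1 :> R by rewrite invr_gt0.
  have n1 : n.+2%:R^-1 < 1 :> R by rewrite invf_lt1// ltr1n.
  rewrite (@continuous_FTC2 _ pw F)//.
  - rewrite -EFinB lee_fin /F powR1 mulr1 gerBl mulr_ge0 ?powR_ge0// invr_ge0 subr_ge0 ltW//.
  - apply: continuous_in_subspaceT => t; rewrite inE/= in_itv/= => /andP[h1 _].
    exact: der_continuous (is_derive1_powR (- gam) (lt_le_trans n0 h1)).
  - split.
    + by move=> t; rewrite in_itv/= => /andP[h1 _]; case: (dF _ (lt_trans n0 h1)).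
    + by apply: cvg_at_right_filter; exact: der_continuous (dF _ n0).
    + by apply: cvg_at_left_filter; exact: der_continuous (dF _ ltr01).
  - by move=> t; rewrite in_itv/= => /andP[h1 _]; rewrite derive1E; case: (dF _ (lt_trans n0 h1)).
have := fun t => @cvg_monotone_convergence _ _ _ t _ measurableT g mg g_ge0 ndg.
rewrite (_ : (fun x => limn (g ^~ x)) = fun t => ((pw \_ `]0%R, 1%R]) t)%:E); last first.
  by apply/funext => t; apply: cvg_lim.
move=> /(_ leb) h; rewrite -(cvg_lim _ h)//; apply: lime_le; first by apply/cvg_ex; eexists; exact: h.
exact: nearW.
Unshelve. all: end_near. Qed.

Definition weight (lam : R) (t : T) : R := if 0 < t then expR (- lam * t) * pw t else 0.

Lemma weight_ge0 lam t : 0 <= weight lam t.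
Proof. by rewrite /weight; case: ifP => // _; rewrite mulr_ge0 ?expR_ge0 ?powR_ge0. Qed.

Lemma measurable_weight lam : measurable_fun [set: T] (weight lam).
Proof.
apply: measurable_fun_ifT; [exact: measurable_fun_ltr| |exact: measurable_cst].
apply: measurable_funM => //; apply: (measurableT_comp (@measurable_expR R)).
by apply: measurable_funM => //; exact: measurable_cst.
Qed.

Lemma integrable_weight lam : 0 < lam -> leb.-integrable [set: T] (EFin \o weight lam).
Proof.
case/andP: gam01 => g0 g1 lam0.
have mI : measurable (`]0%R, 1%R]%classic : set T) by exact: measurable_itv.
have mpI : measurable_fun [set: T] (pw \_ `]0%R, 1%R]).
  by apply/(measurable_restrictT _ mI); exact: measurable_funTS.
have i1 : leb.-integrable [set: T] (EFin \o (pw \_ `]0%R, 1%R])).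
  apply/integrableP; split; first exact/measurable_EFinP.
  apply: (@le_lt_trans _ _ ((1 - gam)^-1)%:E); last exact: ltry.
  apply: le_trans integral_singular_le; apply: ge0_le_integral => //.
  - by apply: measurableT_comp => //; exact/measurable_EFinP.
  - exact/measurable_EFinP.
  - by move=> t _; rewrite /= ger0_norm// /patch; case: ifP => // _; exact: powR_ge0.
have i2 : leb.-integrable [set: T] (EFin \o decay lam).
  apply/integrableP; split; first by apply/measurable_EFinP; exact: measurable_decay.
  under eq_integral do rewrite /= ger0_norm ?decay_ge0//.
  by rewrite /decay integral_patch integral0y_expRN// ltry.
have := integrable_lin 1 1 i1 i2; apply: le_integrable => //.
  by apply/measurable_EFinP; exact: measurable_weight.
move=> t _; rewrite lee_fin (ger0_norm (weight_ge0 _ _)).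
apply: le_trans (ler_norm _); rewrite !mul1r /weight.
have p0 : 0 <= (pw \_ `]0%R, 1%R]) t by rewrite /patch; case: ifP => // _; exact: powR_ge0.
have [t0|t0] := ltP 0 t; last by rewrite addr_ge0// decay_ge0.
have [t1|t1] := leP t 1.
  rewrite (@le_trans _ _ (pw t))//; last first.
    by rewrite {1}/patch mem_set/= ?in_itv/= ?t0// lerDl decay_ge0.
  by rewrite ler_piMl ?powR_ge0// -expR0 ler_expR mulNr oppr_le0 mulr_ge0// ltW.
apply: (@le_trans _ _ (decay lam t)); last by rewrite lerDr.
have -> : decay lam t = expR (- lam * t) by rewrite /decay /patch mem_set//= in_itv/= andbT ltW.
rewrite ler_piMr ?expR_ge0//.
have e : 1 `^ gam = 1 :> R by rewrite powR1.
by rewrite /pw powRN invf_le1 ?powR_gt0// -[leLHS]e ge0_ler_powR ?nnegrE// ltW.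
Qed.

(** With [weight 1] as dominating function, the integral vanishes as the damping grows; this is the
    source of the smallness of [d_x k]. *)
Lemma cvg_weight : \int[leb]_t weight n.+1%:R t @[n --> \oo] --> 0.
Proof.
have [] := @Rdominated_cvg _ _ R leb (fun n t => weight n.+1%:R t) (fun=> 0) (weight 1).
- by move=> n; exact: measurable_weight.
- move=> t; rewrite /weight; have [t0|_] := ltP 0 t; last exact: cvg_cst.
  rewrite -[X in _ --> X](mul0r (pw t)); apply: cvgM; last exact: cvg_cst.
  have h : expabs t n.+1%:R @[n --> \oo] --> 0.
    by rewrite (cvg_shiftS (fun n => expabs t n%:R)); exact: cvg_expabs_nat.
  apply: (cvg_near_eq h); apply: nearW => n.
  by rewrite /expabs ger0_norm//; congr expR; ring.
- exact: integrable_weight.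
- move=> n t; rewrite (ger0_norm (weight_ge0 _ _)) /weight; case: ifPn => // t0.
  rewrite ler_wpM2r ?powR_ge0// ler_expR !mulNr lerN2.
  by apply: ler_wpM2r; [exact: ltW|rewrite ler1n].
have z : \int[leb]_(x in [set: T]) (0 : R) = 0 by rewrite /Rintegral integral0.
by move=> _; rewrite z.
Qed.

End singular_weight.

(** * The weighted kernel *)

Section slices.
Context {R : realType}.
Local Notation leb := (@lebesgue_measure R).
Local Notation mu2 := (prod_measure leb leb).
Local Notation T := (measurableTypeR R).
Local Notation P := (T * T)%type.

Lemma slice_integral (F : P -> R) (c : T -> R) : measurable_fun [set: P] F ->
  leb.-integrable [set: T] (EFin \o c) ->
  (forall t, \int[leb]_x `|F (t, x)|%:E = (c t)%:E)%E ->
  mu2.-integrable [set: P] (EFin \o F) /\ nrm1 mu2 F = \int[leb]_t c t.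
Proof.
move=> mF intc Fc.
have e : (\int[mu2]_p `|(F p)%:E| = \int[leb]_t (c t)%:E)%E.
  have mG : measurable_fun [set: P] (fun p => `|(F p)%:E|%E).
    by apply: measurableT_comp => //; exact/measurable_EFinP.
  rewrite [LHS](@fubini_tonelli1 _ _ _ _ _ leb leb (fun p => `|(F p)%:E|%E) mG (fun p => abse_ge0 _)).
  by apply: eq_integral => t _; rewrite /fubini_F -Fc.
have intF : mu2.-integrable [set: P] (EFin \o F).
  apply/integrableP; split; first exact/measurable_EFinP.
  rewrite e -(EFin_Rintegral intc) ltry//.
split; first exact: intF.
by apply: EFin_inj; rewrite EFin_nrm1// e EFin_Rintegral.
Qed.

End slices.

Section weighted_kernel.
Context {R : realType} (beta A B eps : R).
Local Notation leb := (@lebesgue_measure R).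
Local Notation mu2 := (prod_measure leb leb).
Local Notation T := (measurableTypeR R).
Local Notation P := (T * T)%type.
Hypotheses (b1 : 1 < beta) (A0 : 0 < A) (eps0 : 0 < eps).
Hypothesis st_ge0 : forall s x : R, 0 < s -> 0 <= stable beta A B s x.

Let gam := beta^-1.
Let gam01 : 0 < gam < 1.
Proof. by rewrite /gam invr_gt0 invf_lt1 ?(lt_trans ltr01 b1)//= (lt_trans ltr01 b1). Qed.

Let p := stable beta A B 1.
Let dp := dstable beta A B.
Let ep := quotient_error beta A B.

Let intp : leb.-integrable [set: T] (EFin \o p).
Proof. exact: (integrable_stable b1 A0 st_ge0 ltr01). Qed.

Definition rate (t : R) : R := (eps * t) `^ (- gam).

Lemma rate_gt0 t : 0 < t -> 0 < rate t.
Proof. by move=> t0; rewrite powR_gt0// mulr_gt0. Qed.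

Lemma measurable_rate : measurable_fun [set: T] (rate : T -> R).
Proof.
apply: (measurableT_comp (measurable_powR (- gam))); exact: measurable_funM.
Qed.

Lemma stable_rate (t x : R) : 0 < t ->
  stable beta A B (eps * t) x = rate t * p (x * rate t).
Proof. by move=> t0; rewrite stable_scaling// mulr_gt0. Qed.

Lemma rate_weight lam t : 0 < t -> expR (- lam * t) * rate t = eps `^ (- gam) * weight gam lam t.
Proof. by move=> t0; rewrite /weight t0 /rate powRM ?(ltW eps0) ?(ltW t0)//; ring. Qed.

Definition wkernel (lam : R) (q : P) : R :=
  if 0 < q.1 then expR (- lam * q.1) * stable beta A B (eps * q.1) q.2 else 0.

(** The x-derivative of [wkernel] written through time 1: one factor [rate] is the amplitude of the
    scaling, the other comes from the chain rule. *)
Definition wdkernel (lam : R) (q : P) : R :=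
  if 0 < q.1 then expR (- lam * q.1) * (rate q.1 ^+ 2 * dp (q.2 * rate q.1)) else 0.

Definition wquotient (lam d : R) (q : P) : R :=
  1 * (d^-1 * (wkernel lam (q.1, q.2 + d) - wkernel lam q)) + -1 * wdkernel lam q.

Let m1 := @measurable_fst _ _ T T.
Let m2 := @measurable_snd _ _ T T.

Let mpos : measurable_fun [set: P] (fun q : P => 0 < q.1).
Proof. by apply: measurable_fun_ltr; [exact: measurable_cst|exact: m1]. Qed.

Let mexp lam : measurable_fun [set: P] (fun q : P => expR (- lam * q.1)).
Proof.
apply: (measurableT_comp (@measurable_expR R)); apply: measurable_funM; [exact: measurable_cst|exact: m1].
Qed.

Lemma measurable_wkernel lam : measurable_fun [set: P] (wkernel lam).
Proof.
apply: measurable_fun_ifT; [exact: mpos| |exact: measurable_cst].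
apply: measurable_funM; first exact: mexp.
apply: (measurable_stable A B b1); last exact: m2.
by apply: measurable_funM; [exact: measurable_cst|exact: m1].
Qed.

Lemma measurable_wdkernel lam : measurable_fun [set: P] (wdkernel lam).
Proof.
have mr : measurable_fun [set: P] (fun q : P => rate q.1) := measurableT_comp measurable_rate m1.
apply: measurable_fun_ifT; [exact: mpos| |exact: measurable_cst].
apply: measurable_funM; first exact: mexp.
apply: measurable_funM; first by apply: measurable_funX.
apply: (measurableT_comp (measurable_dstable A B b1)).
exact: measurable_funM m2 mr.
Qed.

Lemma measurable_wquotient lam d : measurable_fun [set: P] (wquotient lam d).
Proof.
apply: measurable_funD; apply: measurable_funM; try exact: measurable_cst; last exact: measurable_wdkernel.
apply: measurable_funM; first exact: measurable_cst.
apply: measurable_funB; last exact: measurable_wkernel.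
apply: (measurableT_comp (measurable_wkernel lam)); apply/measurable_fun_pairP; split; first exact: m1.
by apply: measurable_funD; [exact: m2|exact: measurable_cst].
Qed.

Lemma wkernel_ge0 lam q : 0 <= wkernel lam q.
Proof. by rewrite /wkernel; case: ifPn => // q0; rewrite mulr_ge0 ?expR_ge0// st_ge0// mulr_gt0. Qed.

Lemma wkernel_neg lam q : q.1 <= 0 -> wkernel lam q = 0.
Proof. by move=> q0; rewrite /wkernel ltNge q0. Qed.

Lemma wkernel_mass (lam t : R) : 0 < t ->
  (\int[leb]_x (wkernel lam (t, x))%:E <= (expR (- lam * t))%:E)%E.
Proof.
move=> t0; have et0 : 0 < eps * t by rewrite mulr_gt0.
rewrite (_ : (expR (- lam * t))%:E = (expR (- lam * t))%:E * 1)%E; last by rewrite mule1.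
apply: (@le_trans _ _ ((expR (- lam * t))%:E * \int[leb]_x (stable beta A B (eps * t) x)%:E)%E).
  rewrite -ge0_integralZl//; last 2 first.
  - apply/measurable_EFinP; apply: (measurable_stable A B b1) => //; exact: measurable_cst.
  - by move=> x _; rewrite lee_fin st_ge0.
  rewrite le_eqVlt; apply/orP; left; apply/eqP; apply: eq_integral => x _.
  by rewrite /wkernel /= t0 EFinM.
by rewrite lee_wpmul2l ?lee_fin ?expR_ge0//; exact: stable_mass_le.
Qed.

Lemma wkernel_semigroup (lam s t x : R) : 0 < s -> 0 < t ->
  (\int[leb]_y (wkernel lam (t, x - y) * wkernel lam (s, y))%:E = (wkernel lam (t + s, x))%:E)%E.
Proof.
move=> s0 t0; have et0 : 0 < eps * t by rewrite mulr_gt0.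
have es0 : 0 < eps * s by rewrite mulr_gt0.
rewrite {3}/wkernel /= addr_gt0// (mulrDr eps) EFinM -(stable_semigroup b1 A0 st_ge0 x et0 es0).
have i := integrable_stableM b1 A0 st_ge0 x et0 es0.
rewrite -(EFin_Rintegral i) -EFinM -RintegralZl//.
rewrite EFin_Rintegral; last exact: integrable_scale i.
by apply: eq_integral => y _; rewrite /wkernel /= s0 t0 (mulrDr (- lam)) expRD; congr EFin; ring.
Qed.

(** The substitution in [x] uses up one of the two factors [rate t]; the other is the integrable
    singularity in time. *)
Lemma slice_scale (f : T -> R) (t c : R) : leb.-integrable [set: T] (EFin \o f) -> 0 < t -> 0 <= c ->
  (\int[leb]_x `|c * (rate t ^+ 2 * f (x * rate t)%R)|%:E = (c * rate t * nrm1 leb f)%:E)%E.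
Proof.
move=> intf t0 c0; have r0 := rate_gt0 t0.
have mf : measurable_fun [set: T] (fun x => `|(f x)%:E|%E).
  by apply: measurableT_comp => //; have /integrableP[] := intf.
have cr0 : 0 <= c * rate t by rewrite mulr_ge0// ltW.
rewrite EFinM EFin_nrm1// -(ge0_integral_scale r0 mf) => [|x]; last exact: abse_ge0.
have msc : measurable_fun [set: T] (fun x : T => rate t * x).
  by apply: measurable_funM => //; exact: measurable_cst.
rewrite -!ge0_integralZl//; last 4 first.
- by apply: emeasurable_funM; [exact: measurable_cst|exact: (measurableT_comp mf msc)].
- by move=> x _; rewrite mule_ge0// lee_fin ltW.
- exact: (measurableT_comp mf msc).
- by rewrite lee_fin ltW.
apply: eq_integral => x _; rewrite /= -!EFinM !normrM (ger0_norm c0) (gtr0_norm r0) (mulrC x).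
by congr EFin; ring.
Qed.

Lemma wdkernel_slice lam t : (\int[leb]_x `|wdkernel lam (t, x)|%:E =
  (eps `^ (- gam) * nrm1 leb dp * weight gam lam t)%:E)%E.
Proof.
have [t0|t0] := ltP 0 t; last first.
  rewrite /wdkernel /weight /= ltNge t0/= mulr0.
  by under eq_integral do rewrite normr0; rewrite integral0.
under eq_integral do rewrite /wdkernel /= t0.
rewrite (slice_scale (integrable_dstable B b1 A0) t0 (expR_ge0 _)) rate_weight//.
by congr EFin; ring.
Qed.

Lemma integrable_wdkernel lam : 0 < lam -> mu2.-integrable [set: P] (EFin \o wdkernel lam) /\
  nrm1 mu2 (wdkernel lam) = eps `^ (- gam) * nrm1 leb dp * \int[leb]_t weight gam lam t.
Proof.
move=> lam0; have iw := integrable_weight gam01 lam0.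
have [h1 h2] := slice_integral (measurable_wdkernel lam) (integrable_scale _ iw) (wdkernel_slice lam).
by split => //; rewrite h2 RintegralZl.
Qed.

Lemma small_wdkernel (eta : R) : 0 < eta -> exists2 lam, 0 < lam & nrm1 mu2 (wdkernel lam) <= eta.
Proof.
move=> eta0; pose c := eps `^ (- gam) * nrm1 leb dp.
have h : c * \int[leb]_t weight gam n.+1%:R t @[n --> \oo] --> 0.
  by rewrite -[X in _ --> X](mulr0 c); apply: cvgM; [exact: cvg_cst|exact: cvg_weight].
have /cvgr_lt/(_ _ eta0) [N _ hN] := h.
exists N.+1%:R => //; have [_ ->] := integrable_wdkernel (ltr0Sn R N).
by apply/ltW; exact: hN (leqnn N).
Qed.

(** By scaling, the step [d] at time [t] becomes the step [d * rate t] at time 1. *)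
Lemma wquotient_slice lam d t : d != 0 -> (\int[leb]_x `|wquotient lam d (t, x)|%:E =
  (eps `^ (- gam) * weight gam lam t * nrm1 leb (ep (d * rate t)))%:E)%E.
Proof.
move=> d0; have [t0|t0] := ltP 0 t; last first.
  rewrite /wquotient /wkernel /wdkernel /weight /= ltNge t0/= !(mulr0, mul0r).
  by under eq_integral do rewrite subrr !mulr0 addr0 normr0; rewrite integral0.
have r0 := rate_gt0 t0; have rn : rate t != 0 by rewrite gt_eqF.
rewrite -rate_weight// -(slice_scale (integrable_quotient_error b1 A0 intp _) t0 (expR_ge0 _)).
apply: eq_integral => x _; congr (`|_|%:E).
rewrite /wquotient /wkernel /wdkernel /= t0 !stable_rate// /quotient_error mulrDl invfM.
rewrite -/p -/dp; move: (p _) (p _) (dp _) => u v w.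
by field; rewrite d0 rn.
Qed.

(** Dominated convergence in time: at fixed [t] the rescaled step tends to 0, and the bound uniform
    in all steps makes a multiple of [weight] a dominating function. *)
Lemma cvg_wquotient lam (d : nat -> R) : 0 < lam -> d n @[n --> \oo] --> 0 -> (forall n, d n != 0) ->
  nrm1 mu2 (wquotient lam (d n)) @[n --> \oo] --> 0.
Proof.
move=> lam0 cd d0; have iw := integrable_weight gam01 lam0.
have [C hC] := nrm1_quotient_error_le b1 A0 intp.
pose c n (t : T) := eps `^ (- gam) * weight gam lam t * nrm1 leb (ep (d n * rate t)).
have C0 : 0 <= C by apply: le_trans (nrm1_ge0 _ _) (hC 1 (oner_neq0 _)).
have e0 : 0 <= eps `^ (- gam) by exact: powR_ge0.
have slE n t : \int[leb]_x `|wquotient lam (d n) (t, x)| = c n t.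
  by rewrite /Rintegral wquotient_slice.
have mc n : measurable_fun [set: T] (c n).
  have mF : measurable_fun [set: P] (fun q => `|wquotient lam (d n) q|).
    by apply: measurableT_comp => //; exact: measurable_wquotient.
  rewrite (_ : c n = fun t => \int[leb]_x `|wquotient lam (d n) (t, x)|).
    exact: (@measurable_Rintegral_param _ _ T T R leb _ mF).
  by apply/funext => t; rewrite slE.
have cb n t : `|c n t| <= C * eps `^ (- gam) * weight gam lam t.
  rewrite /c /weight; case: ifPn => [t0|_]; last by rewrite !mulr0 mul0r normr0.
  set w := expR _ * _; have w0 : 0 <= w by rewrite mulr_ge0 ?expR_ge0 ?powR_ge0.
  rewrite ger0_norm; last exact: mulr_ge0 (mulr_ge0 e0 w0) (nrm1_ge0 _ _).
  rewrite [leLHS]mulrC -[leRHS]mulrA; apply: ler_wpM2r; first exact: mulr_ge0.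
  apply: hC.
  by rewrite mulf_neq0// gt_eqF// rate_gt0.
have cc t : c n t @[n --> \oo] --> 0.
  rewrite /c; have [t0|t0] := ltP 0 t; last first.
    by rewrite /weight ltNge t0/=; under eq_fun do rewrite mulr0 mul0r; exact: cvg_cst.
  rewrite -[X in _ --> X](mulr0 (eps `^ (- gam) * weight gam lam t)).
  apply: cvgM; first exact: cvg_cst.
  have h0 : d n * rate t @[n --> \oo] --> 0.
    by rewrite -(mul0r (rate t)); apply: cvgM => //; exact: cvg_cst.
  have hn0 n : d n * rate t != 0 by rewrite mulf_neq0// gt_eqF// rate_gt0.
  exact: (cvg_nrm1_quotient_error B b1 A0 h0 hn0).
have ib := integrable_scale (C * eps `^ (- gam)) iw.
have [_] := Rdominated_cvg mc cc ib cb.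
rewrite [X in _ --> X -> _](_ : _ = 0); last by rewrite /Rintegral integral0.
move=> hc; apply: (cvg_near_eq hc); apply: nearW => n.
have ic : leb.-integrable [set: T] (EFin \o c n).
  apply: (le_integrable _ _ _ ib) => //; first exact/measurable_EFinP.
  by move=> t _; rewrite lee_fin (le_trans (cb n t))// ler_norm.
by have [_ ->] := slice_integral (measurable_wquotient lam (d n)) ic (fun t => wquotient_slice lam t (d0 n)).
Qed.

(** [wquotient] with [d = dx] is the forward error and with [d = - dx] the backward one. *)
Lemma wkernel_quotient_cvg lam eta : 0 < lam -> 0 < eta -> exists dx, [/\ 0 < dx,
  nrm1 mu2 (fun q => 1 * right_quotient (wkernel lam) dx q + -1 * wdkernel lam q) <= eta &
  nrm1 mu2 (fun q => 1 * left_quotient (wkernel lam) dx q + -1 * wdkernel lam q) <= eta].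
Proof.
move=> lam0 eta0.
have hn n : harmonic n != 0 :> R by rewrite gt_eqF// harmonic_gt0.
have hN n : - harmonic n != 0 :> R by rewrite oppr_eq0.
have c1 := cvg_wquotient lam0 (@cvg_harmonic R) hn.
have c2' : - harmonic n @[n --> \oo] --> (0 : R) by rewrite -oppr0; apply: cvgN; exact: cvg_harmonic.
have c2 := cvg_wquotient lam0 c2' hN.
have [N1 _ h1] : \forall n \near \oo, nrm1 mu2 (wquotient lam (harmonic n)) < eta.
  by have /cvgr_lt := c1; apply.
have [N2 _ h2] : \forall n \near \oo, nrm1 mu2 (wquotient lam (- harmonic n)) < eta.
  by have /cvgr_lt := c2; apply.
pose N := maxn N1 N2; exists (harmonic N); split; first exact: harmonic_gt0.
- have := h1 N (leq_maxl _ _); move=> /ltW; congr (nrm1 _ _ <= _); apply/funext => q.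
  by rewrite /wquotient /right_quotient /sub2 /= subr0 opprK; ring.
- have := h2 N (leq_maxr _ _); move=> /ltW; congr (nrm1 _ _ <= _); apply/funext => q.
  by rewrite /wquotient /left_quotient /sub2 /= subr0 invrN; ring.
Qed.

End weighted_kernel.

(** * Mild solutions *)

Section kernel_identification.
Local Open Scope complex_scope.
Context {R : realType} (alpha : R).
Local Notation leb := (@lebesgue_measure R).
Local Notation T := (measurableTypeR R).
Local Notation beta := (alpha + 1).
Local Notation theta := (beta * pi / 2).

(** Parity of cosine and sine moves the sign of [xi] from the angle to [spow]; the real part of the
    integrand is then [osc] with phase [x xi]. *)
Lemma kernelE (t x : R) : 0 < alpha ->
  Defs.kernel alpha t x = stable beta (- cos theta) (sin theta) t x.
Proof.
move=> a0; have b0 : 0 < beta by rewrite addr_gt0.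
have ReZ (c : R) (z : R[i]) : complex.Re (c%:C * z) = c * complex.Re z.
  by case: z => u v; rewrite ReM /= mul0r subr0.
rewrite /Defs.kernel /ckernel ReZ; congr (_ * _).
apply: eq_Rintegral => xi _; rewrite symbolE.
have eC : `|xi| `^ beta * cos (Num.sg xi * theta) = cos theta * npow beta xi.
  rewrite mulrC /npow; case: sgrP => [_|_|_]; rewrite ?mul1r//; last by rewrite mulN1r cosN.
  by rewrite powR0 ?gt_eqF// !mulr0.
have eS : `|xi| `^ beta * sin (Num.sg xi * theta) = sin theta * spow beta xi.
  rewrite /spow mulrC; case: sgrP => [_|_|_]; rewrite ?mul1r//.
    by rewrite mul0r sin0 !mul0r mulr0.
  by rewrite mulN1r sinN mulN1r mulrN mulNr.
rewrite eC eS /osc; move: (cos theta) (sin theta) (npow beta xi) (spow beta xi) => c s u v.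
have -> : - (- c * t) * u = c * u * t by ring.
have -> : s * t * v = s * v * t by ring.
rewrite /cexp; simpc; rewrite /= expR0 !mul1r cosD.
by ring.
Qed.

(** The angle lies strictly between [pi / 2] and [pi]; this sign is the dissipation of the
    equation. *)
Lemma cos_theta_lt0 : 0 < alpha < 1 -> 0 < - cos theta.
Proof.
case/andP=> a0 a1; have p0 := @pi_gt0 R.
have -> : theta = alpha * pi / 2 + pi / 2 by field.
rewrite cosDpihalf opprK sin_gt0_pi//; apply/andP; split.
  by rewrite divr_gt0 ?mulr_gt0.
by rewrite ltr_pdivrMr// mulrC ltr_pM2l//; lra.
Qed.

End kernel_identification.

(** * Essential bounds and local Lipschitz continuity *)

Section essential_bounds.
Context {R : realType}.
Local Notation leb := (@lebesgue_measure R).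

Lemma Lfun_pinfty_bounded d (X : measurableType d) (mu : {measure set X -> \bar R}) (f : X -> R) :
  f \in Lfun mu +oo%E ->
  measurable_fun [set: X] f /\ exists M, {ae mu, forall x, `|f x| <= M}.
Proof.
rewrite inE => /andP[]; rewrite inE/= => mf; rewrite inE/= /finite_norm unlock /Lnorm => fin.
split; first exact: mf.
move: fin; case: ifPn => [mu0 fin|].
  have h := ess_sup_inf.ess_sup_ge mu (abse \o (EFin \o f)).
  have fn : ess_sup_inf.ess_sup mu (abse \o (EFin \o f)) \is a fin_num.
    rewrite ge0_fin_numE//; apply: ess_sup_inf.ess_sup_gee => //; apply: aeW => x; exact: abse_ge0.
  exists (fine (ess_sup_inf.ess_sup mu (abse \o (EFin \o f)))).
  by apply: filterS h => x; rewrite -lee_fin fineK.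
(* On a space of measure zero every almost everywhere statement holds. *)
rewrite -leNgt => mu0 _; exists 0; exists [set: X]; split => //.
by apply/eqP; rewrite eq_le mu0 measure_ge0.
Qed.

Lemma integrable_Linf d (X : measurableType d) (mu : {measure set X -> \bar R}) (g f : X -> R) :
  f \in Lfun mu +oo%E -> mu.-integrable [set: X] (EFin \o g) ->
  mu.-integrable [set: X] (fun x => (g x * f x)%:E).
Proof.
move=> /Lfun_pinfty_bounded[mf [M fM]] intg.
have mg := measurable_of_integrable intg.
apply/integrableP; split; first by apply/measurable_EFinP; exact: measurable_funM.
have := integrable_scale M intg => /integrableP[_]; apply: le_lt_trans.
apply: ae_ge0_le_integral => //.
- by apply: measurableT_comp => //; apply/measurable_EFinP; exact: measurable_funM.
- by apply: measurableT_comp => //; apply/measurable_EFinP; apply: measurable_funM => //; exact: measurable_cst.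
apply: filterS fM => x fx _; rewrite lee_fin !normrM mulrC ler_wpM2r//.
exact: le_trans (ler_norm _).
Qed.

Lemma box_measure_gt0 (x y e : R) : 0 < e ->
  (0 < (leb \x leb) ((ball x e : set (measurableTypeR R)) `*` (ball y e : set (measurableTypeR R))))%E.
Proof.
move=> e0; have mB z : measurable (ball z e : set (measurableTypeR R)).
  by apply: open_measurable; exact: ball_open.
have lB z : leb (ball z e : set (measurableTypeR R)) = (e *+ 2)%:E.
  exact: lebesgue_measure_ball (ltW e0).
rewrite (product_measure1E _ _ (mB x) (mB y)) (_ : (_ * _)%E = ((e *+ 2) * (e *+ 2))%:E).
  by rewrite lte_fin mulr_gt0// mulrn_wgt0.
by rewrite EFinM; congr (_ * _)%E; exact: lB.
Qed.

(** By continuity the set where the bound fails is open; if nonempty it would put a box of positive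
    measure inside a null set. *)
Lemma continuous_ae_bound (D : set (R * R)) (g : R * R -> R) (M : R) : open D ->
  (forall p, D p -> {for p, continuous g}) ->
  {ae (leb \x leb)%E, forall p : measurableTypeR R * measurableTypeR R, D p -> `|g p| <= M} ->
  forall p, D p -> `|g p| <= M.
Proof.
move=> oD cg [N [mN N0 hN]] p Dp; rewrite leNgt; apply/negP => gM.
have : nbhs p [set q | M < `|g q| /\ D q].
  have h1 : \forall q \near p, M < `|g q|.
    have c : `|g q| @[q --> p] --> `|g p| by apply: cvg_norm; exact: cg.
    by have /cvgr_gt := c; apply.
  have h2 : \forall q \near p, D q by exact: open_nbhs_nbhs.
  by apply: filterS2 h1 h2 => q *; split.
move=> /nbhs_ballP[e /= e0 he].
have sub : (ball p.1 e `*` ball p.2 e) `<=` N.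
  move=> q [q1 q2]; apply: hN => /= h.
  have [h1 h2] : M < `|g q| /\ D q by apply: he; split.
  by move: h1; rewrite ltNge h.
have := box_measure_gt0 p.1 p.2 e0; rewrite ltNge => /negP; apply.
rewrite -N0; apply: le_measure => //; rewrite inE//.
by apply: measurableX; apply: open_measurable; exact: ball_open.
Qed.

Lemma smooth_lipschitz (f : R -> R) (M : R) : smooth f -> 0 <= M ->
  exists L, 0 < L /\ forall x y, `|x| <= M -> `|y| <= M -> `|f x - f y| <= L * `|x - y|.
Proof.
move=> sf M0; have df (x : R) : is_derive x 1 f (derive1 f x).
  by split; [exact: (sf 0%N x)|rewrite derive1E].
have cdf : continuous (derive1 f).
  by move=> x; apply: differentiable_continuous; apply/derivable1_diffP; exact: (sf 1%N x).
have [] := @EVT_max R (fun x => `|derive1 f x|) (- M) M; first lra.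
  by apply: continuous_subspaceT => x; apply: cvg_norm; exact: cdf.
move=> c cI hc; exists (`|derive1 f c| + 1); split; first by rewrite ltr_wpDl.
move=> x y; rewrite (ler_norml x) (ler_norml y) => /andP[x1 x2] /andP[y1 y2].
wlog xy : x y x1 x2 y1 y2 / y <= x.
  move=> wl; have [h|h] := leP y x; first exact: wl.
  by rewrite distrC (distrC x); apply: wl => //; exact: ltW.
have [z] := @MVT_segment _ f (derive1 f) y x xy (fun t _ => df t)
  (continuous_subspaceT (fun t => der_continuous (df t))).
rewrite in_itv/= => /andP[z1 z2] ->; rewrite normrM ler_wpM2r//.
apply: le_trans (hc z _) _; last by rewrite lerDl.
by rewrite in_itv/=; apply/andP; split; lra.
Qed.

End essential_bounds.

(** * Duhamel's formula as a convolution in the plane *)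

Section duhamel.
Context {R : realType} (alpha eps lam : R).
Local Notation leb := (@lebesgue_measure R).
Local Notation mu2 := (prod_measure leb leb).
Local Notation T := (measurableTypeR R).
Local Notation P := (T * T)%type.
Hypotheses (alpha01 : 0 < alpha < 1) (eps0 : 0 < eps) (lam0 : 0 < lam).

Let beta := alpha + 1.
Let A := - cos (beta * pi / 2).
Let B := sin (beta * pi / 2).
Let a0 : 0 < alpha. Proof. by case/andP: alpha01. Qed.
Let b1 : 1 < beta. Proof. by rewrite /beta ltrDr. Qed.
Let A0 : 0 < A. Proof. exact: cos_theta_lt0. Qed.

Lemma fractional_ge0 (s x : R) : 0 < s -> 0 <= stable beta A B s x.
Proof.
move=> s0; apply: stable_ge0 => //; rewrite b1 /beta.
by case/andP: alpha01 => _ a1; lra.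
Qed.

Definition fkernel := wkernel beta A B eps lam.
Definition fdkernel := wdkernel beta A B eps lam.

Lemma Rintegral_source0 (f : P -> R) : measurable_fun [set: P] f ->
  \int[source0]_r f r = \int[leb]_y f (0, y).
Proof.
move=> /measurable_EFinP mf; rewrite /Rintegral integralE [in RHS]integralE.
rewrite (integral_source0 (measurable_funepos mf)); last exact: funepos_ge0.
congr (fine (_ - _))%E; first by apply: eq_integral => y _; rewrite !funeposE.
rewrite (integral_source0 (measurable_funeneg mf)); last exact: funeneg_ge0.
by apply: eq_integral => y _; rewrite !funenegE.
Qed.

(** Positive and negative parts scale separately and [fine] sends infinities to 0, so divergent
    integrals are covered; [conv_kernel_source], stated for measurable data, relies on this. *)
Lemma Rintegral_gt0Z (c : R) (f : T -> R) : 0 < c -> measurable_fun [set: T] f ->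
  \int[leb]_x (c * f x) = c * \int[leb]_x f x.
Proof.
move=> c0 /measurable_EFinP mf; have mp := measurable_funepos mf; have mn := measurable_funeneg mf.
rewrite /Rintegral -fine_gt0_mule// integralE [in RHS]integralE gt0_muleB//.
rewrite -ge0_integralZl//; last by rewrite lee_fin ltW.
rewrite -ge0_integralZl//; last by rewrite lee_fin ltW.
rewrite (_ : (fun x => (c * f x)%:E) = fun x => (c%:E * (EFin \o f) x)%E)//.
by rewrite ge0_funeposM ?ge0_funenegM// ltW.
Qed.

Lemma measurable_kernelx (t : R) : measurable_fun [set: T] (Defs.kernel alpha t : T -> R).
Proof.
rewrite (_ : Defs.kernel alpha t = stable beta A B t); last by apply/funext => x; rewrite kernelE.
by apply: (measurable_stable A B b1) => //; exact: measurable_cst.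
Qed.

Lemma conv_kernel_source (w0 : T -> R) (t x : R) : measurable_fun [set: T] w0 -> 0 < t ->
  gconv sub2 source0 fkernel (datum w0) (t, x) =
  expR (- lam * t) * Defs.conv (Defs.kernel alpha (eps * t)) w0 x.
Proof.
move=> mw t0; rewrite /gconv Rintegral_source0; last first.
  apply: measurable_funM; last by exact: (measurableT_comp mw measurable_snd).
  by apply: (measurableT_comp (measurable_wkernel A B eps b1 lam)); exact: measurable_sub2r.
rewrite /Defs.conv -Rintegral_gt0Z ?expR_gt0//; last first.
  apply: measurable_funM => //; apply: (measurableT_comp (measurable_kernelx (eps * t))).
  by apply: measurable_funB => //; exact: measurable_cst.
apply: eq_Rintegral => y _.
rewrite /fkernel /wkernel /sub2 /= subr0 t0 kernelE// /datum /= mulrA.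
by rewrite -/beta -/A -/B.
Qed.

Lemma derive1_kernel (t x : R) : 0 < t -> derive1 (Defs.kernel alpha (eps * t)) x =
  rate beta eps t ^+ 2 * dstable beta A B (x * rate beta eps t).
Proof.
move=> t0; set r := rate beta eps t.
have -> : Defs.kernel alpha (eps * t) = fun x => r * stable beta A B 1 (x * r).
  by apply/funext => y; rewrite kernelE// -/beta -/A -/B (stable_rate A B b1 eps0).
have dl := der_mul (der_id x) (der_cst r x).
have d := der_scale r (der_comp (f := stable beta A B 1) (g := fun x => x * r) (der_stable B b1 A0 (x * r)) dl).
by rewrite derive1E; have [_ ->] := d; ring.
Qed.

(** The weight factors as [exp(- lam t) = exp(- lam (t - s)) exp(- lam s)]. The kernel vanishes for
    [s >= t] and the source for [s <= 0], which confines the planar integral to []0, t[]. *)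
Lemma duhamel_gconv (g : P -> R) (M t x : R) : measurable_fun [set: P] g ->
  (forall r, 0 < r.1 -> `|g r| <= M) -> 0 < t ->
  gconv sub2 mu2 fdkernel (fun r => if 0 < r.1 then expR (- lam * r.1) * g r else 0) (t, x) =
  expR (- lam * t) * \int[leb]_(s in `]0, t[)
    Defs.conv (derive1 (Defs.kernel alpha (eps * (t - s)))) (fun y => g (s, y)) x.
Proof.
move=> mg gM t0; set G := fun r : P => _.
have M0 : 0 <= M by have := gM (t, x) t0; exact: le_trans.
have mG : measurable_fun [set: P] G.
  apply: measurable_fun_ifT; last exact: measurable_cst.
    by apply: measurable_fun_ltr; [exact: measurable_cst|exact: measurable_fst].
  apply: measurable_funM => //; apply: (measurableT_comp (@measurable_expR R)).
  by apply: measurable_funM; [exact: measurable_cst|exact: measurable_fst].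
have GM r : `|G r| <= M.
  rewrite /G; case: ifPn => [r0|_]; last by rewrite normr0.
  rewrite normrM ger0_norm ?expR_ge0// -[leRHS]mul1r; apply: ler_pM; rewrite ?expR_ge0 ?gM//.
  by rewrite -expR0 ler_expR mulNr oppr_le0 mulr_ge0// ltW.
have [intQ _] := integrable_wdkernel B b1 A0 eps0 lam0.
pose F (r : P) := fdkernel (sub2 (t, x) r) * G r.
have intF : mu2.-integrable [set: P] (EFin \o F).
  have := integrable_mulb mG GM (integrable_sub2r (t, x) intQ).
  by apply: eq_integrable => // r _; rewrite mulrC.
rewrite /gconv -[LHS](Rfubini1 intF).
pose c s := Defs.conv (derive1 (Defs.kernel alpha (eps * (t - s)))) (fun y => g (s, y)) x.
have mdk s : 0 < t - s -> measurable_fun [set: T]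
    (fun y => derive1 (Defs.kernel alpha (eps * (t - s))) (x - y) * g (s, y)).
  move=> ts0; under eq_fun do rewrite derive1_kernel//.
  apply: measurable_funM; last exact: (measurableT_comp mg (pair1_measurable (s : T))).
  apply: measurable_funM; first exact: measurable_cst.
  apply: (measurableT_comp (measurable_dstable A B b1)); apply: measurable_funM; last exact: measurable_cst.
  by apply: measurable_funB => //; exact: measurable_cst.
pose h s := if 0 < s < t then c s else 0.
have inner s : \int[leb]_y F (s, y) = expR (- lam * t) * h s.
  rewrite /h; case: ifPn => [/andP[s0 st]|ns]; last first.
    rewrite mulr0 /Rintegral (_ : (fun y => (F (s, y))%:E) = fun=> 0%E) ?integral0//.
    apply/funext => y; congr EFin; rewrite /F /fdkernel /wdkernel /G /sub2 /= subr_gt0.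
    by move: ns; rewrite negb_and; case: (0 < s) => /=; [move/negbTE => ->; rewrite mul0r|rewrite mulr0].
  have ts0 : 0 < t - s by rewrite subr_gt0.
  rewrite /c /Defs.conv -Rintegral_gt0Z ?expR_gt0//; last exact: mdk.
  apply: eq_Rintegral => y _.
  rewrite /F /fdkernel /wdkernel /G /sub2 /= subr_gt0 st s0 derive1_kernel//.
  rewrite (_ : - lam * t = - lam * (t - s) + - lam * s) ?expRD; last by ring.
  by move: (expR _) (expR _) (rate _ _ _ ^+ 2) (dstable _ _ _ _) (g _) => *; ring.
have mh : measurable_fun [set: T] (h : T -> R).
  rewrite (_ : h = fun s => expR (lam * t) * \int[leb]_y F (s, y)).
    by apply: measurable_funM; [exact: measurable_cst|exact: measurable_Rfubini1 intF].
  by apply/funext => s; rewrite inner mulrA -expRD mulNr subrr expR0 mul1r.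
under eq_Rintegral do rewrite inner.
rewrite Rintegral_gt0Z ?expR_gt0//; congr (_ * _).
rewrite /Rintegral [in RHS]integral_mkcond; congr fine; apply: eq_integral => s _.
rewrite /h /patch mem_setE in_itv/=.
by case: (0 < s < t).
Qed.

End duhamel.

Lemma ae_imply2 {d} {X : measurableType d} {K : realFieldType} (nu : {measure set X -> \bar K})
    (E F G : X -> Prop) : (forall x, E x -> F x -> G x) ->
  {ae nu, forall x, E x} -> {ae nu, forall x, F x} -> {ae nu, forall x, G x}.
Proof. by move=> EFG; exact: filterS2. Qed.

(** * The weighted difference of two solutions *)

Section weighted_contraction.
Context {R : realType} (alpha eps : R).
Local Notation leb := (@lebesgue_measure R).
Local Notation mu2 := (prod_measure leb leb).
Local Notation T := (measurableTypeR R).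
Local Notation P := (T * T)%type.
Hypotheses (alpha01 : 0 < alpha < 1) (eps0 : 0 < eps).

Let beta := alpha + 1.
Let A := - cos (beta * pi / 2).
Let B := sin (beta * pi / 2).
Let a0 : 0 < alpha. Proof. by case/andP: alpha01. Qed.
Let b1 : 1 < beta. Proof. by rewrite /beta ltrDr. Qed.
Let A0 : 0 < A. Proof. exact: cos_theta_lt0. Qed.

Lemma measurable_invR : measurable_fun [set: T] (fun x : T => x^-1 : R).
Proof.
rewrite (_ : (fun x : T => x^-1 : R) = fun x : R => Num.sg x * `|x| `^ (-1)).
  apply: measurable_funM; first exact: measurable_sg.
  have mn : measurable_fun [set: T] (fun x : T => `|x| : R).
    by apply: continuous_measurable_fun; exact: norm_continuous.
  exact: (measurableT_comp (measurable_powR (-1)) mn).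
apply/funext => x; rewrite powR_inv1// {1}(numEsg x) invfM.
by rewrite -[(Num.sg x)^-1]/((Num.sg x)^-1); case: sgrP => _; rewrite ?invr0 ?mul0r ?invr1// invrN1.
Qed.

Lemma integrable_reflected (f : T -> R) (x : R) : leb.-integrable [set: T] (EFin \o f) ->
  leb.-integrable [set: T] (EFin \o (fun y : T => f (x - y))).
Proof.
move=> intf; apply: (integrable_invariant (phi := fun y : T => x - y)) => //.
  by apply: measurable_funB => //; exact: measurable_cst.
move=> g mg g0; rewrite -[RHS](ge0_integral_shift x mg g0) -[RHS]ge0_integral_opp//.
  by apply: eq_integral => y _; rewrite addrC.
by apply: (measurableT_comp mg); apply: measurable_funD => //; exact: measurable_cst.
Qed.

Variables (f : R -> R) (u v : P -> R) (u0 v0 : T -> R) (M L : R).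
Hypotheses (mf : measurable_fun [set: T] (f : T -> R)) (mu : measurable_fun [set: P] u)
  (mv : measurable_fun [set: P] v).
Hypotheses (uM : forall p, `|u p| <= M) (vM : forall p, `|v p| <= M).
Hypothesis L0 : 0 < L.
Hypothesis fL : forall x y, `|x| <= M -> `|y| <= M -> `|f x - f y| <= L * `|x - y|.
Hypotheses (u0oo : u0 \in Lfun leb +oo%E) (v0oo : v0 \in Lfun leb +oo%E).
Let w0 : T -> R := fun y => u0 y - v0 y.
Hypothesis intw0 : leb.-integrable [set: T] (EFin \o w0).

Definition mild_rhs (z0 : T -> R) (z : P -> R) (p : P) :=
  Defs.conv (Defs.kernel alpha (eps * p.1)) z0 p.2
  - \int[leb]_(s in `]0, p.1[)
      Defs.conv (derive1 (Defs.kernel alpha (eps * (p.1 - s)))) (fun y => f (z (s, y))) p.2.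

Hypotheses (u_mild : {ae mu2, forall p, 0 < p.1 -> u p = mild_rhs u0 u p})
  (v_mild : {ae mu2, forall p, 0 < p.1 -> v p = mild_rhs v0 v p}).

Definition weighted (lam : R) (z : P -> R) (r : P) : R :=
  if 0 < r.1 then expR (- lam * r.1) * z r else 0.

Lemma measurable_weighted lam z : measurable_fun [set: P] z -> measurable_fun [set: P] (weighted lam z).
Proof.
move=> mz; apply: measurable_fun_ifT; last exact: measurable_cst.
  by apply: measurable_fun_ltr; [exact: measurable_cst|exact: measurable_fst].
apply: measurable_funM => //; apply: (measurableT_comp (@measurable_expR R)).
by apply: measurable_funM; [exact: measurable_cst|exact: measurable_fst].
Qed.

Lemma norm_weighted_le lam z C : 0 < lam -> (forall r, `|z r| <= C) ->
  forall r, `|weighted lam z r| <= C.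
Proof.
move=> lam0 zC r; have C0 : 0 <= C by exact: le_trans (zC r).
rewrite /weighted; case: ifPn => [r0|_]; last by rewrite normr0.
rewrite normrM ger0_norm ?expR_ge0// -[leRHS]mul1r; apply: ler_pM; rewrite ?expR_ge0//.
by rewrite -expR0 ler_expR mulNr oppr_le0 mulr_ge0// ltW.
Qed.

Let diff r := u r - v r.

(** Difference quotient of the flux, which makes the equation of [u - v] linear. Where [u = v] the
    value 0 keeps it bounded and measurable. *)
Definition slope (r : P) : R := if u r == v r then 0 else (f (u r) - f (v r)) / (u r - v r).

Lemma measurable_slope : measurable_fun [set: P] slope.
Proof.
apply: measurable_fun_ifT; [exact: measurable_fun_eqr|exact: measurable_cst|].
apply: measurable_funM; last by apply: (measurableT_comp measurable_invR); exact: measurable_funB.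
by apply: measurable_funB; exact: (measurableT_comp mf).
Qed.

Lemma norm_slope_le r : `|slope r| <= L.
Proof.
rewrite /slope; case: eqVneq => [_|uv]; first by rewrite normr0 ltW.
by rewrite normrM normfV ler_pdivrMr ?normr_gt0 ?subr_eq0// fL.
Qed.

Lemma slope_weighted lam r : slope r * weighted lam diff r =
  weighted lam (f \o u) r - weighted lam (f \o v) r.
Proof.
rewrite /weighted /slope /diff /=; case: (0 < r.1); last by rewrite mulr0 subrr.
case: eqVneq => [->|uv]; first by rewrite mul0r subrr.
by field; rewrite subr_eq0.
Qed.

Lemma bounded_flux : exists C, forall r, `|f (u r)| <= C /\ `|f (v r)| <= C.
Proof.
have M0 : 0 <= M by exact: le_trans (uM (0, 0)).
have h x : `|x| <= M -> `|f x| <= `|f 0| + L * M.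
  move=> xM; rewrite -(subrK (f 0) (f x)) addrC (le_trans (ler_normD _ _))// lerD2l.
  by rewrite (le_trans (fL _ _))// ?normr0// subr0 ler_wpM2l// ltW.
by exists (`|f 0| + L * M) => r; split; exact: h.
Qed.

Variable lam : R.
Hypothesis lam0 : 0 < lam.

Let k := fkernel alpha eps lam.
Let Q := fdkernel alpha eps lam.

Let intQ : mu2.-integrable [set: P] (EFin \o Q).
Proof. by have [] := integrable_wdkernel B b1 A0 eps0 lam0. Qed.

Let k_mass (t : R) : 0 < t -> (\int[leb]_x (k (t, x))%:E <= (expR (- lam * t))%:E)%E.
Proof. exact: (wkernel_mass b1 A0 eps0 (fractional_ge0 alpha01) lam). Qed.

Lemma integrable_kernel (s x : R) : 0 < s ->
  leb.-integrable [set: T] (EFin \o (fun y => Defs.kernel alpha s (x - y))).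
Proof.
move=> s0; apply: (integrable_reflected (f := Defs.kernel alpha s)).
rewrite (_ : Defs.kernel alpha s = stable beta A B s); last by apply/funext => y; rewrite kernelE.
exact: (integrable_stable b1 A0 (fractional_ge0 alpha01) s0).
Qed.

Lemma gconv_weighted (z : P -> R) (C : R) (p : P) : measurable_fun [set: P] z ->
  (forall r, `|z r| <= C) -> mu2.-integrable [set: P] (fun r => (Q (sub2 p r) * weighted lam z r)%:E).
Proof.
move=> mz zC; have := integrable_mulb (measurable_weighted lam mz) (norm_weighted_le lam0 zC)
  (integrable_sub2r p intQ).
by apply: eq_integrable => // r _; rewrite mulrC.
Qed.

(** The difference of the two mild equations times [exp(- lam t)], with [slope_weighted] for the
    fluxes; at [t <= 0] both sides vanish. The convolutions with [u0] and [v0] can be subtracted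
    since both data are essentially bounded and the kernel is integrable. *)
Lemma weighted_mild : {ae mu2, forall p, weighted lam diff p =
  gconv sub2 source0 k (datum w0) p - gconv sub2 mu2 Q (fun r => slope r * weighted lam diff r) p}.
Proof.
have mw0 := measurable_of_integrable intw0.
have [C fC] := bounded_flux.
have mfu : measurable_fun [set: P] (f \o u) by exact: (measurableT_comp mf mu).
have mfv : measurable_fun [set: P] (f \o v) by exact: (measurableT_comp mf mv).
pose U (z0 : T -> R) (z : P -> R) (p : P) := 0 < p.1 -> z p = mild_rhs z0 z p.
apply: (ae_imply2 (E := U u0 u) (F := U v0 v) _ u_mild v_mild) => -[t x] uE vE.
have eQ : gconv sub2 mu2 Q (fun r => slope r * weighted lam diff r) (t, x) =
    gconv sub2 mu2 Q (weighted lam (f \o u)) (t, x) - gconv sub2 mu2 Q (weighted lam (f \o v)) (t, x).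
  rewrite /gconv -RintegralB//; last 2 first.
  - exact: (gconv_weighted (t, x) mfu (fun r => (fC r).1)).
  - exact: (gconv_weighted (t, x) mfv (fun r => (fC r).2)).
  by apply: eq_Rintegral => r _; rewrite slope_weighted mulrBr.
have [t0|t0] := ltP 0 t; last first.
  rewrite {1}/weighted /= ltNge t0/=.
  have -> : gconv sub2 source0 k (datum w0) (t, x) = 0.
    rewrite /gconv Rintegral_source0; last first.
      apply: measurable_funM; last by exact: (measurableT_comp mw0 measurable_snd).
      by apply: (measurableT_comp (measurable_wkernel A B eps b1 lam)); exact: measurable_sub2r.
    rewrite /Rintegral (_ : (fun y => _) = fun=> 0%E) ?integral0//.
    by apply/funext => y; rewrite /k /fkernel wkernel_neg ?mul0r//= subr0.
  suff -> : gconv sub2 mu2 Q (fun r => slope r * weighted lam diff r) (t, x) = 0 by rewrite subrr.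
  rewrite /gconv /Rintegral (_ : (fun r => _) = fun=> 0%E) ?integral0//.
  apply/funext => r; congr EFin; rewrite /Q /fdkernel /wdkernel /weighted /sub2 /= subr_gt0.
  case: ifPn => [rt|_]; last by rewrite mul0r.
  by rewrite ltNge (ltW (lt_le_trans rt t0))/= !mulr0.
rewrite eQ (conv_kernel_source eps lam alpha01 x mw0 t0).
rewrite (duhamel_gconv alpha01 eps0 lam0 x mfu (fun r _ => (fC r).1) t0).
rewrite (duhamel_gconv alpha01 eps0 lam0 x mfv (fun r _ => (fC r).2) t0).
rewrite /weighted /= t0 /diff uE// vE// /mild_rhs /=.
have et0 : 0 < eps * t by rewrite mulr_gt0.
have -> : Defs.conv (Defs.kernel alpha (eps * t)) w0 x =
    Defs.conv (Defs.kernel alpha (eps * t)) u0 x - Defs.conv (Defs.kernel alpha (eps * t)) v0 x.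
  rewrite /Defs.conv -RintegralB//; last 2 first.
  - exact: (integrable_Linf u0oo (integrable_kernel x et0)).
  - exact: (integrable_Linf v0oo (integrable_kernel x et0)).
  by apply: eq_Rintegral => y _; rewrite /w0 mulrBr.
ring.
Qed.

Hypothesis smallQ : nrm1 mu2 Q * L <= 4^-1.

Lemma weighted_contraction (D : set T) : measurable D ->
  (\int[leb]_(t in D) \int[leb]_x `|weighted lam diff (t, x)|%:E <=
   (nrm1 leb w0)%:E * \int[leb]_(t in D) (decay lam t)%:E)%E.
Proof.
have mk : measurable_fun [set: P] k := measurable_wkernel A B eps b1 lam.
have k_ge0 p : 0 <= k p by exact: (wkernel_ge0 eps0 (fractional_ge0 alpha01)).
have k_neg (p : P) : p.1 <= 0 -> k p = 0 by exact: wkernel_neg.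
have k_semi (s t x : R) : 0 < s -> 0 < t -> (\int[leb]_y (k (t, x - y) * k (s, y))%:E = (k (t + s, x))%:E)%E.
  exact: (wkernel_semigroup b1 A0 eps0 (fractional_ge0 alpha01)).
have intk : mu2.-integrable [set: P] (EFin \o k).
  by have := integrable_damped mk k_ge0 k_neg k_mass lam0 (lexx 0); rewrite damped0.
have inth : mu2.-integrable [set: P] (EFin \o gconv sub2 source0 k (datum w0)).
  exact: (integrable_gconv measurable_sub2 ge0_integral_sub2l intk (integrable_datum intw0)).
have mdiff : measurable_fun [set: P] diff by exact: measurable_funB.
have dM r : `|diff r| <= M + M by rewrite (le_trans (ler_normB _ _))// lerD.
have intW := bounded_integrable measurable_slope norm_slope_le L0 inth intQ
  (measurable_weighted lam mdiff) (norm_weighted_le lam0 dM) weighted_mild smallQ.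
have qc eta (eta0 : 0 < eta) := wkernel_quotient_cvg b1 A0 eps0 (fractional_ge0 alpha01) lam0 eta0.
exact: (contraction mk k_ge0 k_neg k_mass k_semi lam0 measurable_slope norm_slope_le L0 intw0 intQ intW
  weighted_mild qc smallQ).
Qed.

End weighted_contraction.

Lemma ae_imply {d} {X : measurableType d} {K : realFieldType} (nu : {measure set X -> \bar K})
    (E F : X -> Prop) : (forall x, E x -> F x) -> {ae nu, forall x, E x} -> {ae nu, forall x, F x}.
Proof. by move=> EF; exact: filterS. Qed.

(** * From integrated bounds to every positive time *)

Section all_times.
Context {R : realType}.
Local Notation leb := (@lebesgue_measure R).
Local Notation mu2 := (prod_measure leb leb).
Local Notation T := (measurableTypeR R).
Local Notation P := (T * T)%type.

Lemma limn_einf_le (a : (\bar R)^nat) (c : \bar R) : (forall n, (a n <= c)%E) ->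
  (limn_einf a <= c)%E.
Proof.
move=> ac; rewrite limn_einf_lim; apply: lime_le; first exact: is_cvg_einfs.
apply: nearW => n; apply: (le_trans _ (ac n)); apply: ereal_inf_lbound.
by exists n => //=.
Qed.

Variables (w : P -> R) (lam c : R).
Hypotheses (lam0 : 0 < lam) (mw : measurable_fun [set: P] w).
Hypothesis wc : forall D : set T, measurable D ->
  (\int[leb]_(t in D) \int[leb]_x `|weighted lam w (t, x)|%:E <=
   c%:E * \int[leb]_(t in D) (decay lam t)%:E)%E.

Let Phi (s : T) : \bar R := (\int[leb]_x `|w (s, x)|%:E)%E.

Let mwx (s : T) : measurable_fun [set: T] (fun x : T => w (s, x)).
Proof. exact: (measurableT_comp mw (pair1_measurable s)). Qed.

(** Otherwise the norm is at least [c + eta] throughout []t, t + d[]. The factor [exp(- lam s)]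
    stands on both sides of [wc] and has a finite positive integral there, so integration would give
    [c + eta <= c]. *)
Lemma exists_small_time (t d eta : R) : 0 < t -> 0 < d -> 0 < eta ->
  exists s, [/\ t < s, s < t + d & (Phi s <= (c + eta)%:E)%E].
Proof.
move=> t0 d0 eta0; apply: contrapT => nex.
have big s : t < s -> s < t + d -> ((c + eta)%:E <= Phi s)%E.
  move=> ts sd; rewrite leNgt; apply/negP => h; apply: nex; exists s; split => //.
  exact: ltW.
pose D : set T := `]t, (t + d)[%classic.
have mD : measurable D by exact: measurable_itv.
have decE s : D s -> decay lam s = expR (- lam * s).
  rewrite /D /= in_itv/= => /andP[ts _]; rewrite /decay patchE mem_set//=.
  by rewrite in_itv/= andbT ltW// (lt_trans t0).
have mdec : measurable_fun D (fun s : T => (decay lam s)%:E).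
  apply/measurable_EFinP; apply: measurable_funTS; exact: measurable_decay.
set I := (\int[leb]_(s in D) (decay lam s)%:E)%E.
have lD : leb D = d%:E.
  by rewrite /D lebesgue_measure_itv/= lte_fin ltrDl d0 -EFinD addrAC subrr add0r.
have I0 : (0 <= I)%E by apply: integral_ge0 => s _; rewrite lee_fin decay_ge0.
have Ioo : (I < +oo)%E.
  apply: (@le_lt_trans _ _ (\int[leb]_(s in D) 1%:E)%E).
    apply: ge0_le_integral => //.
    - by move=> s _; rewrite lee_fin decay_ge0.
    - by move=> s Ds; rewrite lee_fin (decE s Ds) -expR0 ler_expR mulNr oppr_le0 mulr_ge0 ?ltW//;
        move: Ds; rewrite /D /= in_itv/= => /andP[ts _]; exact: lt_trans ts.
  rewrite integral_cst// mul1e; have := ltry d; rewrite -lD; exact.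
have Ipos : (0 < I)%E.
  apply: (@lt_le_trans _ _ (\int[leb]_(s in D) (expR (- lam * (t + d)))%:E)%E).
    rewrite integral_cst//; have : (0 < (expR (- lam * (t + d)))%:E * d%:E)%E by rewrite -EFinM lte_fin mulr_gt0// expR_gt0.
    by rewrite -lD; exact.
  apply: ge0_le_integral => //.
  - move=> s Ds; rewrite lee_fin (decE s Ds) ler_expR !mulNr lerN2 ler_wpM2l ?ltW//.
    by move: Ds; rewrite /D /= in_itv/= => /andP[_].
have h : ((c + eta)%:E * I <= c%:E * I)%E.
  apply: (le_trans _ (wc mD)).
  have c0 : 0 <= c + eta.
    have : (0 <= c%:E * I)%E.
      by apply: (le_trans _ (wc mD)); apply: integral_ge0 => s _; apply: integral_ge0 => x _; rewrite lee_fin.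
    move: I0 Ipos Ioo; case: I => [r| |]// _ r0 _; rewrite -EFinM lee_fin pmulr_lge0// => c0.
    by rewrite addr_ge0// ltW.
  rewrite -ge0_integralZl//; last by move=> s _; rewrite lee_fin decay_ge0.
  apply: ge0_le_integral => //.
  - by move=> s _; rewrite -EFinM lee_fin mulr_ge0 ?decay_ge0.
  - by apply: measurable_funeM.
  - apply: measurable_funTS; apply: (@measurable_fun_fubini_tonelli_F _ _ T T R leb (fun p : P => `|weighted lam w p|%:E)) => //.
    by apply/measurable_EFinP; apply: measurableT_comp => //; exact: measurable_weighted.
  move=> s Ds; rewrite (decE s Ds); move: Ds; rewrite /D /= in_itv/= => /andP[ts sd].
  have s0 : 0 < s by exact: lt_trans ts.
  have -> : (\int[leb]_x `|weighted lam w (s, x)|%:E = (expR (- lam * s))%:E * Phi s)%E.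
    rewrite /Phi -ge0_integralZl//; last by apply/measurable_EFinP; apply: measurableT_comp.
    by apply: eq_integral => x _; rewrite /weighted /= s0 normrM ger0_norm ?expR_ge0.
  by rewrite muleC lee_pmul2l ?lte_fin ?expR_gt0// big.
move: I0 Ipos Ioo h; case: I => [r| |]// _ r0 _; rewrite -!EFinM lee_fin ler_pM2r//.
by rewrite gerDl leNgt eta0.
Qed.

Lemma contraction_at (t : R) : 0 < t -> (forall x, {for (t, x), continuous w}) ->
  (\int[leb]_x `|w (t, x)|%:E <= c%:E)%E.
Proof.
move=> t0 cw; apply/lee_addgt0Pr => eta eta0; rewrite -EFinD.
have /choice[s hs] (n : nat) : exists s, [/\ t < s, s < t + n.+1%:R^-1 & (Phi s <= (c + eta)%:E)%E].
  by apply: exists_small_time => //; rewrite invr_gt0.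
have cs : s n @[n --> \oo] --> t.
  apply: (squeeze_cvgr (f := fun=> t) (h := fun n => t + n.+1%:R^-1)).
  - by apply: nearW => n; have [h1 h2 _] := hs n; rewrite !ltW.
  - exact: cvg_cst.
  - have : t + n.+1%:R^-1 @[n --> \oo] --> t + 0 by apply: cvgD; [exact: cvg_cst|exact: cvg_harmonic].
    by rewrite addr0.
have lim x : limn_einf (fun n => `|w (s n, x)|%:E) = `|w (t, x)|%:E.
  have cv : `|w (s n, x)|%:E @[n --> \oo] --> `|w (t, x)|%:E.
    apply: cvg_EFin; first exact: nearW.
    apply: cvg_norm; apply: (cvg_comp (fun n => (s n, x)) w); last exact: cw.
    exact: (cvg_pair cs (cvg_cst x)).
  by rewrite is_cvg_limn_einfE; [exact: cvg_lim|apply/cvg_ex; eexists; exact: cv].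
under eq_integral do rewrite -lim.
apply: (@le_trans _ _ (limn_einf (fun n => Phi (s n)))).
  apply: (@fatou _ _ _ leb _ measurableT (fun n x => `|w (s n, x)|%:E)) => //.
  by move=> n; apply/measurable_EFinP; apply: measurableT_comp.
by apply: limn_einf_le => n; have [] := hs n.
Qed.

End all_times.

(** * Representatives bounded in the whole plane *)

Section positive_times.
Context {R : realType} (alpha eps : R) (f : R -> R).
Local Notation leb := (@lebesgue_measure R).
Local Notation mu2 := (prod_measure leb leb).
Local Notation T := (measurableTypeR R).
Local Notation P := (T * T)%type.

Lemma smooth_measurable : smooth f -> measurable_fun [set: T] (f : T -> R).
Proof.
move=> sf; apply: continuous_measurable_fun => x.
by apply: differentiable_continuous; apply/derivable1_diffP; exact: (sf 0%N x).
Qed.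

Lemma open_strip : open (strip (+oo%E : \bar R)).
Proof.
rewrite (_ : strip _ = fst @^-1` [set x : R | 0 < x]).
  by apply: open_comp; [move=> p _; exact: cvg_fst|exact: open_gt].
by apply/seteqP; split => p /=; [case|move=> p0; split; rewrite ?ltry].
Qed.

(** A mild solution says nothing about [t <= 0]; the value 0 there makes measurability and
    boundedness hold in the whole plane. *)
Definition at_positive_times (w : R -> R -> R) (p : P) : R := if 0 < p.1 then w p.1 p.2 else 0.

Lemma mild_solution_at_positive_times (w0 : R -> R) (w : R -> R -> R) :
  mild_solution alpha eps f +oo%E w0 w -> smooth_on (strip +oo%E) (fun p => w p.1 p.2) ->
  [/\ measurable_fun [set: P] (at_positive_times w),
      exists M, forall p, `|at_positive_times w p| <= M,
      {ae mu2, forall p, 0 < p.1 -> at_positive_times w p = mild_rhs alpha eps f w0 (at_positive_times w) p} &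
      forall t x, 0 < t -> {for (t, x), continuous (at_positive_times w)}].
Proof.
move=> [wL wE] ws; set w' := at_positive_times w.
have w'E : ((fun p : R * R => w p.1 p.2) \_ (strip +oo%E)) = w'.
  apply/funext => p; rewrite patchE /w' /at_positive_times; case: ifPn => [|].
    by rewrite inE => -[->].
  rewrite notin_setE => np; case: ifPn => // p0; exfalso; apply: np; split => //.
  exact: ltry.
have stripE (p : R * R) : 0 < p.1 -> strip +oo%E p by move=> p0; split => //; exact: ltry.
have cw (p : R * R) : strip +oo%E p -> {for p, continuous (fun p : R * R => w p.1 p.2)}.
  by have [+ _] := ws 0%N; apply.
have [mw' [M wM]] := Lfun_pinfty_bounded wL.
have cw' t x : 0 < t -> {for (t, x), continuous w'}.
  move=> t0; have h : \forall p \near ((t, x) : R * R), w p.1 p.2 = w' p.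
    have : \forall p \near ((t, x) : R * R), strip +oo%E p.
      by apply: open_nbhs_nbhs; split; [exact: open_strip|exact: stripE].
    by apply: filterS => p [p0 _]; rewrite /w' /at_positive_times p0.
  rewrite /prop_for /continuous_at {2}/w' /at_positive_times /= t0.
  apply: cvg_trans (cw (t, x) (stripE (t, x) t0)); apply: near_eq_cvg; exact: h.
split => //.
- by rewrite -w'E.
(* By continuity the essential bound holds at every point of the open half-plane. *)
- have h (p : R * R) : strip +oo%E p -> `|w p.1 p.2| <= M.
    apply: (continuous_ae_bound open_strip cw).
    by apply: filterS wM => q + sq; rewrite patchE mem_set.
  exists (Num.max M 0) => p; rewrite /w' /at_positive_times; case: ifPn => [p0|_].
    by rewrite le_max (h p (stripE p p0)).
  by rewrite normr0 le_max lexx orbT.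
pose E (p : P) := strip +oo%E (p : R * R) -> w p.1 p.2 = mild_rhs alpha eps f w0 (fun p => w p.1 p.2) p.
have wE' : {ae mu2, forall p, E p} := wE.
apply: (ae_imply _ wE') => -[t x] h t0.
rewrite /w' {1}/at_positive_times /= t0 h; last exact: stripE.
(* The time integral runs over [s > 0], where the two representatives coincide. *)
rewrite /mild_rhs /=; congr (_ - _); apply: eq_Rintegral => s; rewrite inE/= in_itv/= => /andP[s0 _].
by congr Defs.conv; apply/funext => y; rewrite /= /at_positive_times /= s0.
Qed.

End positive_times.

Theorem theorem3p2 (R : realType) (alpha eps : R) (f u0 v0 : R -> R)
    (u v : R -> R -> R) :
  0 < alpha < 1 -> smooth f -> 0 < eps ->
  u0 \in Lfun (@lebesgue_measure R) +oo%E ->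
  v0 \in Lfun (@lebesgue_measure R) +oo%E ->
  u0 \- v0 \in Lfun (@lebesgue_measure R) 1%E ->
  mild_solution alpha eps f +oo%E u0 u ->
  smooth_on (strip +oo%E) (fun p => u p.1 p.2) ->
  mild_solution alpha eps f +oo%E v0 v ->
  smooth_on (strip +oo%E) (fun p => v p.1 p.2) ->
  forall t : R, 0 < t ->
    u t \- v t \in Lfun (@lebesgue_measure R) 1%E /\
    ('N[@lebesgue_measure R]_1[EFin \o (u t \- v t)%R] <=
     'N[@lebesgue_measure R]_1[EFin \o (u0 \- v0)%R])%E.
Proof.
move=> alpha01 sf eps0 u0L v0L /Lfun1_integrable intw0 um us vm vs t t0.
have a0 : 0 < alpha by case/andP: alpha01.
have b1 : 1 < alpha + 1 by rewrite ltrDr.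
have A0 := cos_theta_lt0 alpha01.
have [mu' [Mu uMu] uE cu] := mild_solution_at_positive_times um us.
have [mv' [Mv vMv] vE cv] := mild_solution_at_positive_times vm vs.
set u' := at_positive_times u in mu' uMu uE cu.
set v' := at_positive_times v in mv' vMv vE cv.
pose M := Num.max Mu Mv.
have uM p : `|u' p| <= M by rewrite le_max uMu.
have vM p : `|v' p| <= M by rewrite le_max vMv orbT.
have M0 : 0 <= M by apply: le_trans (uM (0, 0)).
have [L [L0 fL]] := smooth_lipschitz sf M0.
(* The Lipschitz constant of the flux on the common range of both solutions decides how large [lam]
   must be. *)
have e0 : 0 < 4^-1 / L by rewrite divr_gt0// invr_gt0.
have [lam lam0 small] := small_wdkernel (sin ((alpha + 1) * pi / 2)) b1 A0 eps0 e0.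
have smallQ : nrm1 (prod_measure (@lebesgue_measure R) (@lebesgue_measure R)) (fdkernel alpha eps lam) * L <= 4^-1.
  by rewrite -ler_pdivlMr.
have wc := weighted_contraction alpha01 eps0 (smooth_measurable sf) mu' mv' uM vM L0 fL u0L v0L intw0 uE vE lam0 smallQ.
have mw : measurable_fun setT (fun p => u' p - v' p) by exact: measurable_funB.
have cw x : {for (t, x), continuous (fun p => u' p - v' p)}.
  by apply: continuousB; [exact: cu|exact: cv].
have key := contraction_at lam0 mw wc t0 cw.
have wE x : u' (t, x) - v' (t, x) = (u t \- v t) x by rewrite /u' /v' /at_positive_times /= t0.
have {}key : (\int[@lebesgue_measure R]_x `|(EFin \o (u t \- v t)%R) x| <=
    (nrm1 (@lebesgue_measure R) (fun y => u0 y - v0 y))%:E)%E.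
  by apply: le_trans key; rewrite le_eqVlt; apply/orP; left; apply/eqP; apply: eq_integral => x _; rewrite wE.
have intw : (@lebesgue_measure R).-integrable [set: measurableTypeR R] (EFin \o (u t \- v t)).
  apply/integrableP; split.
    apply/measurable_EFinP; have := measurableT_comp mw (pair1_measurable (t : measurableTypeR R)).
    by apply: eq_measurable_fun => x _; rewrite /= wE.
  exact: (le_lt_trans key (ltry _)).
split; first exact/Lfun1_integrable.
rewrite !Lnorm1; have -> := esym (EFin_nrm1 intw0).
exact: key.
Qed.
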